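(* Let $d \in \mathbb{N}$ (i.e. $d\ge 1$), let $\mathcal{M} = \mathbb{R}^d$ or $\mathcal{M} = \mathbb{T}^d = \mathbb{R}^d/(2\pi\mathbb{Z})^d$, and let $s \in \mathbb{R}$ with $s \le -\frac{2}{3}$. Then, for every $\varepsilon > 0$, there exist a solution $u_\varepsilon$ to the cubic nonlinear heat equation $$\partial_t u - \Delta u + u^3 = 0$$ on $\mathcal{M}$ (with initial data $u_\varepsilon(0)$ at time $t=0$) and a time $t_\varepsilon \in (0,\varepsilon)$, belonging to the time interval on which $u_\varepsilon$ is defined, such that $$\|u_\varepsilon(0)\|_{\mathcal{C}^s(\mathcal{M})} < \varepsilon \qquad \text{and} \qquad \|\mathbf{P}_0 u_\varepsilon(t_\varepsilon)\|_{L^\infty(\mathcal{M})} > \varepsilon^{-1}.$$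
   Context: Littlewood-Paley projectors. Let $\widehat{\mathcal{M}}$ be the Pontryagin dual of $\mathcal{M}$: $\widehat{\mathcal{M}} = \mathbb{R}^d$ if $\mathcal{M} = \mathbb{R}^d$, and $\widehat{\mathcal{M}} = \mathbb{Z}^d$ if $\mathcal{M} = \mathbb{T}^d$. For $j \in \mathbb{N}\cup\{0\}$, $\mathbf{P}_j$ is the standard non-homogeneous (smooth) Littlewood-Paley projector onto frequencies $\{\xi \in \widehat{\mathcal{M}} : |\xi| \sim 2^j\}$ for $j \ge 1$ and $\{\xi \in \widehat{\mathcal{M}} : |\xi| \lesssim 1\}$ for $j = 0$. Concretely, fix a smooth radial function $\varphi:\mathbb{R}^d \to [0,1]$ with $\varphi(\xi) = 1$ for $|\xi|\le 1$ and $\varphi(\xi) = 0$ for $|\xi| \ge 2$; then $\mathbf{P}_0$ is the Fourier multiplier with symbol $\varphi(\xi)$, and for $j \ge 1$, $\mathbf{P}_j$ is the Fourier multiplier with symbol $\varphi(2^{-j}\xi) - \varphi(2^{-j+1}\xi)$, restricted to $\xi \in \widehat{\mathcal{M}}$. Hölder-Besov space. For $s \in \mathbb{R}$, $\mathcal{C}^s(\mathcal{M}) = B^s_{\infty,\infty}(\mathcal{M})$ is the Besov space with norm $$\|u\|_{\mathcal{C}^s(\mathcal{M})} = \sup_{j \in \mathbb{N}\cup\{0\}} 2^{js}\|\mathbf{P}_j u\|_{L^\infty(\mathcal{M})}.$$ Solutions. A solution to $\partial_t u - \Delta u + u^3 = 0$ on $\mathcal{M}$ with $u|_{t=0} = u_0$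 is a function $u \in C([0,T];\mathcal{C}^{s_0}(\mathcal{M}))$, for some $T>0$ and some $s_0 > 0$, satisfying the Duhamel formulation $$u(t) = e^{t\Delta}u_0 - \int_0^t e^{(t-t')\Delta}\big(u(t')^3\big)\,dt', \qquad t \in [0,T],$$ where $e^{t\Delta}$ denotes the heat semigroup on $\mathcal{M}$. *)

(* Defs.v *)
From HB Require Import structures.
From mathcomp Require Import all_boot all_order all_algebra.
From mathcomp Require Import complex.
From mathcomp Require Import all_classical all_reals all_analysis.

Set Implicit Arguments.
Unset Strict Implicit.
Unset Printing Implicit Defensive.

Import Order.TTheory GRing.Theory Num.Theory.
Import numFieldNormedType.Exports.

Local Open Scope classical_set_scope.
Local Open Scope ring_scope.
Local Open Scope complex_scope.

Section LebesgueMeasure.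
Context {R : realType}.

Local Notation Rn n := (n.-tuple (measurableTypeR R)).

Definition consT n (x : measurableTypeR R * Rn n) : Rn n.+1 :=
  [the n.+1.-tuple _ of x.1 :: x.2].

Lemma measurable_consT n : measurable_fun setT (@consT n).
Proof. exact: measurable_cons. Qed.

Lemma consT_bij n : bijective (@consT n).
Proof.
exists (fun t : Rn n.+1 => (thead t, [tuple of behead t])) => [[x t]|t].
  by rewrite theadE; congr pair; apply: val_inj.
by rewrite [RHS]tuple_eta; apply: val_inj.
Qed.

Section Step.
Context n (m : {sigma_finite_measure set (Rn n) -> \bar R}).

Definition leb_step : set (Rn n.+1) -> \bar R :=
  pushforward (@lebesgue_measure R \x m)%E (@consT n).

Let mu1 : {measure set (Rn n.+1) -> \bar R} :=
  measure_function_pushforward__canonical__measure_function_Measure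
    (@lebesgue_measure R \x m)%E (@measurable_consT n).

HB.instance Definition _ := isMeasure.Build _ _ _ leb_step
  (measure0 mu1) (measure_ge0 mu1) (@measure_semi_sigma_additive _ _ _ mu1).

Let leb_step_sigma_finite : sigma_finite setT leb_step.
Proof.
have [g gK Kg] := @consT_bij n.
have mg : measurable_fun setT g.
  have -> : g = (fun t : Rn n.+1 => (thead t, [tuple of behead t])).
    apply/funext => t; apply: (bij_inj (@consT_bij n)); rewrite Kg.
    by rewrite [LHS]tuple_eta; apply: val_inj.
  apply: measurable_fun_pair; last exact: measurable_behead.
  exact: measurable_tnth.
have /sigma_finiteP[F [FT ndF Foo]] := sigma_finiteT (@lebesgue_measure R).
have /sigma_finiteP[G [GT ndG Goo]] := sigma_finiteT m.
exists (fun k => g @^-1` (F k `*` G k)) => [|k].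
  apply/seteqP; split => // t _.
  have [i _ Fi] : (\bigcup_k F k) (g t).1 by rewrite -FT.
  have [j _ Gj] : (\bigcup_k G k) (g t).2 by rewrite -GT.
  exists (maxn i j) => //; split.
  - by move: Fi; exact/subsetPset/ndF/leq_maxl.
  - by move: Gj; exact/subsetPset/ndG/leq_maxr.
have [mF Fk] := Foo k; have [mG Gk] := Goo k; split.
  by rewrite -[X in measurable X]setTI; apply: mg => //; exact: measurableX.
rewrite /leb_step /pushforward -comp_preimage (_ : g \o _ = id).
  by rewrite preimage_id product_measure1E// lte_mul_pinfty// ge0_fin_numE.
by apply/funext => x /=; rewrite gK.
Qed.

HB.instance Definition _ :=
  Measure_isSigmaFinite.Build _ _ _ leb_step leb_step_sigma_finite.
End Step.

Fixpoint lebesgue_Rn n : {sigma_finite_measure set (Rn n) -> \bar R} :=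
  match n with
  | 0 => dirac [tuple]
  | n'.+1 => leb_step (lebesgue_Rn n')
  end.
End LebesgueMeasure.

(* [lebesgue_measure] lives on R and products of it on nested pairs; the
   measure on R^n is built on n-tuples (product sigma-algebra) and functions on
   R^n are functions of row vectors, evaluated at [rVtuple t]. *)
Definition rVtuple {R : realType} n (t : n.-tuple (measurableTypeR R)) :
  'rV[R]_n := \row_i tnth t i.

Definition dot {R : realType} n (x y : 'rV[R]_n) : R := \sum_i x 0 i * y 0 i.

(* The norm of ['rV[R]_n] in the library is the sup norm. *)
Definition enorm {R : realType} n (x : 'rV[R]_n) : R := Num.sqrt (dot x x).

Fixpoint class_C {R : realType} n (k : nat) (f : 'rV[R]_n -> R) : Prop :=
  match k with
  | 0 => continuous f
  | k'.+1 => (forall x, differentiable f x) /\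
             (forall v, class_C k' (fun x => 'D_v f x))
  end.

Definition smooth {R : realType} n (f : 'rV[R]_n -> R) := forall k, class_C k f.

Record lp_cutoff {R : realType} n (phi : 'rV[R]_n -> R) : Prop := {
  lp_smooth : smooth phi ;
  lp_radial : forall x y, enorm x = enorm y -> phi x = phi y ;
  lp_range : forall x, 0 <= phi x <= 1 ;
  lp_one : forall x, enorm x <= 1 -> phi x = 1 ;
  lp_zero : forall x, 2 <= enorm x -> phi x = 0 }.

(* Functions on T^n = R^n / (2 pi Z)^n are represented by periodic functions on
   R^n, and integrals and norms over T^n are taken over a fundamental cell. *)
Inductive flat_space := Euclidean | Torus.

Definition defined_on {R : realType} n (M : flat_space) (f : 'rV[R]_n -> R) : Prop :=
  match M with
  | Euclidean => True
  | Torus => forall i x, f (x + (2 * pi) *: delta_mx 0 i) = f x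
  end.

Definition cell {R : realType} n (M : flat_space) :
    set (n.-tuple (measurableTypeR R)) :=
  match M with
  | Euclidean => setT
  | Torus => [set t | forall i, 0 <= tnth t i <= 2 * pi]
  end.

Definition cis {R : realType} (a : R) : R[i] := cos a +i* sin a.

Definition cintegral {R : realType} d (T : measurableType d)
    (mu : {measure set T -> \bar R}) (D : set T) (f : T -> R[i]) : R[i] :=
  Rintegral mu D (fun x => complex.Re (f x)) +i*
  Rintegral mu D (fun x => complex.Im (f x)).

Definition clim {R : realType} (f : nat -> R[i]) : R[i] :=
  limn (fun N => complex.Re (f N)) +i* limn (fun N => complex.Im (f N)).

Definition inv_fourier {R : realType} n (m : 'rV[R]_n -> R) (x : 'rV[R]_n) :
    R[i] :=
  ((2 * pi) ^- n)%:C *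
  cintegral (@lebesgue_Rn R n) setT
    (fun t => (m (rVtuple t))%:C * cis (dot x (rVtuple t))).

Definition fourier_coef {R : realType} n (f : 'rV[R]_n -> R) (k : 'rV[R]_n) :
    R[i] :=
  ((2 * pi) ^- n)%:C *
  cintegral (@lebesgue_Rn R n) (cell Torus)
    (fun t => (f (rVtuple t))%:C * cis (- dot k (rVtuple t))).

(* The lattice point c - (N, ..., N): as c ranges over {0, ..., 2N}^n it ranges
   over the points of Z^n with coordinates at most N in absolute value. *)
Definition box_point {R : realType} n N (c : {ffun 'I_n -> 'I_(N.*2.+1)}) :
  'rV[R]_n := \row_i ((c i)%:R - N%:R).

(* The Fourier multiplier with symbol [m]: the Fourier series of symbol times
   coefficients on T^n, and convolution with the inverse Fourier transform of
   the symbol on R^n. It is applied below only to bounded continuous functions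
   and to symbols that are either smooth with compact support or Gaussian, so
   that the integrals and the series converge absolutely. *)
Definition multiplier {R : realType} n (M : flat_space) (m f : 'rV[R]_n -> R)
    (x : 'rV[R]_n) : R[i] :=
  match M with
  | Euclidean =>
      cintegral (@lebesgue_Rn R n) setT
        (fun t => inv_fourier m (x - rVtuple t) * (f (rVtuple t))%:C)
  | Torus =>
      clim (fun N => \sum_(c : {ffun 'I_n -> 'I_(N.*2.+1)})
        (m (box_point c))%:C * fourier_coef f (box_point c) *
        cis (dot (box_point c) x))
  end.

Definition lp_symbol {R : realType} n (phi : 'rV[R]_n -> R) (j : nat) :
    'rV[R]_n -> R :=
  match j with
  | 0 => phi
  | j'.+1 => fun xi => phi (2 ^- j'.+1 *: xi) - phi (2 ^- j' *: xi)
  end.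

Definition lp_proj {R : realType} n (M : flat_space) (phi : 'rV[R]_n -> R) (j : nat)
    (f : 'rV[R]_n -> R) : 'rV[R]_n -> R[i] :=
  multiplier M (lp_symbol phi j) f.

Definition norm_Linfty {R : realType} n (M : flat_space) (g : 'rV[R]_n -> R[i]) :
    \bar R :=
  Lnorm (@lebesgue_Rn R n) +oo%E
    (fun t => (\1_(cell M) t * Normc.normc (g (rVtuple t)))%:E).

Definition norm_Cs {R : realType} n (M : flat_space) (phi : 'rV[R]_n -> R) (s : R)
    (f : 'rV[R]_n -> R) : \bar R :=
  ereal_sup (range (fun j : nat =>
    ((2 `^ (j%:R * s))%R%:E * norm_Linfty M (lp_proj M phi j f))%E)).

(* For s > 0 the elements of C^s are bounded and have a unique continuous
   representative, so no distributions are needed. *)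
Record in_Cs {R : realType} n (M : flat_space) (phi : 'rV[R]_n -> R) (s : R)
    (f : 'rV[R]_n -> R) : Prop := {
  Cs_domain : defined_on M f ;
  Cs_continuous : continuous f ;
  Cs_bounded : exists B, forall x, `|f x| <= B ;
  Cs_norm : (norm_Cs M phi s f < +oo)%E }.

(* The symbol 1 of the identity is not integrable, so t = 0 is set apart. *)
Definition heat {R : realType} n (M : flat_space) (t : R) (f : 'rV[R]_n -> R)
    (x : 'rV[R]_n) : R[i] :=
  if t == 0 then (f x)%:C
  else multiplier M (fun xi => expR (- t * enorm xi ^+ 2)) f x.

Record solution {R : realType} n (M : flat_space) (phi : 'rV[R]_n -> R) (T s0 : R)
    (u : R -> 'rV[R]_n -> R) : Prop := {
  sol_time : 0 < T ;
  sol_reg : 0 < s0 ;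
  sol_in : forall t, 0 <= t <= T -> in_Cs M phi s0 (u t) ;
  sol_continuous : forall t, 0 <= t <= T ->
    norm_Cs M phi s0 (u t' \- u t) @[t' --> within `[0, T] (nbhs t)] --> 0%E ;
  sol_duhamel : forall t x, 0 <= t <= T ->
    (u t x)%:C = heat M t (u 0) x -
      cintegral (@lebesgue_measure R) `[0, t]
        (fun t' => heat M (t - t') (fun y => u t' y ^+ 3) x) }.

(* Main.v *)
Require Import Defs.
From HB Require Import structures.
From mathcomp Require Import all_boot all_order all_algebra.
From mathcomp Require Import complex.
From mathcomp Require Import all_classical all_reals all_analysis.
From mathcomp Require Import measurable_realfun ring lra zify.

(** Norm inflation through resonant lacunary data. Put r = 2^(2/3), so that
r^3 = 4, and let

  u(0, x) = sum over k <= K of delta r^(m+k) cos(2^(m+k) x_i0).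

Each Littlewood-Paley block of u(0) is a single wave, of size delta 2^(2j/3), so
the C^s norm of u(0) is at most delta for every s <= -2/3, whatever K and m are
([norm_Cs_data]). Let w be the heat flow of u(0). The first Picard increment is
minus the Duhamel integral of w^3, and its mean over x is fed by the resonances
2^j + 2^j - 2^(j+1) = 0: the product of the three amplitudes is of order
delta^3 4^j exp(-6 4^j t), whose integral in time is bounded below independently
of j. Since all amplitudes are nonnegative, the mean of this increment at time T
is at most - K delta^3 / 48 ([zmode_resonance]), so that it is large when K is.

The later Picard increments are smaller. The iteration is carried out on finite
lists of terms a(t) cos(k th), th = 2^m x_i0, in which equal frequencies are
never collected. The sum of |a(t)| 2^k over a list is submultiplicative, is not
increased by the heat flow, and dominates every quantity that matters. For w it
is at most W(t) = C r^m exp(- 4^m t), where C depends on delta and K only. The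
integral of W^3 is bounded by B = C^3 for all m, so the first increment is at
most B; each later one gains the factor q = integral over [0,T] of
3 (W + 2 B)^2 ([picard_bound]). The integral of W^2 is of order r^(-m), so q is
made small by taking first T small and then m large. The later increments then
change the mean by at most 2 B q <= 1 ([zmode_picard]).

The weight 2^k also dominates k^2, so that 4^j times the j-th block of an
iterate is bounded by a multiple of this norm, uniformly in j ([lp_rep]). The iterates
converge geometrically, and their limit is a solution in C([0,T]; C^2)
([psol_solution]).

Of the Littlewood-Paley and heat multipliers only three properties are used, the
record [admissible]: they are bounded on bounded continuous functions, linear,
and multiply cos(k x_i) by the value of the symbol at k e_i. On R^n these follow
from [fourier_inversion] for symbols with integrable Fourier transform; a smooth
cutoff has one because integration by parts makes its transform decay. On T^n
they follow from the absolute convergence of Fourier series multiplied by a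
symbol that is dominated by a Gaussian. *)

Set Implicit Arguments.
Unset Strict Implicit.
Unset Printing Implicit Defensive.

Import Order.TTheory GRing.Theory Num.Theory.
Import numFieldNormedType.Exports.

Local Open Scope classical_set_scope.
Local Open Scope ring_scope.

Notation Rn R n := (n.-tuple (measurableTypeR R)).
Notation leb R := (@lebesgue_measure R).
Notation lebn R n := (@lebesgue_Rn R n).

(** * Lebesgue measure on R^n: iterated integrals and affine changes of variables *)

Section Tonelli.
Context {R : realType}.
Local Open Scope ereal_scope.

(** The measure on (n+1)-tuples is the image under [consT] of a product measure, so
this is Tonelli's theorem after a change of variables. *)
Lemma Rn_tonelli n (f : Rn R n.+1 -> \bar R) :
  measurable_fun [set: Rn R n.+1] f -> (forall t, 0 <= f t) ->
  \int[lebn R n.+1]_t f t = \int[leb R]_x \int[lebn R n]_t f (consT (x, t)).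
Proof.
move=> mf f0.
have mc := @measurable_consT R n.
transitivity (\int[(leb R \x lebn R n)]_z (f \o @consT R n) z).
  rewrite /= -[in RHS](preimage_setT (@consT R n)).
  by rewrite -(ge0_integral_pushforward mc)//= => y _.
by rewrite fubini_tonelli1//=; exact: measurableT_comp.
Qed.

(** Up to the factor |r|, the image of Lebesgue measure under an affine map gives
intervals their length, hence is Lebesgue measure by uniqueness. *)
Lemma lebesgue_affine (x r : R) (f : R -> \bar R) : (r != 0)%R ->
  measurable_fun setT f -> (forall y, 0 <= f y) ->
  (`|r|%:E) * \int[leb R]_y f (x + r * y)%R = \int[leb R]_y f y.
Proof.
move=> r0 mf f0.
pose phi : measurableTypeR R -> measurableTypeR R := fun y => (x + r * y)%R.
have mphi : measurable_fun setT phi.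
  apply: measurable_funD => //; exact: measurable_funM.
pose mu1 : {measure set (measurableTypeR R) -> \bar R} :=
  measure_function_pushforward__canonical__measure_function_Measure (leb R) mphi.
have E : forall A, measurable A ->
    leb R A = mscale ((`|r|%:nng)%R) mu1 A.
  apply: lebesgue_measure_unique => _ [[a b]] _ <-.
  change (leb R `]a, b]%classic =
    `|r|%:E * leb R (phi @^-1` `]a, b]%classic)).
  rewrite [LHS]lebesgue_measure_itv/= lte_fin.
  have [r_gt0|r_le0] := ltP 0%R r.
    have -> : phi @^-1` `]a, b]%classic = `]((a - x) / r)%R, ((b - x) / r)%R]%classic.
      apply/seteqP; split => y; rewrite /phi/= !in_itv/=;
      by rewrite ltr_pdivrMr// ler_pdivlMr// ltrBlDl lerBrDl (mulrC y).
    rewrite lebesgue_measure_itv/= lte_fin ltr_pM2r ?invr_gt0// ltrD2r.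
    case: ifPn => // _; last by rewrite mule0.
    rewrite -!EFinD -EFinM; congr EFin.
    by rewrite ger0_norm ?ltW//; field; rewrite gt_eqF.
  have r_lt0 : (r < 0)%R by rewrite lt_neqAle r0.
  have -> : phi @^-1` `]a, b]%classic = `[((b - x) / r)%R, ((a - x) / r)%R[%classic.
    apply/seteqP; split => y; rewrite /phi/= !in_itv/=;
    by rewrite ler_ndivrMr// ltr_ndivlMr// ltrBlDl lerBrDl (mulrC y) andbC.
  rewrite lebesgue_measure_itv/= lte_fin ltr_nM2r ?invr_lt0// ltrD2r.
  case: ifPn => // _; last by rewrite mule0.
  rewrite -!EFinD -EFinM; congr EFin.
  by rewrite ltr0_norm//; field; rewrite lt_eqF.
transitivity (\int[mscale ((`|r|%:nng)%R) mu1]_y f y); last first.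
  by apply: eq_measure_integral => A mA _; apply/esym; exact: E.
rewrite ge0_integral_mscale//=; congr (_ * _).
by rewrite ge0_integral_pushforward//= preimage_setT.
Qed.

End Tonelli.

Section Affine.
Context {R : realType}.
Implicit Types (n : nat).

Definition affT n (x : n.-tuple R) (r : R) (t : Rn R n) : Rn R n :=
  [tuple tnth x i + r * tnth t i | i < n].

Lemma measurable_affT n (x : n.-tuple R) r : measurable_fun setT (affT x r).
Proof.
apply/measurable_fun_tnthP => i.
rewrite (_ : _ \o _ = fun t => tnth x i + r * tnth t i); last first.
  by apply/funext => t /=; rewrite tnth_mktuple.
by apply: measurable_funD => //; apply: measurable_funM => //;
  exact: measurable_tnth.
Qed.

Lemma affT_consT n (x : n.+1.-tuple R) (r y : R) (t : Rn R n) :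
  affT x r (consT (y, t)) = consT (thead x + r * y, affT (behead_tuple x) r t).
Proof.
apply: eq_from_tnth => i; rewrite tnth_mktuple.
case: (unliftP ord0 i) => [j ->|->]; rewrite ?tnth0 ?tnthS ?tnth_mktuple//.
by rewrite tnth_behead; congr (tnth x _ + _); apply/val_inj; rewrite /= inordK// ltnS.
Qed.

Local Open Scope ereal_scope.

Lemma Rn_affine n (x : n.-tuple R) (r : R) (f : Rn R n -> \bar R) :
  (r != 0)%R -> measurable_fun [set: Rn R n] f -> (forall t, 0 <= f t) ->
  (`|r| ^+ n)%:E * \int[lebn R n]_t f (affT x r t) = \int[lebn R n]_t f t.
Proof.
move=> r0; elim: n x f => [|n IH] x f mf f0.
  rewrite expr0 mul1e; apply: eq_integral => t _.
  by rewrite (tuple0 t) [affT _ _ _]tuple0.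
rewrite [in RHS]Rn_tonelli// [in LHS]Rn_tonelli//; last first.
  by apply: measurableT_comp => //; exact: measurable_affT.
have mc := @measurable_consT R n.
have mfc : measurable_fun setT (f \o @consT R n) by exact: measurableT_comp.
have f0' z : 0 <= (f \o @consT R n) z by exact: f0.
have mF := measurable_fun_fubini_tonelli_F (m2 := lebn R n) _ mfc f0'.
have F0 y : 0 <= \int[lebn R n]_t f (consT (y, t)) by exact: integral_ge0.
rewrite -(lebesgue_affine (thead x) r0 mF F0).
rewrite exprS EFinM -muleA; congr (_ * _).
rewrite -ge0_integralZl//=.
- apply: eq_integral => y _.
  rewrite /fubini_F.
  rewrite -(IH (behead_tuple x) (fun t => f (consT ((thead x + r * y)%R, t)))) => //.
    by congr (_ * _); apply: eq_integral => t _; exact: (congr1 f (affT_consT x r y t)).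
  by apply: (measurableT_comp mfc); exact: pair1_measurable.
- have mfa : measurable_fun setT ((f \o affT x r) \o @consT R n).
    by apply: measurableT_comp => //; apply: measurableT_comp => //;
      exact: measurable_affT.
  exact: (measurable_fun_fubini_tonelli_F (m2 := lebn R n) _ mfa (fun z => f0 _)).
- by move=> y _; exact: integral_ge0.
Qed.

End Affine.

(** * Measurability of continuous functions of row vectors *)

Section MeasContinuous.
Context {R : realType}.

Lemma ler_rV_norm n (v : 'rV[R]_n) (M : R) :
  0 <= M -> (forall i, `|v 0 i| <= M) -> `|v| <= M.
Proof.
move=> M0 h; rewrite [leLHS]/Num.norm/= mx_normrE; apply/bigmax_leP; split => //.
by move=> [a i] _ /=; rewrite (ord1 a).
Qed.

Lemma coord_le_norm n (v : 'rV[R]_n) i : `|v 0 i| <= `|v|.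
Proof.
rewrite [leRHS]/Num.norm/= mx_normrE.
by apply/bigmax_geP; right; exists (ord0, i).
Qed.

(** The sigma-algebra on tuples is the product one, for which open sets of row
vectors are not measurable by definition. A continuous function is however the
pointwise limit of functions of the countably many grid cells. *)
Definition grid n (k : nat) (x : 'rV[R]_n) : n.-tuple int :=
  [tuple Num.floor (k.+1%:R * x 0 i) | i < n].

Definition ungrid n (k : nat) (v : n.-tuple int) : 'rV[R]_n :=
  \row_i ((tnth v i)%:~R / k.+1%:R).

Lemma grid_close n k (x : 'rV[R]_n) : `|x - ungrid k (grid k x)| <= k.+1%:R^-1.
Proof.
apply: ler_rV_norm => [|i]; first by rewrite invr_ge0.
rewrite !mxE tnth_mktuple.
have k0 : 0 < k.+1%:R :> R by [].
set y := _ * x 0 i.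
have -> : x 0 i = y / k.+1%:R by rewrite /y mulrC mulKf ?gt_eqF.
rewrite -mulrBl normrM [X in _ * X]ger0_norm ?invr_ge0//.
have h1 : (Num.floor y)%:~R <= y by exact: floor_le.
have h2 : y < (Num.floor y + 1)%:~R by exact: floorD1_gt.
rewrite intrD in h2; rewrite ler_piMl ?invr_ge0// ger0_norm; lra.
Qed.

Lemma grid_cvg n (x : 'rV[R]_n) : ungrid k (grid k x) @[k --> \oo] --> x.
Proof.
apply/cvgrPdist_le => e e0.
have := @cvg_harmonic R; move/cvgrPdist_le => /(_ _ e0); apply: filterS => k.
rewrite sub0r normrN /harmonic/= ger0_norm ?invr_ge0//.
exact/le_trans/grid_close.
Qed.

Lemma measurable_grid n k (B : set (n.-tuple int)) :
  measurable [set t : Rn R n | B (grid k (rVtuple t))].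
Proof.
have -> : [set t : Rn R n | B (grid k (rVtuple t))] =
   \bigcup_(v : n.-tuple int) ((if v \in B then setT else set0) `&`
     \bigcap_(i in [set: 'I_n]) ((@tnth _ _ ^~ i) @^-1`
       [set y : measurableTypeR R | (tnth v i)%:~R <= k.+1%:R * y < (tnth v i + 1)%:~R])).
  apply/seteqP; split => t /=.
    move=> Bt; exists (grid k (rVtuple t)) => //; split; first by rewrite mem_set.
    move=> i _ /=; rewrite tnth_mktuple mxE; apply/andP; split.
      exact: floor_le.
    exact: floorD1_gt.
  move=> [v _ []]; case: ifPn => // /set_mem Bv _ h.
  suff -> : grid k (rVtuple t) = v by [].
  apply: eq_from_tnth => i; rewrite tnth_mktuple mxE.
  by apply/floor_def; exact: h.
apply: countable_bigcupT_measurable => [|v]; first exact: countableP.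
apply: measurableI; first by case: ifPn.
apply: fin_bigcap_measurable => // i _.
rewrite -[X in measurable X]setTI; apply: measurable_tnth => //.
have -> : [set y : measurableTypeR R | (tnth v i)%:~R <= k.+1%:R * y < (tnth v i + 1)%:~R]
  = `[(tnth v i)%:~R / k.+1%:R, (tnth v i + 1)%:~R / k.+1%:R[%classic.
  by apply/seteqP; split => y /=; rewrite in_itv/= ler_pdivrMr// ltr_pdivlMr// (mulrC y).
exact: measurable_itv.
Qed.

Lemma continuous_meas n (f : 'rV[R]_n -> R) : continuous f ->
  measurable_fun [set: Rn R n] (fun t => f (rVtuple t)).
Proof.
move=> cf.
apply: (@measurable_fun_cvg _ _ _ _ (fun k t => f (ungrid k (grid k (rVtuple t))))).
  move=> k _ B mB; rewrite setTI.
  exact: (measurable_grid k [set v | B (f (ungrid k v))]).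
move=> t _; apply: cvg_comp; first exact: grid_cvg.
exact: cf.
Qed.

End MeasContinuous.

(** * Integrals over R^n of functions of row vectors *)

Section Int.
Context {R : realType} {n : nat}.
Implicit Types (f g : 'rV[R]_n -> R).

Definition Meas f := measurable_fun [set: Rn R n] (fun t => f (rVtuple t)).
Definition Intg f :=
  (lebn R n).-integrable [set: Rn R n] (fun t => (f (rVtuple t))%:E).
Definition Int f : R := Rintegral (lebn R n) setT (fun t => f (rVtuple t)).

Lemma Intg_meas f : Intg f -> Meas f.
Proof. by move=> /integrableP[/measurable_EFinP]. Qed.

Lemma Int_E f : Intg f -> (Int f)%:E = (\int[lebn R n]_t (f (rVtuple t))%:E)%E.
Proof. by move=> If; rewrite /Int /Rintegral fineK//; exact: integrable_fin_num. Qed.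

Lemma Intg_le f g : Meas f -> (forall x, `|f x| <= g x) -> Intg g -> Intg f.
Proof.
move=> mf fg; apply: le_integrable => //; first exact/measurable_EFinP.
move=> t _ /=; rewrite lee_fin (le_trans (fg _))//; exact: ler_norm.
Qed.

Lemma IntgD f g : Intg f -> Intg g -> Intg (fun x => f x + g x).
Proof. by move=> If Ig; exact: (integrableD measurableT If Ig). Qed.

Lemma IntgB f g : Intg f -> Intg g -> Intg (fun x => f x - g x).
Proof. by move=> If Ig; exact: (integrableB measurableT If Ig). Qed.

Lemma IntgZ (a : R) f : Intg f -> Intg (fun x => a * f x).
Proof. by move=> If; exact: (integrableZl measurableT a If). Qed.

Lemma Intg_norm f : Intg f -> Intg (fun x => `|f x|).
Proof. by move=> If; exact: (integrable_norm If). Qed.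

Lemma Intg_mulb f g (C : R) : Intg f -> Meas g -> (forall x, `|g x| <= C) ->
  Intg (fun x => f x * g x).
Proof.
move=> If mg gC; apply: (@Intg_le _ (fun x => C * `|f x|)).
- by apply: measurable_funM => //; exact: Intg_meas.
- by move=> x; rewrite normrM mulrC ler_wpM2r.
- exact/IntgZ/Intg_norm.
Qed.

Lemma IntD f g : Intg f -> Intg g -> Int (fun x => f x + g x) = Int f + Int g.
Proof. by move=> If Ig; exact: RintegralD. Qed.

Lemma IntB f g : Intg f -> Intg g -> Int (fun x => f x - g x) = Int f - Int g.
Proof. by move=> If Ig; exact: RintegralB. Qed.

Lemma IntZ (a : R) f : Intg f -> Int (fun x => a * f x) = a * Int f.
Proof. by move=> If; exact: RintegralZl. Qed.

Lemma le_Int f g : Intg f -> Intg g -> (forall x, f x <= g x) -> Int f <= Int g.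
Proof. by move=> If Ig fg; apply: le_Rintegral. Qed.

Lemma le_norm_Int f : Intg f -> `|Int f| <= Int (fun x => `|f x|).
Proof. by move=> If; exact: le_normr_Rintegral. Qed.

Lemma Int_dominated (f_ : nat -> 'rV[R]_n -> R) f g :
  (forall k, Meas (f_ k)) -> (forall x, f_ k x @[k --> \oo] --> f x) ->
  Intg g -> (forall k x, `|f_ k x| <= g x) ->
  Intg f /\ (Int (f_ k) @[k --> \oo] --> Int f).
Proof.
move=> mf_ ff Ig fg.
have mf : Meas f by apply: (@measurable_fun_cvg _ _ _ _ (fun k t => f_ k (rVtuple t))).
have [] := @dominated_convergence _ _ _ (lebn R n) setT measurableT
  (fun k t => (f_ k (rVtuple t))%:E) (fun t => (f (rVtuple t))%:E)
  (fun t => (g (rVtuple t))%:E).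
- by move=> k; apply/measurable_EFinP; exact: mf_.
- by apply/measurable_EFinP; exact: mf.
- apply: aeW => t _; apply: cvg_EFin; [exact: nearW|exact: ff].
- exact: Ig.
- by apply: aeW => t k _; rewrite lee_fin.
move=> If _ cv; split => //; apply: fine_cvg.
by rewrite /Int /Rintegral fineK//; exact: integrable_fin_num.
Qed.

End Int.

Section Affine.
Context {R : realType} {n : nat}.
Implicit Types (f g : 'rV[R]_n -> R).

Lemma rVtuple_affT (x : 'rV[R]_n) r (t : Rn R n) :
  rVtuple (affT [tuple x 0 i | i < n] r t) = x + r *: rVtuple t.
Proof. by apply/rowP => i; rewrite !mxE !tnth_mktuple. Qed.

Lemma Meas_affine f (x : 'rV[R]_n) (r : R) : Meas f ->
  Meas (fun y => f (x + r *: y)).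
Proof.
move=> mf; rewrite /Meas.
under eq_fun do rewrite -rVtuple_affT.
by apply: (measurableT_comp mf); exact: measurable_affT.
Qed.

Lemma Int_affine_ge0 (f : 'rV[R]_n -> \bar R) (x : 'rV[R]_n) (r : R) : r != 0 ->
  measurable_fun [set: Rn R n] (fun t => f (rVtuple t)) ->
  (forall y, 0 <= f y)%E ->
  (\int[lebn R n]_t f (x + r *: rVtuple t)%R)%E =
  (((`|r| ^+ n)^-1)%:E * \int[lebn R n]_t f (rVtuple t))%E.
Proof.
move=> r0 mf f0.
rewrite -(Rn_affine [tuple x 0 i | i < n] r0 mf)// muleA -EFinM mulVf; last first.
  by rewrite expf_neq0// normr_eq0.
by rewrite mul1e; apply: eq_integral => t _; rewrite rVtuple_affT.
Qed.

Lemma Intg_affine f (x : 'rV[R]_n) (r : R) : r != 0 -> Intg f ->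
  Intg (fun y => f (x + r *: y)).
Proof.
move=> r0 /integrableP[/measurable_EFinP mf fi]; apply/integrableP; split.
  by apply/measurable_EFinP; exact: Meas_affine.
rewrite (Int_affine_ge0 (f := fun y => `|(f y)%:E|%E))//.
  by rewrite lte_mul_pinfty//.
by apply/measurable_EFinP; exact: measurableT_comp.
Qed.

Lemma Int_affine f (x : 'rV[R]_n) (r : R) : r != 0 -> Intg f ->
  Int (fun y => f (x + r *: y)) = (`|r| ^+ n)^-1 * Int f.
Proof.
move=> r0 If; apply: EFin_inj.
rewrite Int_E; last exact: Intg_affine.
rewrite EFinM Int_E//.
rewrite integralE [in RHS]integralE.
rewrite muleBr//; last first.
  exact: integrable_add_def.
have mf : measurable_fun [set: Rn R n] (fun t => (f (rVtuple t))%:E).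
  by apply/measurable_EFinP; exact: Intg_meas.
congr (_ - _)%E.
- have := measurable_funepos mf; rewrite funepos.unlock => m'.
  apply: (@Int_affine_ge0 (fun y => maxe (f y)%:E 0%E) x r r0 m') => y.
  by rewrite le_max lexx orbT.
- have := measurable_funeneg mf; rewrite funeneg.unlock => m'.
  apply: (@Int_affine_ge0 (fun y => maxe (- (f y)%:E)%E 0%E) x r r0 m') => y.
  by rewrite le_max lexx orbT.
Qed.

(** The reflection x |-> - x preserves the integral and changes the sign of f. *)
Lemma Int_odd f : Intg f -> (forall x, f (- x) = - f x) -> Int f = 0.
Proof.
move=> If odd.
have N0 : -1 != 0 :> R by rewrite oppr_eq0 oner_eq0.
have := Int_affine 0 N0 If.
rewrite normrN1 expr1n invr1 mul1r.
rewrite (_ : (fun y => _) = fun y => -1 * f y); last first.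
  by apply/funext => y; rewrite add0r scaleN1r odd mulN1r.
by rewrite IntZ//; lra.
Qed.

End Affine.

(** * One-dimensional integration by parts and the Fourier transform of the Gaussian *)

Section Gauss1D.
Context {R : realType}.
Local Notation mu := (leb R).
Notation IR f := (mu.-integrable setT (EFin \o f)).

Lemma IR_le (f g : R -> R) : measurable_fun setT f -> (forall x, `|f x| <= g x) ->
  IR g -> IR f.
Proof.
move=> mf fg; apply: le_integrable => //; first exact/measurable_EFinP.
move=> t _ /=; rewrite lee_fin (le_trans (fg _))//; exact: ler_norm.
Qed.

Lemma IR_gauss_scaled : IR (fun x => expR (- (x ^+ 2 / 2))).
Proof.
pose r : R := (Num.sqrt 2)^-1.
have r0 : r != 0 by rewrite invr_eq0 sqrtr_eq0 -ltNge.
have E : (fun x : R => expR (- (x ^+ 2 / 2))) = (fun x => gauss_fun (0 + r * x)).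
  apply/funext => x; rewrite /gauss_fun add0r exprMn exprVn sqr_sqrtr//.
  by rewrite mulrC.
have mg : measurable_fun setT (EFin \o @gauss_fun R).
  by apply/measurable_EFinP; exact: measurable_gauss_fun.
have := @lebesgue_affine R 0 r (EFin \o @gauss_fun R) r0 mg.
move/(_ (fun y => gauss_fun_ge0 y)) => H.
apply/integrableP; split.
  apply/measurable_EFinP; rewrite E.
  apply: measurableT_comp; first exact: measurable_gauss_fun.
  by apply: measurable_funD => //; exact: measurable_funM.
have -> : (\int[mu]_x `|(EFin \o (fun x : R => expR (- (x ^+ 2 / 2)))) x| =
    (`|r|^-1)%:E * \int[mu]_y (gauss_fun y)%:E)%E.
  rewrite -[in RHS]H muleA -EFinM mulVf ?normr_eq0// mul1e.
  apply: eq_integral => x _ /=; rewrite ger0_norm ?expR_ge0//.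
  by have /(congr1 (fun h => h x)) := E; move=> /= ->.
by rewrite integralT_gauss -EFinM ltry.
Qed.

Lemma gauss_dom (x : R) : `|x| * expR (- x ^+ 2) <= expR (- (x ^+ 2 / 2)).
Proof.
have -> : - x ^+ 2 = - (x ^+ 2 / 2) + - (x ^+ 2 / 2) by field.
rewrite expRD mulrA ler_piMl ?expR_ge0//.
rewrite expRN ler_pdivrMr ?expR_gt0// mul1r.
apply: le_trans (expR_ge1Dx _).
rewrite -[x ^+ 2]real_normK ?num_real//.
have := sqr_ge0 (`|x| - 1); rewrite sqrrB1; lra.
Qed.

Lemma measurable_cosM (y : R) : measurable_fun setT (fun x : R => cos (y * x)).
Proof.
apply: continuous_measurable_fun => x.
by apply: continuous_comp; [exact: mulrl_continuous|exact: continuous_cos].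
Qed.

Lemma measurable_sinM (y : R) : measurable_fun setT (fun x : R => sin (y * x)).
Proof.
apply: continuous_measurable_fun => x.
by apply: continuous_comp; [exact: mulrl_continuous|exact: continuous_sin].
Qed.

Lemma IR_gauss_cos (y : R) : IR (fun x => gauss_fun x * cos (y * x)).
Proof.
apply: (@IR_le _ gauss_fun); last exact: integrableT_gauss.
  by apply: measurable_funM; [exact: measurable_gauss_fun|exact: measurable_cosM].
by move=> x; rewrite normrM ger0_norm ?gauss_fun_ge0// ler_piMr ?gauss_fun_ge0// ler_norml cos_geN1 cos_le1.
Qed.

Lemma IR_gauss_sin (y : R) : IR (fun x => gauss_fun x * sin (y * x)).
Proof.
apply: (@IR_le _ gauss_fun); last exact: integrableT_gauss.
  by apply: measurable_funM; [exact: measurable_gauss_fun|exact: measurable_sinM].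
by move=> x; rewrite normrM ger0_norm ?gauss_fun_ge0// ler_piMr ?gauss_fun_ge0// ler_norml sin_geN1 sin_le1.
Qed.

Lemma IR_xgauss_sin (y : R) : IR (fun x => x * gauss_fun x * sin (y * x)).
Proof.
apply: (@IR_le _ (fun x => expR (- (x ^+ 2 / 2)))); last exact: IR_gauss_scaled.
  apply: measurable_funM; last exact: measurable_sinM.
  by apply: measurable_funM => //; exact: measurable_gauss_fun.
move=> x; apply: le_trans (gauss_dom x); rewrite normrM normrM.
rewrite (ger0_norm (gauss_fun_ge0 _)) ler_piMr ?mulr_ge0 ?gauss_fun_ge0//.
by rewrite ler_norml sin_geN1 sin_le1.
Qed.

Lemma Rintegral_derivative0 (G g : R -> R) :
  (forall x : R, is_derive x 1 G (g x)) -> continuous g -> IR g ->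
  G x @[x --> +oo] --> 0 -> G x @[x --> -oo] --> 0 ->
  \int[mu]_x g x = 0.
Proof.
move=> dG cg Ig Gp Gn.
pose I (k : nat) : set R := `[- k.+1%:R, k.+1%:R]%classic.
have Ik k : \int[mu]_(x in I k) g x = G k.+1%:R - G (- k.+1%:R).
  rewrite /Rintegral (@continuous_FTC2 _ g G)//.
  - by rewrite gtrN.
  - exact: continuous_subspaceT.
  - split.
    + by move=> x _; exact: ex_derive.
    + apply: cvg_at_right_filter; apply: differentiable_continuous.
      by apply/derivable1_diffP; exact: ex_derive.
    + apply: cvg_at_left_filter; apply: differentiable_continuous.
      by apply/derivable1_diffP; exact: ex_derive.
  - by move=> x _; rewrite derive1E; exact: derive_val.
have ky : k.+1%:R @[k --> \oo] --> (+oo : set_system R).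
  by rewrite (cvg_shiftS (fun k => k%:R : R)); exact: cvgr_idn.
have c0 : \int[mu]_(x in I k) g x @[k --> \oo] --> 0.
  under eq_fun do rewrite Ik.
  rewrite -(subr0 (0:R)); apply: cvgB; first exact: (cvg_comp _ _ ky Gp).
  apply: (cvg_comp _ _ _ Gn).
  by apply: ((cvgNrNy (fun k => k.+1%:R : R)).2); exact: ky.
have mg : measurable_fun setT g by exact: continuous_measurable_fun.
have mI k : measurable (I k) by exact: measurable_itv.
have c1 : \int[mu]_(x in I k) g x @[k --> \oo] --> \int[mu]_x g x.
  have [] := @dominated_convergence _ _ _ mu setT measurableT
    (fun k x => ((g \_ (I k)) x)%:E) (EFin \o g) (EFin \o (fun x => `|g x|)).
  - move=> k; apply/measurable_EFinP; apply/(measurable_restrictT g (mI k)).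
    exact: measurable_funTS.
  - exact/measurable_EFinP.
  - apply: aeW => x _; apply: cvg_near_cst.
    near=> k; rewrite patchE ifT// inE /I/= in_itv/= -ler_norml.
    near: k; have := nbhs_infty_ger `|x|; apply: filterS => k xk.
    by rewrite (le_trans xk)// ler_nat.
  - exact: integrable_norm.
  - apply: aeW => x k _ /=; rewrite lee_fin patchE.
    by case: ifPn => // _; rewrite normr0.
  move=> _ _ cv.
  have -> : (fun k => \int[mu]_(x in I k) g x) =
      (fun k => fine (\int[mu]_x ((g \_ (I k)) x)%:E)%E).
    by apply/funext => k; rewrite Rintegral_mkcond.
  apply: fine_cvg; rewrite /Rintegral fineK//.
  exact: integrable_fin_num.
exact: (cvg_unique _ c1 c0).
Unshelve. all: end_near. Qed.

Lemma gauss_fun_cvgy : @gauss_fun R x @[x --> +oo] --> 0.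
Proof. exact: cvg_gauss_fun. Qed.

Lemma gauss_fun_cvgNy : @gauss_fun R x @[x --> -oo] --> 0.
Proof.
apply/cvgNy_compNP; rewrite (_ : _ \o _ = gauss_fun); first exact: gauss_fun_cvgy.
by apply/funext => x; rewrite /gauss_fun/= sqrrN.
Qed.

Lemma is_derive_ext (f g : R -> R) (x df dg : R) :
  is_derive x 1 f df -> f =1 g -> df = dg -> is_derive x 1 g dg.
Proof. by move=> + /funext <- <-. Qed.

Lemma is_derive_mulr (a x : R) : is_derive x 1 (fun x => a * x) a.
Proof.
by apply: (is_derive_ext (is_deriveZ a (is_derive_id x 1))) => //=; exact: mulr1.
Qed.

Lemma is_derive_expsq (a x : R) :
  is_derive x 1 (fun x => expR (a * x ^+ 2)) (2 * a * x * expR (a * x ^+ 2)).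
Proof.
have d2 : is_derive x 1 (fun x : R => x ^+ 2) (2 * x).
  apply: (is_derive_ext (is_deriveM (is_derive_id x 1) (is_derive_id x 1))) => //=.
  by rewrite /GRing.scale/=; ring.
have da : is_derive x 1 (fun x => a * x ^+ 2) (a * (2 * x)).
  exact: (is_derive_ext (is_deriveZ a d2)).
apply: (is_derive_ext (is_derive1_comp (is_derive_expR _) da)) => //=.
by ring.
Qed.

Lemma gauss_funE (x : R) : gauss_fun x = expR (-1 * x ^+ 2).
Proof. by rewrite /gauss_fun mulN1r. Qed.

Lemma is_derive_gauss (x : R) : is_derive x 1 gauss_fun (- (2 * x) * gauss_fun x).
Proof.
apply: (is_derive_ext (is_derive_expsq (-1) x)) => [y|]; rewrite gauss_funE//.
by ring.
Qed.

Lemma is_derive_sinM (y x : R) : is_derive x 1 (fun x => sin (y * x)) (y * cos (y * x)).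
Proof.
apply: (is_derive_ext (is_derive1_comp (is_derive_sin _) (is_derive_mulr y x))) => //=.
by ring.
Qed.

Lemma is_derive_cosM (y x : R) : is_derive x 1 (fun x => cos (y * x)) (- y * sin (y * x)).
Proof.
apply: (is_derive_ext (is_derive1_comp (is_derive_cos _) (is_derive_mulr y x))) => //=.
by ring.
Qed.

Lemma cvg0_mul_bounded (F : set_system R) (FF : Filter F) (f g : R -> R) :
  f x @[x --> F] --> 0 -> (forall x, `|g x| <= 1) -> f x * g x @[x --> F] --> 0.
Proof.
move=> f0 g1; apply/cvgrPdist_lt => e e0.
move/cvgrPdist_lt : f0 => /(_ _ e0); apply: filterS => x; rewrite !sub0r !normrN.
by apply: le_lt_trans; rewrite normrM ler_piMr.
Qed.

Lemma norm_cos_le1 (x : R) : `|cos x| <= 1.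
Proof. by rewrite ler_norml cos_geN1 cos_le1. Qed.

Lemma norm_sin_le1 (x : R) : `|sin x| <= 1.
Proof. by rewrite ler_norml sin_geN1 sin_le1. Qed.

Lemma continuous_cosM (y : R) : continuous (fun x : R => cos (y * x)).
Proof.
by move=> x; apply: continuous_comp; [exact: mulrl_continuous|exact: continuous_cos].
Qed.

Lemma continuous_sinM (y : R) : continuous (fun x : R => sin (y * x)).
Proof.
by move=> x; apply: continuous_comp; [exact: mulrl_continuous|exact: continuous_sin].
Qed.

(** The integral over the line of the derivative of exp(-x^2) sin(y x) vanishes. *)
Lemma gauss_ibp (y : R) :
  \int[mu]_x (x * gauss_fun x * sin (y * x)) =
  (y / 2) * \int[mu]_x (gauss_fun x * cos (y * x)).
Proof.
have := @Rintegral_derivative0 (fun x => gauss_fun x * sin (y * x))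
   (fun x => y * (gauss_fun x * cos (y * x)) - 2 * (x * gauss_fun x * sin (y * x))).
have Ic := IR_gauss_cos y; have Is := IR_xgauss_sin y.
have Iyc : IR (fun x => y * (gauss_fun x * cos (y * x))).
  exact: (integrableZl measurableT y Ic).
have I2s : IR (fun x => 2 * (x * gauss_fun x * sin (y * x))).
  exact: (integrableZl measurableT 2 Is).
rewrite RintegralB// RintegralZl// RintegralZl// => H.
have : y * \int[mu]_x (gauss_fun x * cos (y * x)) -
   2 * \int[mu]_x (x * gauss_fun x * sin (y * x)) = 0.
  apply: H.
  - move=> x.
    apply: (is_derive_ext (is_deriveM (is_derive_gauss x) (is_derive_sinM y x))) => //=.
    by rewrite /GRing.scale/=; ring.
  - have cc := @continuous_cosM y; have cs := @continuous_sinM y.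
    have cg := @continuous_gauss_fun R.
    move=> x; apply: cvgB; (apply: cvgM; first exact: cvg_cst); apply: cvgM.
    + exact: cg.
    + exact: cc.
    + by apply: cvgM; [exact: cvg_id|exact: cg].
    + exact: cs.
  - exact: (integrableB measurableT Iyc I2s).
  - by apply: cvg0_mul_bounded; [exact: gauss_fun_cvgy|move=> x; exact: norm_sin_le1].
  - by apply: cvg0_mul_bounded; [exact: gauss_fun_cvgNy|move=> x; exact: norm_sin_le1].
lra.
Qed.

(** Differentiation under the integral gives minus the left-hand side of
[gauss_ibp], so that the transform solves H' = - (y / 2) H. *)
Lemma is_derive_gauss_cos_transform (y : R) :
  is_derive y 1 (fun y => \int[mu]_x (gauss_fun x * cos (y * x)))
   (- (y / 2) * \int[mu]_x (gauss_fun x * cos (y * x))).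
Proof.
pose f (y x : R) := gauss_fun x * cos (y * x).
have df (z x : R) : is_derive z 1 (f ^~ x) (- (x * gauss_fun x * sin (z * x))).
  have d1 : is_derive z 1 (fun z => cos (x * z)) (- x * sin (x * z)).
    exact: is_derive_cosM.
  apply: (is_derive_ext (is_deriveZ (gauss_fun x) d1)) => [w|].
    by rewrite /f /= /GRing.scale/= (mulrC x).
  by rewrite /GRing.scale/= (mulrC x z); ring.
have yI : `]y - 1, y + 1[%classic y by rewrite /= in_itv/= ltrBlDr ltrDl; apply/andP.
have H1 : forall x : R, `]y - 1, y + 1[%classic x -> mu.-integrable setT (EFin \o f x).
  by move=> x _; exact: IR_gauss_cos.
have H2 : forall x z, `]y - 1, y + 1[%classic x -> [set: R] z -> derivable (f ^~ z) x 1.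
  by move=> x z _ _; exact: ex_derive.
have H3 : forall x z, `]y - 1, y + 1[%classic x -> [set: R] z ->
    `|partial1of2 f x z| <= expR (- (z ^+ 2 / 2)).
  move=> x z _ _; rewrite partial1of2E (@derive_val _ _ _ _ _ _ _ (df x z)) normrN.
  apply: le_trans (gauss_dom z); rewrite normrM normrM.
  rewrite (ger0_norm (gauss_fun_ge0 _)) ler_piMr ?mulr_ge0 ?gauss_fun_ge0//.
  exact: norm_sin_le1.
have G0 (z : R) : 0 <= expR (- (z ^+ 2 / 2)) by exact: expR_ge0.
have D1 := derivable_under_integral measurableT yI H1 H2 G0 IR_gauss_scaled H3.
have D2 := differentiation_under_integral measurableT yI H1 H2 G0 IR_gauss_scaled H3.
apply: DeriveDef; first exact: D1.
rewrite -derive1E D2.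
rewrite mulNr -gauss_ibp.
transitivity (\int[mu]_x (-1 * (x * gauss_fun x * sin (y * x)))).
  by apply: eq_Rintegral => x _; rewrite partial1of2E (@derive_val _ _ _ _ _ _ _ (df y x)) mulN1r.
rewrite RintegralZl//; last exact: IR_xgauss_sin.
by rewrite mulN1r.
Qed.

Lemma is_derive_gaussM (H : R -> R) (a dH z : R) : is_derive z 1 H dH ->
  is_derive z 1 (fun z => H z * expR (a * z ^+ 2))
    ((H z * (2 * a * z) + dH) * expR (a * z ^+ 2)).
Proof.
move=> d1; have d2 := is_derive_expsq a z.
have d := @is_deriveM R R^o _ _ _ _ _ _ d1 d2.
apply: (is_derive_ext d); first by move=> w.
by rewrite /GRing.scale/=; ring.
Qed.

(** H exp(y^2 / 4) has derivative zero and its value at 0 is the Gaussian integral. *)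
Lemma gauss_cos_transform (y : R) :
  \int[mu]_x (gauss_fun x * cos (y * x)) = Num.sqrt pi * expR (- (y ^+ 2 / 4)).
Proof.
pose H (y : R) := \int[mu]_x (gauss_fun x * cos (y * x)).
have H0 : H 0 = Num.sqrt pi.
  rewrite /H (_ : (fun x => _) = gauss_fun); last first.
    by apply/funext => x; rewrite mul0r cos0 mulr1.
  by rewrite /Rintegral integralT_gauss.
have dH (z : R) : is_derive z 1 H (- (z / 2) * H z).
  exact: is_derive_gauss_cos_transform.
rewrite -/(H y); move: H H0 dH => H H0 dH.
have K : forall z : R, is_derive z 1 (fun z => H z * expR (4^-1 * z ^+ 2)) 0.
  move=> z; have d := is_derive_gaussM 4^-1 (dH z).
  apply: (is_derive_ext d); first by move=> w.
  rewrite (_ : _ + _ = 0) ?mul0r//; by field.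
have := is_derive_0_is_cst y 0 K.
rewrite H0 expr0n/= mulr0 expR0 mulr1 => <-.
rewrite -mulrA -expRD (_ : _ + _ = 0) ?expR0 ?mulr1//; by field.
Qed.

Lemma gauss_sin_transform (y : R) : \int[mu]_x (gauss_fun x * sin (y * x)) = 0.
Proof.
have Is := IR_gauss_sin y; set f := (fun x : R => _) in Is *.
have mf : measurable_fun setT (EFin \o f) by case/integrableP : Is.
rewrite /Rintegral integralE.
suff -> : (\int[mu]_x (EFin \o f)^\- x = \int[mu]_x (EFin \o f)^\+ x)%E.
  rewrite subee//; apply: integrable_fin_num => //; exact: integrable_funepos.
have N0 : -1 != 0 :> R by rewrite oppr_eq0 oner_eq0.
have := @lebesgue_affine R 0 (-1) (EFin \o f)^\+%E N0 (measurable_funepos mf).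
move=> /(_ (fun y => funepos_ge0 _ _)); rewrite normrN1 mul1e => <-.
apply: eq_integral => x _; rewrite funepos.unlock funeneg.unlock /= /f.
by rewrite add0r mulN1r /gauss_fun sqrrN mulrN sinN mulrN.
Qed.

End Gauss1D.

(** * Tensor products, characters and Gaussians on R^n *)

Section Tensor.
Context {R : realType}.
Local Notation mu := (leb R).
Notation IR f := (mu.-integrable setT (EFin \o f)).

Definition tlrow n (x : 'rV[R]_n.+1) : 'rV[R]_n := \row_i x 0 (lift ord0 i).

Lemma rVtuple_consT0 n (y : R) (t : Rn R n) : rVtuple (consT (y, t)) 0 ord0 = y.
Proof. by rewrite mxE. Qed.

Lemma rVtuple_consTS n (y : R) (t : Rn R n) : tlrow (rVtuple (consT (y, t))) = rVtuple t.
Proof. by apply/rowP => i; rewrite !mxE tnthS. Qed.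

Lemma Meas_hd n (f : R -> R) : measurable_fun setT f ->
  Meas (fun x : 'rV[R]_n.+1 => f (x 0 ord0)).
Proof.
move=> mf; apply: (measurableT_comp mf).
under eq_fun do rewrite mxE.
exact: measurable_tnth.
Qed.

Lemma Meas_tl n (g : 'rV[R]_n -> R) : Meas g ->
  Meas (fun x : 'rV[R]_n.+1 => g (tlrow x)).
Proof.
move=> mg; rewrite /Meas.
rewrite (_ : (fun t => _) = (fun t => g (rVtuple t)) \o
  (fun t : Rn R n.+1 => [tuple of behead t])).
  by apply: (measurableT_comp mg); exact: measurable_behead.
apply/funext => t /=; congr g; apply/rowP => i.
by rewrite !mxE tnth_behead; congr tnth; apply/val_inj; rewrite /= inordK// ltnS.
Qed.

Lemma Int_tensor n (f : R -> R) (g : 'rV[R]_n -> R) : IR f -> Intg g ->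
  Intg (fun x : 'rV[R]_n.+1 => f (x 0 ord0) * g (tlrow x)) /\
  Int (fun x : 'rV[R]_n.+1 => f (x 0 ord0) * g (tlrow x)) =
    (\int[mu]_x f x) * Int g.
Proof.
move=> If Ig.
pose h (x : 'rV[R]_n.+1) := f (x 0 ord0) * g (tlrow x).
have mh : Meas h.
  apply: measurable_funM; last by apply: Meas_tl; exact: Intg_meas.
  by apply: Meas_hd; apply/measurable_EFinP; case/integrableP : If.
have mhE : measurable_fun [set: Rn R n.+1] (fun t => (h (rVtuple t))%:E).
  by apply/measurable_EFinP.
have mc := @measurable_consT R n.
pose hh (z : measurableTypeR R * Rn R n) := (h (rVtuple (consT z)))%:E.
have hhE y t : hh (y, t) = (f y * g (rVtuple t))%:E.
  by rewrite /hh /h rVtuple_consT0 rVtuple_consTS.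
have mhh : measurable_fun setT hh by exact: (measurableT_comp mhE mc).
have Ihh : ((leb R \x lebn R n)%E).-integrable setT hh.
  apply/integrable12ltyP => //.
  under eq_integral => y _.
    under eq_integral => t _ do rewrite hhE EFinM abseM.
    rewrite ge0_integralZl//; first over.
    by apply/measurable_EFinP; apply: measurableT_comp => //; exact: Intg_meas.
  rewrite /= ge0_integralZr//; last 2 first.
  - have mf : measurable_fun setT f by apply/measurable_EFinP; case/integrableP : If.
    by apply/measurable_EFinP; exact: measurableT_comp.
  - exact: integral_ge0.
  move/integrableP : If => [_ f1]; move/integrableP : Ig => [_ g1].
  by rewrite lte_mul_pinfty// ?integral_ge0// ge0_fin_numE// integral_ge0.
have IhE : (pushforward (leb R \x lebn R n)%E (@consT R n)).-integrable setT
    (fun t => (h (rVtuple t))%:E).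
  by apply: (integrable_pushforward mc).
split; first exact: IhE.
rewrite /Int /Rintegral.
transitivity (fine (\int[(leb R \x lebn R n)%E]_z hh z)%E).
  congr fine.
  have := integral_pushforward mc mhE (mu := (leb R \x lebn R n)%E) (D := setT).
  by rewrite preimage_setT; apply.
rewrite -integral12_prod_meas1//.
transitivity (fine (\int[mu]_y ((f y)%:E * (Int g)%:E))%E).
  congr fine; apply: eq_integral => y _; rewrite /fubini_F.
  under eq_integral => t _ do rewrite hhE EFinM.
  by rewrite integralZl// Int_E.
rewrite integralZr// fineM//; exact: integrable_fin_num.
Qed.

End Tensor.

Section ComplexProduct.
Context {R : realType}.
Local Open Scope complex_scope.
Local Notation mu := (leb R).
Notation IR f := (mu.-integrable setT (EFin \o f)).

Definition cintegrable1 (f : R -> R[i]) :=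
  IR (fun x => complex.Re (f x)) /\ IR (fun x => complex.Im (f x)).

Definition cintegral1 (f : R -> R[i]) : R[i] :=
  (\int[mu]_x complex.Re (f x)) +i* (\int[mu]_x complex.Im (f x)).

(** The characters cis of a sum are products of one-variable functions, real cosines
are not; this is why products of integrals are taken over complex values. *)
Definition cInt n (f : 'rV[R]_n -> R[i]) : R[i] :=
  Int (fun x => complex.Re (f x)) +i* Int (fun x => complex.Im (f x)).

Lemma cReM (z w : R[i]) : @complex.Re R (z * w) =
  @complex.Re R z * @complex.Re R w - @complex.Im R z * @complex.Im R w.
Proof. by case: z w => a b [c d]. Qed.

Lemma cImM (z w : R[i]) : @complex.Im R (z * w) =
  @complex.Re R z * @complex.Im R w + @complex.Im R z * @complex.Re R w.
Proof. by case: z w => a b [c d]. Qed.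

Lemma Int_point (f : 'rV[R]_0 -> R) : Intg f /\ Int f = f 0.
Proof.
have mf : measurable_fun [set: Rn R 0] (fun t => f (rVtuple t)).
  rewrite (_ : (fun t => _) = cst (f 0)); first exact: measurable_cst.
  by apply/funext => t; rewrite [rVtuple t]thinmx0.
have mE : measurable_fun [set: Rn R 0] (fun t => (f (rVtuple t))%:E).
  exact/measurable_EFinP.
split.
  apply/integrableP; split; first exact: mE.
  rewrite /= integral_dirac//; first by rewrite diracT mul1e ltry.
  by apply/measurable_EFinP; exact: measurableT_comp.
rewrite /Int /Rintegral /= integral_dirac//= indicT mul1r.
by rewrite [rVtuple _]thinmx0.
Qed.

(** By induction on the dimension, each step being [Int_tensor] for the four
real products of real and imaginary parts. *)
Lemma cInt_prod n (F : 'I_n -> R -> R[i]) : (forall i, cintegrable1 (F i)) ->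
  let G := fun x : 'rV[R]_n => \prod_(i < n) F i (x 0 i) in
  [/\ Intg (fun x => complex.Re (G x)), Intg (fun x => complex.Im (G x)) &
      cInt G = \prod_(i < n) cintegral1 (F i)].
Proof.
elim: n F => [|n IH] F HF G.
  have [I1 E1] := Int_point (fun x => complex.Re (G x)).
  have [I2 E2] := Int_point (fun x => complex.Im (G x)).
  by split => //; rewrite /cInt E1 E2 /G !big_ord0.
pose G' (x : 'rV[R]_n) := \prod_(i < n) F (lift ord0 i) (x 0 i).
have [IRe IIm E] : [/\ Intg (fun x => complex.Re (G' x)),
    Intg (fun x => complex.Im (G' x)) &
    cInt G' = \prod_(i < n) cintegral1 (F (lift ord0 i))].
  exact: (IH (fun i => F (lift ord0 i)) (fun i => HF _)).
have GE x : G x = F ord0 (x 0 ord0) * G' (tlrow x).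
  rewrite /G big_ord_recl; congr (_ * _); apply: eq_bigr => i _.
  by rewrite mxE.
have [f1 f2] := HF ord0.
have [I11 E11] := Int_tensor f1 IRe.
have [I22 E22] := Int_tensor f2 IIm.
have [I12 E12] := Int_tensor f1 IIm.
have [I21 E21] := Int_tensor f2 IRe.
have ERe : (fun x => complex.Re (G x)) = (fun x =>
  complex.Re (F ord0 (x 0 ord0)) * complex.Re (G' (tlrow x)) -
  complex.Im (F ord0 (x 0 ord0)) * complex.Im (G' (tlrow x))).
  by apply/funext => x; rewrite GE cReM.
have EIm : (fun x => complex.Im (G x)) = (fun x =>
  complex.Re (F ord0 (x 0 ord0)) * complex.Im (G' (tlrow x)) +
  complex.Im (F ord0 (x 0 ord0)) * complex.Re (G' (tlrow x))).
  by apply/funext => x; rewrite GE cImM.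
split.
- by rewrite ERe; exact: IntgB.
- by rewrite EIm; exact: IntgD.
- rewrite big_ord_recl -E /cInt ERe EIm IntB// IntD// E11 E12 E21 E22.
  by apply/eqP; rewrite eq_complex /=; apply/andP.
Qed.

End ComplexProduct.

Section GaussRn.
Context {R : realType}.
Local Open Scope complex_scope.
Local Notation mu := (leb R).

Lemma cisD (a b : R) : cis (a + b) = cis a * cis b.
Proof.
rewrite /cis cosD sinD; apply/eqP; rewrite eq_complex /=; apply/andP; split => //.
by rewrite addrC (mulrC (sin a)).
Qed.

Lemma cis0 : cis 0 = 1 :> R[i].
Proof. by rewrite /cis cos0 sin0. Qed.

Lemma cis_sum (I : Type) (r : seq I) (F : I -> R) :
  cis (\sum_(i <- r) F i) = \prod_(i <- r) cis (F i).
Proof. exact: (big_morph _ cisD cis0). Qed.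

Lemma expR_sum (I : Type) (r : seq I) (F : I -> R) :
  expR (\sum_(i <- r) F i) = \prod_(i <- r) expR (F i).
Proof. by apply: (big_morph (@expR R)); [exact: expRD|exact: expR0]. Qed.

Variable n : nat.
Implicit Types x z : 'rV[R]_n.

(** Both the Gaussian and the character factor over the coordinates. *)
Lemma gauss_factor z : cInt (fun x => (expR (- dot x x))%:C * cis (dot z x)) =
    (Num.sqrt pi ^+ n * expR (- (dot z z / 4)))%:C /\
  Intg (fun x => expR (- dot x x) * cos (dot z x)).
Proof.
pose F (i : 'I_n) (y : R) : R[i] := (gauss_fun y)%:C * cis (z 0 i * y).
have FRe i : (fun y => complex.Re (F i y)) = (fun y => gauss_fun y * cos (z 0 i * y)).
  by apply/funext => y; rewrite /F cReM /= mul0r subr0.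
have FIm i : (fun y => complex.Im (F i y)) = (fun y => gauss_fun y * sin (z 0 i * y)).
  by apply/funext => y; rewrite /F cImM /= mul0r addr0.
have HF i : cintegrable1 (F i).
  split; rewrite ?FRe ?FIm; [exact: IR_gauss_cos|exact: IR_gauss_sin].
have FE i : cintegral1 (F i) = (Num.sqrt pi * expR (- (z 0 i ^+ 2 / 4)))%:C.
  by rewrite /cintegral1 FRe FIm gauss_sin_transform gauss_cos_transform.
pose G (x : 'rV[R]_n) := \prod_(i < n) F i (x 0 i).
have [I1 _ E1] : [/\ Intg (fun x => complex.Re (G x)),
    Intg (fun x => complex.Im (G x)) &
    cInt G = \prod_(i < n) cintegral1 (F i)] by exact: cInt_prod.
have GE : G = (fun x => (expR (- dot x x))%:C * cis (dot z x)).
  apply/funext => x; rewrite /G big_split /= /dot cis_sum; congr (_ * _).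
  rewrite -rmorph_prod /= -sumrN expR_sum; congr (_%:C).
split.
  rewrite -GE E1.
  rewrite (eq_bigr (fun i => (Num.sqrt pi * expR (- (z 0 i ^+ 2 / 4)))%:C)); last first.
    by move=> i _; rewrite FE.
  rewrite -rmorph_prod /= big_split /= prodr_const card_ord; congr ((_ * _)%:C).
  rewrite -expR_sum; congr expR; rewrite sumrN /dot mulr_suml; congr (- _).
move: I1; rewrite GE; congr Intg; apply/funext => x.
by rewrite cReM /= mul0r subr0.
Qed.

Lemma Int_gauss_cos z :
  Int (fun x => expR (- dot x x) * cos (dot z x)) =
  Num.sqrt pi ^+ n * expR (- (dot z z / 4)).
Proof.
have [+ _] := gauss_factor z; rewrite /cInt => /(congr1 (@complex.Re R)) /= <-.
by congr Int; apply/funext => x; rewrite mul0r subr0.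
Qed.

Lemma dotZl (a : R) x z : dot (a *: x) z = a * dot x z.
Proof. by rewrite /dot mulr_sumr; apply: eq_bigr => i _; rewrite mxE mulrA. Qed.

Lemma dotC x z : dot x z = dot z x.
Proof. by apply: eq_bigr => i _; rewrite mulrC. Qed.

Lemma dotZr (a : R) x z : dot x (a *: z) = a * dot x z.
Proof. by rewrite dotC dotZl dotC. Qed.

Lemma dotDl x y z : dot (x + y) z = dot x z + dot y z.
Proof. by rewrite /dot -big_split; apply: eq_bigr => i _; rewrite mxE mulrDl. Qed.

Lemma dotDr x y z : dot z (x + y) = dot z x + dot z y.
Proof. by rewrite dotC dotDl !(dotC z). Qed.

Lemma dotNl x z : dot (- x) z = - dot x z.
Proof. by rewrite -scaleN1r dotZl mulN1r. Qed.

Lemma dotNr x z : dot z (- x) = - dot z x.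
Proof. by rewrite dotC dotNl dotC. Qed.

Lemma dot0l x : dot 0 x = 0.
Proof. by rewrite -(scale0r x) dotZl mul0r. Qed.

Lemma dot_ge0 x : 0 <= dot x x.
Proof. by apply: sumr_ge0 => i _; rewrite -expr2 sqr_ge0. Qed.

Lemma enorm_sq x : enorm x ^+ 2 = dot x x.
Proof. by rewrite /enorm sqr_sqrtr// dot_ge0. Qed.

Lemma gauss_scaled (r : R) z : 0 < r ->
  Intg (fun x => expR (- (r ^+ 2 * dot x x))) /\
  Int (fun x => expR (- (r ^+ 2 * dot x x)) * cos (dot z x)) =
  (Num.sqrt pi / r) ^+ n * expR (- (dot z z / (4 * r ^+ 2))).
Proof.
move=> r0; have rn0 : r != 0 by rewrite gt_eqF.
split.
  have [_ H] := gauss_factor 0.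
  have := Intg_affine 0 rn0 H; congr Intg; apply/funext => x.
  by rewrite add0r dot0l cos0 mulr1 dotZl dotZr mulrA expr2.
have [_ H] := gauss_factor (r^-1 *: z).
have := Int_affine 0 rn0 H; rewrite Int_gauss_cos => E.
transitivity (Int (fun y => expR (- dot (0 + r *: y) (0 + r *: y)) *
   cos (dot (r^-1 *: z) (0 + r *: y)))).
  congr Int; apply/funext => x; rewrite !add0r !dotZl !dotZr mulrA expr2.
  by rewrite mulKf.
rewrite E gtr0_norm// dotZl dotZr exprMn exprVn mulrCA mulrA.
congr (_ * expR (- _)); field.
by rewrite rn0.
Qed.

End GaussRn.

(** * Fubini and Fourier inversion on R^n *)

Section Fubini2.
Context {R : realType} {n : nat}.
Implicit Types (a b : 'rV[R]_n -> R) (c : 'rV[R]_n -> 'rV[R]_n -> R).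
Local Notation L := (lebn R n).

(** The kernel is dominated by |a(z) b(y)|, which is integrable for the product
measure. This shape covers the exchange of a Fourier integral with an integral
against a function of the dual variable. *)
Lemma Int_fubini a b c : Intg a -> Intg b ->
  measurable_fun setT (fun p : Rn R n * Rn R n => c (rVtuple p.1) (rVtuple p.2)) ->
  (forall z y, `|c z y| <= 1) ->
  [/\ Intg (fun z => Int (fun y => a z * b y * c z y)),
      (forall z, Intg (fun y => a z * b y * c z y)) &
      Int (fun z => Int (fun y => a z * b y * c z y)) =
      Int (fun y => Int (fun z => a z * b y * c z y))].
Proof.
move=> Ia Ib mc c1.
pose K (p : Rn R n * Rn R n) :=
  a (rVtuple p.1) * b (rVtuple p.2) * c (rVtuple p.1) (rVtuple p.2).
have ma : measurable_fun setT (fun p : Rn R n * Rn R n => a (rVtuple p.1)).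
  by apply: (measurableT_comp (Intg_meas Ia)).
have mb : measurable_fun setT (fun p : Rn R n * Rn R n => b (rVtuple p.2)).
  by apply: (measurableT_comp (Intg_meas Ib)).
have mK : measurable_fun setT K.
  by apply: measurable_funM => //; exact: measurable_funM.
have mKE : measurable_fun setT (EFin \o K) by exact/measurable_EFinP.
have IK : (L \x L)%E.-integrable setT (EFin \o K).
  apply: (@le_integrable _ _ _ _ setT measurableT _
     (fun p => ((a (rVtuple p.1))%:E * (b (rVtuple p.2))%:E)%E)) => //.
    move=> p _; rewrite /= lee_fin normrM ler_piMr//.
  apply/integrable12ltyP.
    by apply/measurable_EFinP; exact: measurable_funM.
  rewrite /=.
  have -> : (fun z => (\int[L]_y `|a (rVtuple z) * b (rVtuple y)|%:E)%E) =
     (fun z => (`|a (rVtuple z)|%:E * \int[L]_y `|b (rVtuple y)|%:E)%E).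
    apply/funext => z; rewrite -ge0_integralZl//.
    - by apply: eq_integral => y _; rewrite normrM EFinM.
    - apply/measurable_EFinP; apply: measurableT_comp => //; exact: Intg_meas.
  rewrite ge0_integralZr//; last 2 first.
  - by apply/measurable_EFinP; apply: measurableT_comp => //; exact: Intg_meas.
  - exact: integral_ge0.
  move/integrableP : Ia => [_ f1]; move/integrableP : Ib => [_ g1].
  by rewrite lte_mul_pinfty// ?integral_ge0// ge0_fin_numE// integral_ge0.
have Iz z : Intg (fun y => a z * b y * c z y).
  pose t : Rn R n := [tuple z 0 i | i < n].
  have tz : rVtuple t = z by apply/rowP => i; rewrite mxE tnth_mktuple.
  apply: (@Intg_mulb _ _ (fun y => a z * b y) _ 1) => //; first exact: IntgZ.
  have := measurableT_comp mc (pair1_measurable t).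
  by rewrite /Meas /comp /= tz.
have Iy y : Intg (fun z => a z * b y * c z y).
  pose t : Rn R n := [tuple y 0 i | i < n].
  have tz : rVtuple t = y by apply/rowP => i; rewrite mxE tnth_mktuple.
  apply: (@Intg_mulb _ _ (fun z => a z * b y) (c^~ y) 1) => //.
    by have := IntgZ (b y) Ia; congr Intg; apply/funext => z; rewrite mulrC.
  have := measurableT_comp mc (pair2_measurable t).
  by rewrite /Meas /comp /= tz.
have FE : fubini_F L (EFin \o K) =
    fun z => (Int (fun y => a (rVtuple z) * b y * c (rVtuple z) y))%:E.
  by apply/funext => z; rewrite Int_E.
have GE : fubini_G L (EFin \o K) =
    fun y => (Int (fun z => a z * b (rVtuple y) * c z (rVtuple y)))%:E.
  by apply/funext => z; rewrite Int_E.
split; [|exact: Iz|].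
  by have := integrable_fubini_F IK; rewrite FE.
by rewrite /Int /Rintegral -FE -GE integral12_prod_meas1// integral21_prod_meas1.
Qed.

Lemma Meas_coord i : Meas (fun x : 'rV[R]_n => x 0 i).
Proof. by rewrite /Meas; under eq_fun do rewrite mxE; exact: measurable_tnth. Qed.

Lemma measurable_dot :
  measurable_fun setT (fun p : Rn R n * Rn R n => dot (rVtuple p.1) (rVtuple p.2)).
Proof.
apply: measurable_sum => i; apply: measurable_funM.
  exact: (measurableT_comp (Meas_coord i) measurable_fst).
exact: (measurableT_comp (Meas_coord i) measurable_snd).
Qed.

Lemma measurable_cos_dot : measurable_fun setT
  (fun p : Rn R n * Rn R n => cos (dot (rVtuple p.1) (rVtuple p.2))).
Proof.
apply: measurableT_comp; last exact: measurable_dot.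
by apply: continuous_measurable_fun; exact: continuous_cos.
Qed.

End Fubini2.

Opaque Intg Int.

Section Inversion.
Context {R : realType} {n : nat}.
Implicit Types (m f : 'rV[R]_n -> R) (z x xi : 'rV[R]_n).

Lemma continuous_compose (T U V : topologicalType) (f : T -> U) (g : U -> V) :
  continuous f -> continuous g -> continuous (fun x : T => g (f x)).
Proof. by move=> cf cg x; apply: cvg_comp; [exact: cf|exact: cg]. Qed.

Lemma cvg_rsum (I T : Type) (F : set_system T) (FF : Filter F) (r : seq I)
    (f : I -> T -> R) (a : I -> R) :
  (forall i, f i x @[x --> F] --> a i) ->
  \sum_(i <- r) f i x @[x --> F] --> \sum_(i <- r) a i.
Proof.
move=> fa; elim: r => [|i r IH].
  by rewrite big_nil; under eq_fun do rewrite big_nil; exact: cvg_cst.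
by rewrite big_cons; under eq_fun do rewrite big_cons; exact: cvgD.
Qed.

Lemma continuous_dot z : continuous (fun x => dot z x).
Proof.
move=> x; apply: (@cvg_rsum _ _ (nbhs x)) => i; apply: cvgM; first exact: cvg_cst.
exact: coord_continuous.
Qed.

Lemma continuous_dotself : continuous (fun x : 'rV[R]_n => dot x x).
Proof.
by move=> x; apply: (@cvg_rsum _ _ (nbhs x)) => i; apply: cvgM;
  exact: coord_continuous.
Qed.

Lemma Meas_cos_dot z : Meas (fun x => cos (dot z x)).
Proof.
apply: continuous_meas => x; apply: continuous_comp; first exact: continuous_dot.
exact: continuous_cos.
Qed.

Lemma Meas_sin_dot z : Meas (fun x => sin (dot z x)).
Proof.
apply: continuous_meas => x; apply: continuous_comp; first exact: continuous_dot.
exact: continuous_sin.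
Qed.

(** The inverse Fourier transform of an even symbol, for which only the cosine part
survives; it is real-valued. *)
Definition ft m z : R := (2 * pi) ^- n * Int (fun y => m y * cos (dot z y)).

Lemma Intg_mulcos m z : Intg m -> Intg (fun y => m y * cos (dot z y)).
Proof.
move=> Im; apply: (Intg_mulb (C := 1)) => // [|x]; first exact: Meas_cos_dot.
exact: norm_cos_le1.
Qed.

Lemma Intg_mulsin m z : Intg m -> Intg (fun y => m y * sin (dot z y)).
Proof.
move=> Im; apply: (Intg_mulb (C := 1)) => // [|x]; first exact: Meas_sin_dot.
exact: norm_sin_le1.
Qed.

(** As a partial integral, the transform multiplied by a Gaussian is measurable by
Fubini's theorem; the Gaussian is then divided out. *)
Lemma Meas_ft m : Intg m -> Meas (ft m).
Proof.
move=> Im; pose g x : R := expR (- (1 ^+ 2 * dot x x)).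
have [Ig _] := gauss_scaled 0 (@ltr01 R) : Intg g /\ _.
have [M _ _] := Int_fubini Ig Im measurable_cos_dot
  (fun z y => norm_cos_le1 (dot z y)).
have mg : Meas (fun z => (g z)^-1).
  have -> : (fun z => (g z)^-1) = (fun z => expR (dot z z)).
    by apply/funext => z; rewrite /g -expRN opprK expr1n mul1r.
  have md : Meas (fun z => dot z z).
    by apply: measurable_sum => i; apply: measurable_funM; exact: Meas_coord.
  by apply: (measurableT_comp _ md); exact: measurable_expR.
have -> : ft m = (fun z => (2 * pi) ^- n *
   ((g z)^-1 * Int (fun y => g z * m y * cos (dot z y)))).
  apply/funext => z; rewrite /ft; congr (_ * _).
  under [in RHS]eq_fun do rewrite -mulrA.
  by rewrite IntZ ?mulKf ?gt_eqF ?expR_gt0//; exact: Intg_mulcos.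
have := Intg_meas M => {}M.
have M' : Meas (fun z => (g z)^-1 * Int (fun y => g z * m y * cos (dot z y))).
  exact: measurable_funM.
by apply: measurable_funM.
Qed.


Definition even_fun m := forall x, m (- x) = m x.

(** The symbols for which the convolution with the inverse transform is an absolutely
convergent integral and for which Fourier inversion holds. *)
Record good_symbol m : Prop := {
  good_even : even_fun m ;
  good_cont : continuous m ;
  good_bound : exists C : R, forall x, `|m x| <= C ;
  good_int : Intg m ;
  good_ft : Intg (ft m) }.

Lemma ft_even m : even_fun (ft m).
Proof.
move=> z; rewrite /ft; congr (_ * Int _); apply/funext => y.
by rewrite dotNl cosN.
Qed.

Lemma Int_even_neg f : Intg f -> Int (fun x => f (- x)) = Int f.
Proof.
move=> If; have N0 : -1 != 0 :> R by rewrite oppr_eq0 oner_eq0.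
have := Int_affine 0 N0 If; rewrite normrN1 expr1n invr1 mul1r => <-.
by congr Int; apply/funext => x; rewrite add0r scaleN1r.
Qed.

Lemma Int_mulsin_even m z : even_fun m -> Intg m -> Int (fun y => m y * sin (dot z y)) = 0.
Proof.
move=> em Im; apply: Int_odd; first exact: Intg_mulsin.
by move=> x; rewrite em dotNr sinN mulrN.
Qed.

Lemma Intg_mulgauss m xi (e : R) : Intg m ->
  Intg (fun y => m y * expR (- (dot (y - xi) (y - xi) / (4 * e ^+ 2)))).
Proof.
move=> Im.
apply: (Intg_mulb (C := 1)) => // [|x].
  have cs : continuous (fun y : 'rV[R]_n => y - xi).
    by move=> x; apply: (@cvgB _ _ _ (nbhs x)); [exact: cvg_id|exact: cvg_cst].
  have cd : continuous (fun y : 'rV[R]_n => dot (y - xi) (y - xi)).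
    exact: (continuous_compose cs continuous_dotself).
  apply: continuous_meas.
  have cn : continuous (fun y : 'rV[R]_n => - (dot (y - xi) (y - xi) / (4 * e ^+ 2))).
    by move=> y; apply: (@cvgN _ _ _ (nbhs y)); apply: (cvgM (cd y)); exact: cvg_cst.
  exact: (continuous_compose cn (@continuous_expR R)).
rewrite ger0_norm ?expR_ge0// -expR0 ler_expR oppr_le0 mulr_ge0 ?dot_ge0//.
by rewrite invr_ge0 mulr_ge0// sqr_ge0.
Qed.

Lemma gauss_conv m xi (e : R) : 0 < e -> Intg m ->
  Int (fun y => m y * expR (- (dot (y - xi) (y - xi) / (4 * e ^+ 2)))) =
  (2 * e) ^+ n * Int (fun y => m (xi + (2 * e) *: y) * expR (- (1 ^+ 2 * dot y y))).
Proof.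
move=> e0 Im; have e20 : 2 * e != 0 by rewrite mulf_neq0// gt_eqF.
pose h y := m y * expR (- (dot (y - xi) (y - xi) / (4 * e ^+ 2))).
have Ih : Intg h by exact: Intg_mulgauss.
have := Int_affine xi e20 Ih; rewrite gtr0_norm; last by rewrite mulr_gt0.
move=> E; transitivity ((2 * e) ^+ n * ((2 * e) ^- n * Int h)).
  by rewrite mulVKf// expf_neq0.
rewrite -E; congr (_ * Int _); apply/funext => y; rewrite /h; congr (_ * expR (- _)).
rewrite addrAC subrr add0r dotZl dotZr expr1n mul1r; field.
by rewrite gt_eqF.
Qed.

Lemma cosMcos (a b : R) : cos a * cos b = 2^-1 * (cos (a - b) + cos (a + b)).
Proof. by rewrite cosB cosD; field. Qed.

Lemma gauss_mean_constant (k : nat) (J e p : R) : 0 < e -> 0 < p ->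
  (2 * p ^+ 2) ^- k * ((p / e) ^+ k / 2 * ((2 * e) ^+ k * J + (2 * e) ^+ k * J)) =
  p ^- k * J.
Proof.
move=> e0 p0.
have e1 : e ^+ k != 0 by rewrite expf_neq0// gt_eqF.
have p1 : p ^+ k != 0 by rewrite expf_neq0// gt_eqF.
have p3 : (2 : R) ^+ k != 0 by rewrite expf_neq0.
have -> : (p / e) ^+ k = p ^+ k / e ^+ k by rewrite exprMn exprVn.
rewrite !exprMn; field.
by rewrite e1 p1 p3.
Qed.

Lemma sqrtr_pi_gt0 : 0 < Num.sqrt (pi : R).
Proof. by rewrite sqrtr_gt0 pi_gt0. Qed.

(** By Fubini, integrating the transform against a Gaussian amounts to averaging m
against the transform of that Gaussian, which is a Gaussian of width 2 e
around xi. *)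
Lemma ft_gauss_mean m xi (e : R) : good_symbol m -> 0 < e ->
  Int (fun z => ft m z * cos (dot xi z) * expR (- (e ^+ 2 * dot z z))) =
  Num.sqrt pi ^- n * Int (fun y => m (xi + (2 * e) *: y) * expR (- (1 ^+ 2 * dot y y))).
Proof.
move=> [em cm bm Im _] e0.
pose G z := expR (- (e ^+ 2 * dot z z)).
have [IG _] := gauss_scaled 0 e0 : Intg G /\ _.
pose a z := G z * cos (dot xi z).
have Ia : Intg a by exact: Intg_mulcos.
have [IF IK FK] := Int_fubini Ia Im measurable_cos_dot (fun z y => norm_cos_le1 (dot z y)).
transitivity ((2 * pi) ^- n * Int (fun z => Int (fun y => a z * m y * cos (dot z y)))).
  rewrite -IntZ; last exact: IF.
  congr Int; apply/funext => z; rewrite /ft.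
  under [in RHS]eq_fun do rewrite -mulrA.
  rewrite IntZ; last exact: Intg_mulcos.
  by rewrite /a /G; ring.
rewrite FK.
pose Ga z := expR (- (dot z z / (4 * e ^+ 2))).
have inner y : Int (fun z => a z * m y * cos (dot z y)) =
   (Num.sqrt pi / e) ^+ n * 2^-1 * (m y * Ga (y - xi) + m y * Ga (y + xi)).
  transitivity (Int (fun z => (m y / 2) * (G z * cos (dot (y - xi) z) + G z * cos (dot (y + xi) z)))).
    congr Int; apply/funext => z; rewrite /a.
    by rewrite (dotC z y) dotDl dotDl dotNl cosB cosD; field.
  rewrite IntZ; last by apply: IntgD; exact: Intg_mulcos.
  rewrite IntD; [|exact: Intg_mulcos..].
  have [_ ->] := gauss_scaled (y - xi) e0; have [_ ->] := gauss_scaled (y + xi) e0.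
  by rewrite -/(Ga _) -/(Ga _); field.
under eq_fun do rewrite inner.
have I1 : Intg (fun y => m y * Ga (y - xi)) by exact: Intg_mulgauss.
have I2 : Intg (fun y => m y * Ga (y + xi)).
  by have := Intg_mulgauss (- xi) e Im; rewrite opprK.
rewrite IntZ; last exact: IntgD.
rewrite (IntD I1 I2).
have -> : Int (fun y => m y * Ga (y + xi)) = Int (fun y => m y * Ga (y - xi)).
  rewrite -(Int_even_neg I1); congr Int; apply/funext => y; rewrite em.
  by congr (_ * _); rewrite /Ga -opprD dotNl dotNr opprK.
rewrite (gauss_conv _ e0 Im).
have := gauss_mean_constant n (Int (fun y => m (xi + (2 * e) *: y) *
  expR (- (1 ^+ 2 * dot y y)))) e0 sqrtr_pi_gt0.
by rewrite (sqr_sqrtr (pi_ge0 R)) => ->.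
Qed.

(** Let e tend to 0 in [ft_gauss_mean]: the left-hand side converges because the
transform is integrable, the right-hand side because m is bounded and
continuous. *)
Lemma fourier_inversion m xi : good_symbol m ->
  Int (fun z => ft m z * cos (dot xi z)) = m xi.
Proof.
move=> gm; have [em cm [C bm] Im If] := gm.
pose e k : R := k.+1%:R^-1.
have e0 k : 0 < e k by rewrite invr_gt0.
have ce : e k @[k --> \oo] --> 0 by exact: cvg_harmonic.
have Ig0 : Intg (fun y : 'rV[R]_n => expR (- (1 ^+ 2 * dot y y))).
  by have [] := gauss_scaled (0 : 'rV[R]_n) (@ltr01 R).
have cL : Int (fun z => ft m z * cos (dot xi z) * expR (- ((e k) ^+ 2 * dot z z)))
   @[k --> \oo] --> Int (fun z => ft m z * cos (dot xi z)).
  have [] // := @Int_dominated R n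
    (fun k z => ft m z * cos (dot xi z) * expR (- ((e k) ^+ 2 * dot z z)))
    (fun z => ft m z * cos (dot xi z)) (fun z => `|ft m z|).
  - move=> k; have [Ig _] := gauss_scaled (0 : 'rV[R]_n) (e0 k).
    have M1 := Intg_meas (Intg_mulcos xi If); have M2 := Intg_meas Ig.
    exact: (measurable_funM M1 M2).
  - move=> z.
    have c1 : - ((e k) ^+ 2 * dot z z) @[k --> \oo] --> - (0 * 0 * dot z z).
      by apply: cvgN; apply: cvgM; [exact: cvgM|exact: cvg_cst].
    have := cvg_comp _ _ c1 (@continuous_expR R _).
    rewrite !mul0r oppr0 expR0 => c2.
    have := cvgM (cvg_cst (ft m z * cos (dot xi z))) c2; rewrite mulr1 => c3.
    exact: c3.
  - exact: Intg_norm.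
  - move=> k z; rewrite !normrM -mulrA ler_piMr//.
    rewrite mulr_ile1 ?norm_cos_le1// ger0_norm ?expR_ge0//.
    by rewrite -expR0 ler_expR oppr_le0 mulr_ge0 ?sqr_ge0 ?dot_ge0.
have cR : Int (fun z => ft m z * cos (dot xi z) * expR (- ((e k) ^+ 2 * dot z z)))
   @[k --> \oo] --> m xi.
  under eq_fun do rewrite (ft_gauss_mean xi gm (e0 _)).
  have [] // := @Int_dominated R n
    (fun k y => m (xi + (2 * e k) *: y) * expR (- (1 ^+ 2 * dot y y)))
    (fun y => m xi * expR (- (1 ^+ 2 * dot y y)))
    (fun y => C * expR (- (1 ^+ 2 * dot y y))).
  - move=> k; have M2 := Intg_meas Ig0.
    have M1 := Meas_affine xi (2 * e k) (continuous_meas cm).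
    exact: (measurable_funM M1 M2).
  - move=> y; apply: cvgM; last exact: cvg_cst.
    have c1 : xi + (2 * e k) *: y @[k --> \oo] --> xi + (2 * 0) *: y.
      apply: cvgD; first exact: cvg_cst.
      by apply: cvgZr_tmp; apply: cvgM => //; exact: cvg_cst.
    have := cvg_comp _ _ c1 (cm _); rewrite mulr0 scale0r addr0 => c2.
    exact: c2.
  - exact: IntgZ.
  - by move=> k y; rewrite normrM (ger0_norm (expR_ge0 _)) ler_wpM2r ?expR_ge0.
  move=> _ cv.
  have -> : m xi = Num.sqrt pi ^- n * Int (fun y : 'rV[R]_n => m xi * expR (- (1 ^+ 2 * dot y y))).
    rewrite IntZ//; have [_] := gauss_scaled (0 : 'rV[R]_n) (@ltr01 R).
    under eq_fun do rewrite dot0l cos0 mulr1.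
    move=> ->; rewrite dot0l mul0r oppr0 expR0 mulr1 divr1 mulrCA mulVf ?mulr1//.
    by rewrite expf_neq0// gt_eqF// sqrtr_gt0 pi_gt0.
  by apply: cvgM => //; exact: cvg_cst.
exact: (cvg_unique _ cL cR).
Qed.

End Inversion.

Transparent Intg Int.

(** * Admissible symbols; multipliers on R^n *)

Section EuclideanMultiplier.
Context {R : realType} {n : nat}.
Implicit Types (m f g : 'rV[R]_n -> R) (z x xi : 'rV[R]_n).
Local Open Scope complex_scope.

Definition tame (M : flat_space) f :=
  [/\ defined_on M f, continuous f & exists B : R, forall x, `|f x| <= B].

(** All that the construction of the solution needs to know of a multiplier. On
cosines it acts through the symbol at a lattice point on an axis, the same one on
R^n and on T^n, so that both cases are treated at once from here on. *)
Record admissible (M : flat_space) m : Prop := {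
  adm_bound : exists2 C : R, 0 <= C & forall f (B : R) x, tame M f ->
    (forall y, `|f y| <= B) -> Normc.normc (multiplier M m f x) <= C * B ;
  adm_lin : forall (a : R) f g x, tame M f -> tame M g ->
    multiplier M m (fun y => a * f y + g y) x =
    a%:C * multiplier M m f x + multiplier M m g x ;
  adm_cos : forall (k : nat) i x,
    multiplier M m (fun y => cos (k%:R * y 0 i)) x =
    (m (k%:R *: delta_mx 0 i) * cos (k%:R * x 0 i))%:C }.

Lemma inv_fourierE m z : even_fun m -> Intg m -> inv_fourier m z = (ft m z)%:C.
Proof.
move=> em Im; rewrite /inv_fourier /cintegral.
have -> : Rintegral (lebn R n) setT (fun t => complex.Re ((m (rVtuple t))%:C * cis (dot z (rVtuple t)))) =
  Int (fun y => m y * cos (dot z y)).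
  by apply: eq_Rintegral => t _; rewrite cReM /= mul0r subr0.
have -> : Rintegral (lebn R n) setT (fun t => complex.Im ((m (rVtuple t))%:C * cis (dot z (rVtuple t)))) =
  Int (fun y => m y * sin (dot z y)).
  by apply: eq_Rintegral => t _; rewrite cImM /= mul0r addr0.
by rewrite (Int_mulsin_even z em Im) -rmorphM.
Qed.

Lemma euclid_multiplierE m f x : even_fun m -> Intg m ->
  multiplier Euclidean m f x = (Int (fun y => ft m (x - y) * f y))%:C.
Proof.
move=> em Im; rewrite /multiplier /cintegral.
have E t : inv_fourier m (x - rVtuple t) * (f (rVtuple t))%:C =
    (ft m (x - rVtuple t) * f (rVtuple t))%:C.
  by rewrite (inv_fourierE _ em Im) [RHS]rmorphM.
apply: (f_equal2 (@Complex (Real.sort R))).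
  by apply: eq_Rintegral => t _; rewrite E.
transitivity (Rintegral (lebn R n) setT (fun=> 0)).
  by apply: eq_Rintegral => t _; rewrite E.
by rewrite /Rintegral integral0.
Qed.

Lemma Intg_conv m f x : good_symbol m -> tame Euclidean f ->
  Intg (fun y => ft m (x - y) * f y).
Proof.
move=> gm [_ cf [B fB]]; have [_ _ _ Im If] := gm.
have N0 : -1 != 0 :> R by rewrite oppr_eq0 oner_eq0.
apply: (Intg_mulb _ _ fB); last exact: continuous_meas.
have := Intg_affine x N0 If; congr Intg; apply/funext => y.
by rewrite scaleN1r.
Qed.

(** The multiplier is the convolution with an integrable kernel; applied to a cosine
it yields the cosine integral of the kernel, which is m by Fourier inversion, and
a sine integral, which is zero by parity. *)
Lemma euclid_admissible m : good_symbol m -> admissible Euclidean m.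
Proof.
move=> gm; have [em cm _ Im If] := gm.
have N0 : -1 != 0 :> R by rewrite oppr_eq0 oner_eq0.
have sub (h : 'rV[R]_n -> R) x : Intg h -> Int (fun y => h (x - y)) = Int h.
  move=> Ih; have := Int_affine x N0 Ih; rewrite normrN1 expr1n invr1 mul1r => <-.
  by congr Int; apply/funext => y; rewrite scaleN1r.
split.
- exists (Int (fun y => `|ft m y|)).
    by apply: Rintegral_ge0 => t _.
  move=> f B x tf fB; rewrite euclid_multiplierE//.
  have IC := Intg_conv x gm tf.
  rewrite /Normc.normc /= expr0n addr0 sqrtr_sqr.
  apply: (le_trans (le_norm_Int IC)).
  have Ia := Intg_norm If.
  rewrite -(sub _ x Ia) mulrC.
  have Ia' : Intg (fun y => `|ft m (x - y)|).
    have := Intg_affine x N0 Ia; congr Intg; apply/funext => y.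
    by rewrite scaleN1r.
  rewrite -(IntZ B Ia').
  apply: le_Int; [exact: Intg_norm|exact: IntgZ|move=> y].
  by rewrite normrM mulrC ler_wpM2r.
- move=> a f g x tf tg; rewrite !euclid_multiplierE//.
  have If' := Intg_conv x gm tf; have Ig' := Intg_conv x gm tg.
  rewrite -rmorphM -rmorphD; congr (_%:C).
  rewrite -(IntZ a If') -(IntD (IntgZ a If') Ig').
  by congr Int; apply/funext => y; rewrite mulrDr mulrCA.
- move=> k i x; rewrite euclid_multiplierE//; congr (_%:C).
  pose xi : 'rV[R]_n := k%:R *: delta_mx 0 i.
  have dE (y : 'rV[R]_n) : k%:R * y 0 i = dot xi y.
    rewrite /xi dotZl; congr (_ * _); rewrite /dot (bigD1 i)//= big1.
      by rewrite mxE !eqxx mul1r addr0.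
    by move=> j ji; rewrite mxE eqxx (negbTE ji) mul0r.
  have Ic := Intg_mulcos xi If; have Is := Intg_mulsin xi If.
  have Iall : Intg (fun s => cos (dot xi x) * (ft m s * cos (dot xi s)) +
     sin (dot xi x) * (ft m s * sin (dot xi s))).
    by apply: IntgD; exact: IntgZ.
  transitivity (Int (fun s => cos (dot xi x) * (ft m s * cos (dot xi s)) +
     sin (dot xi x) * (ft m s * sin (dot xi s)))).
    rewrite -(sub _ x Iall); congr Int; apply/funext => y.
    rewrite dE; have -> : cos (dot xi y) = cos (dot xi x - dot xi (x - y)).
      by rewrite dotDr dotNr opprD opprK addNKr.
    by rewrite cosB; ring.
  rewrite (IntD (IntgZ _ Ic) (IntgZ _ Is)) (IntZ _ Ic) (IntZ _ Is).
  rewrite (fourier_inversion xi gm) (Int_mulsin_even xi (@ft_even _ _ m) If).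
  by rewrite mulr0 addr0 mulrC dE.
Qed.

End EuclideanMultiplier.

Section GoodSymbols.
Context {R : realType} {n : nat}.
Implicit Types (m f g : 'rV[R]_n -> R) (z x xi : 'rV[R]_n).

Lemma ft_scale m (r : R) z : 0 < r -> Intg m ->
  ft (fun x => m (r *: x)) z = (r ^+ n)^-1 * ft m (r^-1 *: z).
Proof.
move=> r0 Im; have rn0 : r != 0 by rewrite gt_eqF.
have Ic := Intg_mulcos (r^-1 *: z) Im.
have := Int_affine 0 rn0 Ic; rewrite gtr0_norm// => E.
rewrite /ft mulrCA -E; congr (_ * Int _); apply/funext => y.
by rewrite add0r dotZl dotZr mulKf.
Qed.

Lemma good_scale m (r : R) : 0 < r -> good_symbol m ->
  good_symbol (fun x => m (r *: x)).
Proof.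
move=> r0 [em cm [C bm] Im If]; have rn0 : r != 0 by rewrite gt_eqF.
have riv0 : r^-1 != 0 by rewrite invr_eq0.
split.
- by move=> x; rewrite scalerN em.
- apply: (continuous_compose _ cm) => x.
  exact: (@cvgZl_tmp _ _ _ (nbhs x) _ r id).
- by exists C => x; exact: bm.
- have := Intg_affine 0 rn0 Im; congr Intg; apply/funext => x.
  by rewrite add0r.
- have -> : ft (fun x => m (r *: x)) = fun z => (r ^+ n)^-1 * ft m (0 + r^-1 *: z).
    by apply/funext => z; rewrite ft_scale// add0r.
  by apply: IntgZ; exact: Intg_affine.
Qed.

Lemma good_sub m1 m2 : good_symbol m1 -> good_symbol m2 ->
  good_symbol (fun x => m1 x - m2 x).
Proof.
move=> [em1 cm1 [C1 bm1] Im1 If1] [em2 cm2 [C2 bm2] Im2 If2]; split.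
- by move=> x; rewrite em1 em2.
- by move=> x; exact: (cvgB (cm1 x) (cm2 x)).
- by exists (C1 + C2) => x; rewrite (le_trans (ler_normB _ _))// lerD.
- exact: IntgB.
- have -> : ft (fun x => m1 x - m2 x) = fun z => ft m1 z - ft m2 z.
    apply/funext => z; rewrite /ft -mulrBr; congr (_ * _).
    rewrite -(IntB (Intg_mulcos z Im1) (Intg_mulcos z Im2)).
    by congr Int; apply/funext => y; rewrite mulrBl.
  exact: IntgB.
Qed.

(** The transform of a Gaussian is a Gaussian. *)
Lemma good_gauss (t : R) : 0 < t ->
  good_symbol (fun x : 'rV[R]_n => expR (- t * enorm x ^+ 2)).
Proof.
move=> t0; pose r := Num.sqrt t.
have r0 : 0 < r by rewrite sqrtr_gt0.
have E : (fun x : 'rV[R]_n => expR (- t * enorm x ^+ 2)) =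
    (fun x => expR (- (r ^+ 2 * dot x x))).
  by apply/funext => x; rewrite enorm_sq sqr_sqrtr ?ltW// mulNr.
rewrite E.
have [Ig _] := gauss_scaled (0 : 'rV[R]_n) r0.
split => //.
- by move=> x; rewrite dotNl dotNr opprK.
- apply: (continuous_compose _ (@continuous_expR R)) => x.
  apply: (@cvgN _ _ _ (nbhs x)); apply: cvgM; first exact: cvg_cst.
  exact: continuous_dotself.
- exists 1 => x; rewrite ger0_norm ?expR_ge0// -expR0 ler_expR oppr_le0.
  by rewrite mulr_ge0 ?sqr_ge0 ?dot_ge0.
- have r20 : 0 < (2 * r)^-1 by rewrite invr_gt0 mulr_gt0.
  have -> : ft (fun x : 'rV[R]_n => expR (- (r ^+ 2 * dot x x))) = fun z =>
     ((2 * pi) ^- n * (Num.sqrt pi / r) ^+ n) * expR (- ((2 * r)^-1 ^+ 2 * dot z z)).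
    apply/funext => z; rewrite /ft; have [_ ->] := gauss_scaled z r0.
    rewrite mulrA; congr (_ * expR (- _)); rewrite mulrC exprVn exprMn.
    by congr (_^-1 * _); ring.
  by apply: IntgZ; have [] := gauss_scaled (0 : 'rV[R]_n) r20.
Qed.

End GoodSymbols.

(** * Decay of the Fourier transform of a Littlewood-Paley symbol *)

Section Decay.
Context {R : realType} {n : nat}.
Implicit Types (f g : 'rV[R]_n -> R) (z x : 'rV[R]_n).

Definition compact_supp f := exists r : R, forall x, r <= `|x| -> f x = 0.

Lemma compact_supp_bounded f : continuous f -> compact_supp f ->
  exists2 C : R, 0 <= C & forall x, `|f x| <= C.
Proof.
move=> cf [r fr].
have cA : compact [set x : 'rV[R]_n | `|x| <= r].
  apply: bounded_closed_compact.
    by exists r; split; [exact: num_real|move=> M rM x /= xr; exact: (le_trans xr (ltW rM))].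
  rewrite (_ : [set x | _] = (fun x : 'rV[R]_n => `|x|) @^-1` [set y | y <= r])//.
  apply: preimage_closed; last exact: closed_le.
  by move=> x _; exact: norm_continuous.
have /compact_bounded[M [_ HM]] := continuous_compact (continuous_subspaceT cf) cA.
exists (`|M| + 1) => [|x]; first by rewrite addr_ge0.
have [rx|xr] := leP r `|x|; first by rewrite fr// normr0 addr_ge0.
apply: (HM (`|M| + 1)); last by exists x => //=; exact: ltW.
by rewrite (le_lt_trans (ler_norm _))// ltrDl.
Qed.

Lemma dot_le_norm x : dot x x <= n%:R * `|x| ^+ 2.
Proof.
rewrite -[n in n%:R]card_ord mulr_natl -sumr_const; apply: ler_sum => i _.
by rewrite -expr2 -[leLHS]real_normK ?num_real// lerXn2r ?nnegrE//; exact: coord_le_norm.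
Qed.

(** A Gaussian is a convenient integrable majorant for all functions supported in a
given ball. *)
Lemma compact_dom f (r C : R) : 0 <= r -> 0 <= C ->
  (forall x, `|f x| <= C) -> (forall x, r <= `|x| -> f x = 0) ->
  forall x, `|f x| <= C * expR (n%:R * r ^+ 2) * expR (- (1 ^+ 2 * dot x x)).
Proof.
move=> r0 C0 fC fr x; have [rx|xr] := leP r `|x|.
  by rewrite fr// normr0 !mulr_ge0// expR_ge0.
apply: (le_trans (fC x)); rewrite -mulrA ler_peMr// -expRD.
apply: le_trans (expR_ge1Dx _); rewrite lerDl.
rewrite expr1n mul1r subr_ge0 (le_trans (dot_le_norm x))//.
by rewrite ler_wpM2l// lerXn2r ?nnegrE// ltW.
Qed.

Lemma Intg_gauss1 (C : R) : Intg (fun x : 'rV[R]_n => C * expR (- (1 ^+ 2 * dot x x))).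
Proof.
by apply: IntgZ; have [] := gauss_scaled (0 : 'rV[R]_n) (@ltr01 R).
Qed.

Lemma Intg_compact f : continuous f -> compact_supp f -> Intg f.
Proof.
move=> cf sf; have [C C0 fC] := compact_supp_bounded cf sf; case: sf => r fr.
apply: (Intg_le _ (compact_dom (normr_ge0 r) C0 fC _)).
- exact: continuous_meas.
- by move=> x rx; apply: fr; exact: (le_trans (ler_norm _) rx).
- exact: Intg_gauss1.
Qed.

(** The derivative of f along v is the derivative of the restriction of f to a line,
to which the one-variable mean value theorem applies. *)
Lemma is_derive_line f v x (s : R) : derivable f (x + s *: v) v ->
  is_derive s 1 (fun s => f (x + s *: v)) ('D_v f (x + s *: v)).
Proof.
move=> df.
have E : (fun h => h^-1 *: ((((fun s => f (x + s *: v)) \o shift s) (h *: 1 : R)) -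
    f (x + s *: v))) = (fun h => h^-1 *: ((f \o shift (x + s *: v)) (h *: v) - f (x + s *: v))).
  apply/funext => h /=; congr (_ *: (f _ - _)).
  have -> : h%:A + s = h + s :> R by rewrite /GRing.scale/= mulr1.
  by rewrite scalerDl addrCA.
apply: DeriveDef.
- by rewrite /derivable E.
- by rewrite /derive E.
Qed.

Lemma line_lipschitz f v x (C h : R) : (forall y, derivable f y v) ->
  (forall y, `|'D_v f y| <= C) -> 0 <= h -> `|f (x + h *: v) - f x| <= C * h.
Proof.
move=> df dC h0.
have dl (s : R) : is_derive s 1 (fun s => f (x + s *: v)) ('D_v f (x + s *: v)).
  exact: is_derive_line.
have [] := @MVT_segment R (fun s => f (x + s *: v)) (fun s => 'D_v f (x + s *: v)) 0 h h0.
- have cl : continuous (fun s : R => f (x + s *: v)).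
    move=> s; apply: differentiable_continuous.
    by apply/derivable1_diffP; apply: (@ex_derive _ _ _ _ _ _ _ (dl s)).
  exact: continuous_subspaceT.
move=> c _; rewrite scale0r addr0 subr0 => ->.
by rewrite normrM (ger0_norm h0) ler_wpM2r.
Qed.

Lemma derive_compact_supp f v : compact_supp f -> compact_supp (fun x => 'D_v f x).
Proof.
move=> [r fr]; exists (r + 1) => x rx.
have rx' : r < `|x| by rewrite (lt_le_trans _ rx)// ltrDl.
rewrite /derive; apply/cvg_lim => //.
apply: (@cvg_near_cst); rewrite fr ?ltW//.
have cx : (fun h : R => `|h *: v + x|) @ (0 : R) --> `|0 *: v + x|.
  apply: cvg_norm; apply: cvgD; last exact: cvg_cst.
  by apply: cvgZr_tmp; exact: cvg_id.
rewrite scale0r add0r in cx.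
apply: nbhs_dnbhs.
have d0 : 0 < `|x| - r by rewrite subr_gt0.
move/cvgrPdist_lt : cx => /(_ _ d0); apply: filterS => h /= hr.
rewrite fr ?subrr ?scaler0//; have := ler_norm (`|x| - `|h *: v + x|); lra.
Qed.

Definition csmooth f := smooth f /\ compact_supp f.

Lemma smooth_continuous f : smooth f -> continuous f.
Proof. by move=> sf; exact: (sf 0%N). Qed.

Lemma smooth_derive f v : smooth f -> smooth (fun x => 'D_v f x).
Proof. by move=> sf k; have [_] := sf k.+1; exact. Qed.

Lemma smooth_derivable f v x : smooth f -> derivable f x v.
Proof. by move=> sf; have [df _] := sf 1%N; exact: diff_derivable. Qed.

Lemma csmooth_derive f v : csmooth f -> csmooth (fun x => 'D_v f x).
Proof.
by move=> [sf cf]; split; [exact: smooth_derive|exact: derive_compact_supp].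
Qed.

Lemma csmooth_Intg f : csmooth f -> Intg f.
Proof. by move=> [sf cf]; apply: Intg_compact => //; exact: smooth_continuous. Qed.

Lemma Meas_cos_phase z (th : R) : Meas (fun y => cos (dot z y + th)).
Proof.
apply: continuous_meas; apply: (continuous_compose _ (@continuous_cos R)) => x.
by apply: (cvgD (continuous_dot (x := x))); exact: cvg_cst.
Qed.

Lemma Intg_mulcos_phase f z (th : R) : Intg f ->
  Intg (fun y => f y * cos (dot z y + th)).
Proof.
move=> If; apply: (Intg_mulb If (C := 1)) => [|x]; last exact: norm_cos_le1.
exact: Meas_cos_phase.
Qed.

Lemma Intg_mulsin_phase f z (th : R) : Intg f ->
  Intg (fun y => f y * sin (dot z y + th)).
Proof.
move=> If; have := Intg_mulcos_phase z (th - pi / 2) If; congr Intg.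
by apply/funext => x; rewrite addrA cosBpihalf.
Qed.

Lemma cos_dist (a b : R) : `|cos a - cos b| <= `|a - b|.
Proof.
wlog ab : a b / b <= a.
  move=> H; have [/H//|/ltW/H] := leP b a.
  by rewrite distrC (distrC a).
have [|c _ ->] := @MVT_segment R cos (fun c : R => - sin c) b a ab.
  by apply: continuous_subspaceT; exact: continuous_cos.
by rewrite normrM normrN ler_piMl// norm_sin_le1.
Qed.

(** Difference quotients along v are moved from f to the cosine by the translation
invariance of the integral, then both sides pass to the limit by dominated
convergence. The phase th makes the statement apply to sines as well, so that
it can be iterated. *)
Lemma Int_by_parts f v z (th : R) : csmooth f ->
  Int (fun y => 'D_v f y * cos (dot z y + th)) =
  dot z v * Int (fun y => f y * sin (dot z y + th)).
Proof.
move=> sf; have [smf cf] := sf.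
have If := csmooth_Intg sf.
have sD := csmooth_derive v sf.
have [C C0 dC] := compact_supp_bounded (smooth_continuous sD.1) sD.2.
pose e k : R := k.+1%:R^-1.
have e0 k : 0 < e k by rewrite invr_gt0.
have en0 k : e k != 0 by rewrite gt_eqF.
have e1 k : e k <= 1 by rewrite invf_le1// ler1n.
have ce : e k @[k --> \oo] --> 0 by exact: cvg_harmonic.
have ce' : e k @[k --> \oo] --> (0 : R)^'.
  move=> A hA; apply: (@filterS _ \oo _ (fun k => e k != 0 -> A (e k))) => [k h|].
    exact: (h (en0 k)).
  exact: (ce _ hA).
pose Q k y := (e k)^-1 * (f (y + e k *: v) - f y).
have cQ y : Q k y @[k --> \oo] --> 'D_v f y.
  have := cvg_comp _ _ ce' (@smooth_derivable f v y smf).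
  apply: cvg_trans; apply: near_eq_cvg; apply: nearW => k /=.
  by rewrite /Q /GRing.scale/= (addrC (e k *: v)).
have QC k y : `|Q k y| <= C.
  rewrite normrM gtr0_norm ?invr_gt0// mulrC ler_pdivrMr//.
  by apply: line_lipschitz => //; [move=> x; exact: smooth_derivable|exact: ltW].
have [r fr] := cf.
pose r' := `|r| + `|v|.
have Q0 k y : r' <= `|y| -> Q k y = 0.
  move=> ry; rewrite /Q !fr ?subrr ?mulr0//.
    by rewrite (le_trans _ ry)// (le_trans (ler_norm _))// lerDl.
  have := ler_normB (y + e k *: v) (e k *: v); rewrite addrK => H.
  have H2 : `|e k *: v| <= `|v| by rewrite normrZ gtr0_norm// ler_piMl.
  have := ler_norm r; move: ry H H2; rewrite /r'; lra.
have If1 k : Intg (fun y => f (y + e k *: v)).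
  have := Intg_affine (e k *: v) (oner_neq0 R) If; congr Intg; apply/funext => y.
  by rewrite scale1r addrC.
have IQ k : Intg (Q k) by apply: IntgZ; exact: IntgB.
have mtrig : Meas (fun y => cos (dot z y + th)).
  exact: Meas_cos_phase.
have r'0 : 0 <= r' by rewrite addr_ge0.
have QD k y : `|Q k y * cos (dot z y + th)| <=
    C * expR (n%:R * r' ^+ 2) * expR (- (1 ^+ 2 * dot y y)).
  apply: (le_trans _ (compact_dom r'0 C0 (QC k) (Q0 k) y)).
  by rewrite normrM ler_piMr// norm_cos_le1.
have [_ cL] := @Int_dominated R n (fun k y => Q k y * cos (dot z y + th))
    (fun y => 'D_v f y * cos (dot z y + th)) _
    (fun k => measurable_funM (Intg_meas (IQ k)) mtrig)
    (fun y => cvgM (cQ y) (cvg_cst _)) (Intg_gauss1 (C * expR (n%:R * r' ^+ 2)))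
    QD.
pose P k y := (e k)^-1 * (cos (dot z y + th - e k * dot z v) - cos (dot z y + th)).
have LE k : Int (fun y => Q k y * cos (dot z y + th)) = Int (fun y => f y * P k y).
  have Ia : Intg (fun y => f y * cos (dot z y + (th - e k * dot z v))).
    exact: Intg_mulcos_phase.
  have Ib : Intg (fun y => f y * cos (dot z y + th)) by exact: Intg_mulcos_phase.
  have Ia' : Intg (fun y => f (y + e k *: v) * cos (dot z y + th)).
    exact: Intg_mulcos_phase.
  have Eshift : Int (fun y => f (y + e k *: v) * cos (dot z y + th)) =
     Int (fun y => f y * cos (dot z y + (th - e k * dot z v))).
    have := Int_affine (e k *: v) (oner_neq0 R) Ia.
    rewrite normr1 expr1n invr1 mul1r => <-; congr Int; apply/funext => y.
    rewrite scale1r (addrC (e k *: v)); congr (_ * cos _).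
    by rewrite dotDr dotZr; ring.
  transitivity ((e k)^-1 * (Int (fun y => f (y + e k *: v) * cos (dot z y + th)) -
     Int (fun y => f y * cos (dot z y + th)))).
    rewrite -(IntB Ia' Ib) -(IntZ _ (IntgB Ia' Ib)); congr Int.
    by apply/funext => y; rewrite /Q; ring.
  rewrite Eshift -(IntB Ia Ib) -(IntZ _ (IntgB Ia Ib)); congr Int.
  by apply/funext => y; rewrite /P addrA; ring.
have PC k y : `|P k y| <= `|dot z v|.
  rewrite normrM gtr0_norm ?invr_gt0// mulrC ler_pdivrMr//.
  apply: (le_trans (cos_dist _ _)).
  by rewrite addrAC subrr add0r normrN normrM gtr0_norm// mulrC.
have cP y : P k y @[k --> \oo] --> dot z v * sin (dot z y + th).
  have d : is_derive (0:R) 1 (fun h => cos (dot z y + th - h * dot z v))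
      (dot z v * sin (dot z y + th)).
    have d1 : is_derive (0:R) 1 (fun h : R => - dot z v * h) (- dot z v).
      exact: is_derive_mulr.
    have d2 : is_derive (0:R) 1 (fun h : R => dot z y + th + - dot z v * h) (0 + - dot z v).
      exact: (is_derive_ext (is_deriveD (is_derive_cst (dot z y + th) _ _) d1)).
    apply: (is_derive_ext (is_derive1_comp (is_derive_cos _) d2)).
      by move=> h; congr cos; ring.
    by rewrite mulr0 addr0; ring.
  have [d1 d2] := d.
  have := cvg_comp _ _ ce' d1; rewrite -/(derive _ _ _) d2.
  apply: cvg_trans; apply: near_eq_cvg; apply: nearW => k /=.
  by rewrite /P /GRing.scale/= mulr1 addr0 mul0r subr0.
have mP k : Meas (fun y => f y * P k y).
  have I1 : Intg (fun y => f y * cos (dot z y + (th - e k * dot z v))).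
    exact: Intg_mulcos_phase.
  have I2 : Intg (fun y => f y * cos (dot z y + th)) by exact: Intg_mulcos_phase.
  have := Intg_meas (IntgZ (e k)^-1 (IntgB I1 I2)); congr Meas.
  by apply/funext => y; rewrite /P addrA; ring.
have PD k y : `|f y * P k y| <= `|dot z v| * `|f y|.
  by rewrite normrM mulrC ler_wpM2r.
have [_ cR] := @Int_dominated R n (fun k y => f y * P k y)
    (fun y => f y * (dot z v * sin (dot z y + th))) (fun y => `|dot z v| * `|f y|)
    mP (fun y => cvgM (cvg_cst _) (cP y)) (IntgZ _ (Intg_norm If))
    PD.
rewrite (_ : (fun k => Int _) = (fun k => Int (fun y => f y * P k y))) in cL; last first.
  by apply/funext => k; exact: LE.
rewrite (cvg_unique _ cL cR)// -(IntZ _ (Intg_mulsin_phase z th If)).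
by congr Int; apply/funext => y; ring.
Qed.

End Decay.

Section GoodCutoff.
Context {R : realType} {n : nat}.
Implicit Types (f g phi : 'rV[R]_n -> R) (z x : 'rV[R]_n).

Lemma Int_second_derivative f i z : csmooth f ->
  Int (fun y => 'D_(delta_mx 0 i) (fun x => 'D_(delta_mx 0 i) f x) y * cos (dot z y)) =
  - z 0 i ^+ 2 * Int (fun y => f y * cos (dot z y)).
Proof.
move=> sf.
have dzi : dot z (delta_mx 0 i) = z 0 i.
  rewrite /dot (bigD1 i)//= big1 ?addr0 ?mxE ?eqxx ?mulr1//.
  by move=> j ji; rewrite mxE eqxx (negbTE ji) mulr0.
have E1 := Int_by_parts (delta_mx 0 i) z 0 (csmooth_derive (delta_mx 0 i) sf).
have E2 := Int_by_parts (delta_mx 0 i) z (- (pi / 2)) sf.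
rewrite dzi in E1 E2.
transitivity (z 0 i * Int (fun y => 'D_(delta_mx 0 i) f y * sin (dot z y + 0))).
  rewrite -E1; congr Int; apply/funext => y; by rewrite addr0.
have -> : (fun y => 'D_(delta_mx 0 i) f y * sin (dot z y + 0)) =
    (fun y => 'D_(delta_mx 0 i) f y * cos (dot z y - pi / 2)).
  by apply/funext => y; rewrite addr0 cosBpihalf.
rewrite E2.
have -> : (fun y => f y * sin (dot z y - pi / 2)) = (fun y => -1 * (f y * cos (dot z y))).
  by apply/funext => y; rewrite sinBpihalf; ring.
rewrite (IntZ (-1) (Intg_mulcos z (csmooth_Intg sf))); ring.
Qed.

(** Each coordinate contributes two derivatives, hence a factor 1 + z_i^2; a product
of such factors over all coordinates has an integrable inverse. *)
Lemma fourier_decay (l : seq 'I_n) f : csmooth f ->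
  exists C : R, forall z,
    (\prod_(i <- l) (1 + z 0 i ^+ 2)) * `|Int (fun y => f y * cos (dot z y))| <= C.
Proof.
elim: l f => [|i l IH] f sf.
  have If := csmooth_Intg sf.
  exists (Int (fun y => `|f y|)) => z; rewrite big_nil mul1r.
  apply: (le_trans (le_norm_Int (Intg_mulcos z If))).
  apply: le_Int; [exact/Intg_norm/Intg_mulcos|exact: Intg_norm|move=> y].
  by rewrite normrM ler_piMr// norm_cos_le1.
have [C1 H1] := IH f sf.
have [C2 H2] := IH _ (csmooth_derive (delta_mx 0 i) (csmooth_derive (delta_mx 0 i) sf)).
exists (C1 + C2) => z.
apply: le_trans (lerD (H1 z) (H2 z)).
rewrite Int_second_derivative// big_cons normrM normrN (ger0_norm (sqr_ge0 _)).
by rewrite le_eqVlt; apply/orP; left; apply/eqP; ring.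
Qed.

Lemma IR_cauchy : (leb R).-integrable setT (EFin \o (fun x : R => (1 + x ^+ 2)^-1)).
Proof.
have p0 (x : R) : 0 < 1 + x ^+ 2 by rewrite ltr_pwDl// sqr_ge0.
have cv : continuous (fun x : R => (1 + x ^+ 2)^-1).
  move=> x; apply: cvgV; first by rewrite gt_eqF.
  by apply: cvgD; [exact: cvg_cst|apply: cvgM; exact: cvg_id].
apply/integrableP; split.
  by apply/measurable_EFinP; exact: continuous_measurable_fun.
have -> : (\int[leb R]_x `|(EFin \o (fun x : R => (1 + x ^+ 2)^-1)%R) x| =
   \int[leb R]_x ((1 + x ^+ 2)^-1)%R%:E)%E.
  by apply: eq_integral => x _ /=; rewrite ger0_norm// invr_ge0 ltW.
rewrite ge0_symfun_integralT//; last 2 first.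
- by move=> x; rewrite invr_ge0 ltW.
- by move=> x /=; rewrite sqrrN.
rewrite (_ : [set x | _] = `[0, +oo[%classic); last first.
  by apply/seteqP; split => x/=; rewrite in_itv/= andbT.
have := @integral0y_oneDsqr R; rewrite /oneDsqr => ->.
by rewrite -EFinM ltry.
Qed.

Lemma Intg_prod_cauchy : Intg (fun z : 'rV[R]_n => \prod_(i < n) (1 + z 0 i ^+ 2)^-1).
Proof.
pose F (i : 'I_n) (y : R) : R[i] := real_complex R (1 + y ^+ 2)^-1.
have HF i : cintegrable1 (F i).
  split; first exact: IR_cauchy.
  exact: integrable0.
have [I1 _ _] := cInt_prod HF.
move: I1; congr Intg; apply/funext => z.
by rewrite -(rmorph_prod (real_complex R)).
Qed.

Lemma good_csmooth f : csmooth f -> even_fun f -> good_symbol f.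
Proof.
move=> sf ef; have [smf cf] := sf.
have cof := smooth_continuous smf.
have If := csmooth_Intg sf.
split => //.
  by have [C _ fC] := compact_supp_bounded cof cf; exists C.
have [C HC] := fourier_decay (index_enum 'I_n) sf.
pose c : R := (2 * pi) ^- n.
have c0 : 0 <= c by rewrite invr_ge0 exprn_ge0// mulr_ge0// pi_ge0.
apply: (Intg_le (Meas_ft If) _ (IntgZ (c * C) Intg_prod_cauchy)) => z.
have p0 : 0 < \prod_(i < n) (1 + z 0 i ^+ 2).
  by apply: prodr_gt0 => i _; rewrite ltr_pwDl// sqr_ge0.
rewrite /ft normrM (ger0_norm c0) -mulrA ler_wpM2l//.
by rewrite prodfV ler_pdivlMr// mulrC.
Qed.

Lemma norm_le_enorm x : `|x| <= enorm x.
Proof.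
apply: ler_rV_norm => [|i]; first exact: sqrtr_ge0.
rewrite -sqrtr_sqr ler_wsqrtr// /dot (bigD1 i)//= -expr2 lerDl.
by apply: sumr_ge0 => j _; rewrite -expr2 sqr_ge0.
Qed.

Lemma enormN x : enorm (- x) = enorm x.
Proof. by rewrite /enorm dotNl dotNr opprK. Qed.

Lemma good_cutoff phi : lp_cutoff phi -> good_symbol phi.
Proof.
move=> [sm rad _ _ z2]; apply: good_csmooth; last first.
  by move=> x; apply: rad; rewrite enormN.
split => //; exists 2 => x x2; apply: z2.
exact: (le_trans x2 (norm_le_enorm x)).
Qed.

Lemma good_lp_symbol phi j : lp_cutoff phi -> good_symbol (lp_symbol phi j).
Proof.
move=> /good_cutoff gp; case: j => [//|j] /=.
have p0 k : 0 < (2 : R) ^- k by rewrite invr_gt0 exprn_gt0.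
by apply: good_sub; exact: good_scale.
Qed.

End GoodCutoff.

(** * Fourier coefficients on the torus *)

Section TorusCoef.
Context {R : realType} {n : nat}.
Implicit Types (m f g : 'rV[R]_n -> R) (k x w : 'rV[R]_n).
Local Open Scope complex_scope.

Definition cell_ind x : R := \prod_(i < n) \1_(`[0, 2 * pi]%classic : set R) (x 0 i).

Lemma cell_indE (t : Rn R n) : cell_ind (rVtuple t) = \1_(cell Torus) t.
Proof.
rewrite /cell_ind; have [ct|ct] := pselect (cell Torus t).
  rewrite big1 ?indicE ?mem_set// => i _; rewrite indicE mem_set//.
  by rewrite /= in_itv/= mxE; exact: ct.
rewrite [RHS]indicE memNset//.
have [i hi] : exists i, ~ (0 <= tnth t i <= 2 * pi) by apply/existsNP.
rewrite (bigD1 i)//= indicE memNset ?mul0r//= in_itv/= mxE.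
exact: hi.
Qed.

Lemma measurable_cell : measurable (cell Torus : set (Rn R n)).
Proof.
have -> : (cell Torus : set (Rn R n)) = \bigcap_(i in [set: 'I_n])
    ((@tnth _ _ ^~ i) @^-1` (`[0, 2 * pi]%classic : set (measurableTypeR R))).
  apply/seteqP; split => t /= h i; first by move=> _ /=; rewrite in_itv/=; exact: h.
  by have := h i I; rewrite /= in_itv.
apply: fin_bigcap_measurable => // i _.
rewrite -[X in measurable X]setTI; apply: measurable_tnth => //.
Qed.

Lemma cis_nat (a : nat) : cis (2 * pi * a%:R) = 1 :> R[i].
Proof.
elim: a => [|a IH]; first by rewrite mulr0 cis0.
rewrite -[a.+1%:R]natr1 mulrDr cisD IH mul1r mulr1 /cis.
have -> : (2 * pi : R) = pi + pi by ring.
by rewrite cosDpi sinDpi cospi sinpi oppr0 opprK.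
Qed.

Lemma cis_int (a b : nat) : cis (2 * pi * (a%:R - b%:R)) = 1 :> R[i].
Proof.
have := cis_nat a; rewrite -[in cis (_ * a%:R)](subrK b%:R a%:R) mulrDr cisD cis_nat.
by rewrite mulr1.
Qed.

Lemma itv_lt : 0 < 2 * pi :> R. Proof. by rewrite mulr_gt0// pi_gt0. Qed.

Lemma Rint_restrict (h : R -> R) :
  \int[leb R]_x (\1_(`[0, 2 * pi]%classic : set R) x * h x) =
  \int[leb R]_(x in `[0, 2 * pi]) h x.
Proof.
rewrite [RHS]Rintegral_mkcond; apply: eq_Rintegral => x _.
rewrite patchE indicE; case: ifPn => hx; first by rewrite mul1r.
by rewrite mul0r.
Qed.

Lemma Rint_cos0 (a b : nat) : (a%:R - b%:R : R) != 0 ->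
  \int[leb R]_(x in `[0, 2 * pi]) cos ((a%:R - b%:R) * x) = 0.
Proof.
set j : R := a%:R - b%:R => j0.
have dF (x : R) : is_derive x 1 (fun x : R => j^-1 * sin (j * x)) (cos (j * x)).
  apply: (is_derive_ext (is_deriveZ j^-1 (is_derive_sinM j x))) => [//|].
  by rewrite /GRing.scale/= mulKf.
rewrite /Rintegral (@continuous_FTC2 _ _ (fun x : R => j^-1 * sin (j * x)) _ _ itv_lt).
- have := cis_int a b; rewrite /cis -/j => /(congr1 (@complex.Im R)) /= s0.
  by rewrite (mulrC j) s0 !mulr0 sin0 mulr0 subr0.
- by apply: continuous_subspaceT; exact: continuous_cosM.
- have cF (x : R) : {for x, continuous (fun x : R => j^-1 * sin (j * x))}.
    apply: differentiable_continuous; apply/derivable1_diffP.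
    exact: (@ex_derive _ _ _ _ _ _ _ (dF x)).
  split.
  + by move=> x _; exact: (@ex_derive _ _ _ _ _ _ _ (dF x)).
  + by apply: cvg_at_right_filter; exact: cF.
  + by apply: cvg_at_left_filter; exact: cF.
- by move=> x _; rewrite derive1E; exact: (@derive_val _ _ _ _ _ _ _ (dF x)).
Qed.

Lemma Rint_sin0 (a b : nat) :
  \int[leb R]_(x in `[0, 2 * pi]) sin ((a%:R - b%:R) * x) = 0.
Proof.
set j : R := a%:R - b%:R.
have [->|j0] := eqVneq j 0.
  transitivity (\int[leb R]_(x in `[0, 2 * pi]) (0:R)).
    by apply: eq_Rintegral => x _; rewrite mul0r sin0.
  by rewrite /Rintegral integral0.
have dF (x : R) : is_derive x 1 (fun x : R => - j^-1 * cos (j * x)) (sin (j * x)).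
  apply: (is_derive_ext (is_deriveZ (- j^-1) (is_derive_cosM j x))) => [//|].
  by rewrite /GRing.scale/= mulrA mulrNN mulVf ?mul1r.
rewrite /Rintegral (@continuous_FTC2 _ _ (fun x : R => - j^-1 * cos (j * x)) _ _ itv_lt).
- have := cis_int a b; rewrite /cis -/j => /(congr1 (@complex.Re R)) /= s0.
  by rewrite (mulrC j) s0 mulr0 cos0 subrr.
- by apply: continuous_subspaceT; exact: continuous_sinM.
- have cF (x : R) : {for x, continuous (fun x : R => - j^-1 * cos (j * x))}.
    apply: differentiable_continuous; apply/derivable1_diffP.
    exact: (@ex_derive _ _ _ _ _ _ _ (dF x)).
  split.
  + by move=> x _; exact: (@ex_derive _ _ _ _ _ _ _ (dF x)).
  + by apply: cvg_at_right_filter; exact: cF.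
  + by apply: cvg_at_left_filter; exact: cF.
- by move=> x _; rewrite derive1E; exact: (@derive_val _ _ _ _ _ _ _ (dF x)).
Qed.

Lemma Rint_one : \int[leb R]_(x in `[0, 2 * pi]) (1 : R) = 2 * pi.
Proof.
rewrite Rintegral_cst//= lebesgue_measure_itv/= lte_fin itv_lt.
by rewrite sube0 mul1r.
Qed.

(** Integers are written as differences of naturals, which is the form of the
coordinates of [box_point]. *)
Definition intvec w := exists a b : 'I_n -> nat, forall i, w 0 i = (a i)%:R - (b i)%:R.

Lemma IR_ind (h : R -> R) : continuous h -> (forall x : R, `|h x| <= 1) ->
  (leb R).-integrable setT (EFin \o (fun x : R => \1_(`[0, 2 * pi]%classic : set R) x * h x)).
Proof.
move=> ch h1.
have i1 : (leb R).-integrable setT (EFin \o (\1_(`[0, 2 * pi]%classic : set R))).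
  exact: integrable_indic_itv.
apply: (@IR_le _ _ (\1_(`[0, 2 * pi]%classic : set R))) => //.
  apply: measurable_funM; last exact: continuous_measurable_fun.
  by apply: measurable_indic; exact: measurable_itv.
move=> x; rewrite normrM ger0_norm ?indicE//; case: (_ \in _); rewrite ?mul1r ?mul0r//.
Qed.

(** Orthogonality of characters: over the cell the integral of a character factors
into integrals over a period. *)
Lemma cell_cis w : intvec w ->
  [/\ Intg (fun x => cell_ind x * cos (dot w x)),
      Int (fun x => cell_ind x * cos (dot w x)) = (if w == 0 then (2 * pi) ^+ n else 0) &
      Int (fun x => cell_ind x * sin (dot w x)) = 0].
Proof.
move=> [a [b wE]].
pose J := (`[0, 2 * pi]%classic : set R).
pose F (i : 'I_n) (y : R) : R[i] := real_complex R (\1_J y) * cis (w 0 i * y).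
have FRe i : (fun y => complex.Re (F i y)) = (fun y => \1_J y * cos (w 0 i * y)).
  by apply/funext => y; rewrite /F cReM /= mul0r subr0.
have FIm i : (fun y => complex.Im (F i y)) = (fun y => \1_J y * sin (w 0 i * y)).
  by apply/funext => y; rewrite /F cImM /= mul0r addr0.
have HF i : cintegrable1 (F i).
  split; rewrite ?FRe ?FIm; apply: IR_ind.
  - exact: continuous_cosM.
  - by move=> y; exact: norm_cos_le1.
  - exact: continuous_sinM.
  - by move=> y; exact: norm_sin_le1.
have FE i : cintegral1 (F i) = real_complex R (if w 0 i == 0 then 2 * pi else 0).
  rewrite /cintegral1 FRe FIm !Rint_restrict wE Rint_sin0.
  case: eqVneq => w0; last by rewrite Rint_cos0.
  rewrite w0 -[RHS]/((2 * pi) +i* 0); congr (_ +i* _).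
  transitivity (\int[leb R]_(y in `[0, 2 * pi]) (1 : R)); last exact: Rint_one.
  by apply: eq_Rintegral => y _; rewrite mul0r cos0.
pose G (x : 'rV[R]_n) := \prod_(i < n) F i (x 0 i).
have [IRe IIm EG] : [/\ Intg (fun x => complex.Re (G x)),
    Intg (fun x => complex.Im (G x)) &
    cInt G = \prod_(i < n) cintegral1 (F i)] by exact: cInt_prod.
have GE : G = (fun x => real_complex R (cell_ind x) * cis (dot w x)).
  apply/funext => x; rewrite /G big_split /= /dot cis_sum; congr (_ * _).
  by rewrite -rmorph_prod.
have GRe : (fun x => complex.Re (G x)) = (fun x => cell_ind x * cos (dot w x)).
  by apply/funext => x; rewrite GE cReM /= mul0r subr0.
have GIm : (fun x => complex.Im (G x)) = (fun x => cell_ind x * sin (dot w x)).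
  by apply/funext => x; rewrite GE cImM /= mul0r addr0.
have prodE : \prod_(i < n) cintegral1 (F i) =
   real_complex R (if w == 0 then (2 * pi) ^+ n else 0).
  rewrite (eq_bigr (fun i => real_complex R (if w 0 i == 0 then 2 * pi else 0))); last first.
    by move=> i _; rewrite FE.
  rewrite -rmorph_prod; congr (real_complex R _).
  case: eqVneq => [->|w0].
    under eq_bigr do rewrite mxE eqxx.
    by rewrite prodr_const card_ord.
  have [i wi] : exists i, w 0 i != 0.
    apply/existsP; apply: contra_neqT w0; rewrite negb_exists => /forallP h.
    by apply/rowP => i; rewrite mxE; apply/eqP; have := h i; rewrite negbK.
  by rewrite (bigD1 i)//= (negbTE wi) mul0r.
rewrite prodE /cInt GRe GIm in EG.
rewrite GRe in IRe; split; [exact: IRe|by move: EG => /(congr1 (@complex.Re R))|by move: EG => /(congr1 (@complex.Im R))].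
Qed.

Lemma Intg_cell_ind : Intg cell_ind.
Proof.
have w0 : intvec (0 : 'rV[R]_n).
  by exists (fun=> 0%N), (fun=> 0%N) => i; rewrite mxE subrr.
have [H _ _] := cell_cis w0; move: H; congr Intg; apply/funext => x.
by rewrite dot0l cos0 mulr1.
Qed.

Lemma Int_cell_ind : Int cell_ind = (2 * pi) ^+ n.
Proof.
have w0 : intvec (0 : 'rV[R]_n).
  by exists (fun=> 0%N), (fun=> 0%N) => i; rewrite mxE subrr.
have [_ H _] := cell_cis w0; move: H; rewrite eqxx => <-; congr Int.
by apply/funext => x; rewrite dot0l cos0 mulr1.
Qed.

Definition coefc f k : R := (2 * pi) ^- n * Int (fun y => cell_ind y * (f y * cos (dot k y))).
Definition coefs f k : R := (2 * pi) ^- n * Int (fun y => cell_ind y * (f y * sin (dot k y))).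

Lemma Rintegral_cell f : Rintegral (lebn R n) (cell Torus) (fun t => f (rVtuple t)) =
  Int (fun y => cell_ind y * f y).
Proof.
rewrite Rintegral_mkcond; apply: eq_Rintegral => t _.
rewrite cell_indE patchE indicE; case: ifPn => hx; first by rewrite mul1r.
by rewrite mul0r.
Qed.

Lemma fourier_coefE f k :
  fourier_coef f k = coefc f k +i* coefs f (- k).
Proof.
rewrite /fourier_coef /cintegral.
have -> : Rintegral (lebn R n) (cell Torus) (fun t =>
    complex.Re ((f (rVtuple t))%:C * cis (- dot k (rVtuple t)))) =
  Int (fun y => cell_ind y * (f y * cos (dot k y))).
  rewrite -Rintegral_cell; apply: eq_Rintegral => t _.
  by rewrite cReM /= mul0r subr0 cosN.
have -> : Rintegral (lebn R n) (cell Torus) (fun t =>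
    complex.Im ((f (rVtuple t))%:C * cis (- dot k (rVtuple t)))) =
  Int (fun y => cell_ind y * (f y * sin (dot (- k) y))).
  rewrite -Rintegral_cell; apply: eq_Rintegral => t _.
  by rewrite cImM /= mul0r addr0 dotNl.
by apply/eqP; rewrite eq_complex /= /coefc /coefs; apply/andP; split;
  rewrite mul0r ?subr0 ?addr0.
Qed.

Lemma Intg_cell_cos f k : tame Torus f -> Intg (fun y => cell_ind y * (f y * cos (dot k y))).
Proof.
move=> [_ cf [B fB]]; apply: (Intg_mulb (C := B) Intg_cell_ind).
  by apply: measurable_funM; [exact: continuous_meas|exact: Meas_cos_dot].
move=> x; rewrite normrM; apply: le_trans (fB x).
by rewrite ler_piMr// norm_cos_le1.
Qed.

Lemma Intg_cell_sin f k : tame Torus f -> Intg (fun y => cell_ind y * (f y * sin (dot k y))).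
Proof.
move=> [_ cf [B fB]]; apply: (Intg_mulb (C := B) Intg_cell_ind).
  by apply: measurable_funM; [exact: continuous_meas|exact: Meas_sin_dot].
move=> x; rewrite normrM; apply: le_trans (fB x).
by rewrite ler_piMr// norm_sin_le1.
Qed.

Lemma pi2n_neq0 : (2 * pi) ^+ n != 0 :> R.
Proof. by rewrite expf_neq0// gt_eqF// itv_lt. Qed.

Lemma cell_ind_ge0 x : 0 <= cell_ind x.
Proof. by apply: prodr_ge0 => i _; rewrite indicE. Qed.

Lemma coef_bound h (B : R) : Intg (fun y => cell_ind y * h y) -> (forall y, `|h y| <= B) ->
  `|(2 * pi) ^- n * Int (fun y => cell_ind y * h y)| <= B.
Proof.
move=> Ih hB; have p0 : 0 < (2 * pi : R) ^+ n by rewrite exprn_gt0// itv_lt.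
rewrite normrM gtr0_norm ?invr_gt0// mulrC ler_pdivrMr//.
apply: (le_trans (le_norm_Int Ih)).
rewrite -Int_cell_ind -(IntZ B Intg_cell_ind).
apply: le_Int; [exact: Intg_norm|exact/IntgZ/Intg_cell_ind|move=> y].
by rewrite normrM (ger0_norm (cell_ind_ge0 y)) mulrC ler_wpM2r ?cell_ind_ge0.
Qed.

Lemma coefc_bound f k (B : R) : tame Torus f -> (forall y, `|f y| <= B) -> `|coefc f k| <= B.
Proof.
move=> tf fB; apply: coef_bound; first exact: Intg_cell_cos.
by move=> y; rewrite normrM; apply: le_trans (fB y); rewrite ler_piMr// norm_cos_le1.
Qed.

Lemma coefs_bound f k (B : R) : tame Torus f -> (forall y, `|f y| <= B) -> `|coefs f k| <= B.
Proof.
move=> tf fB; apply: coef_bound; first exact: Intg_cell_sin.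
by move=> y; rewrite normrM; apply: le_trans (fB y); rewrite ler_piMr// norm_sin_le1.
Qed.

Lemma coefc_lin (a : R) f g k : tame Torus f -> tame Torus g ->
  coefc (fun y => a * f y + g y) k = a * coefc f k + coefc g k.
Proof.
move=> tf tg; have If := Intg_cell_cos k tf; have Ig := Intg_cell_cos k tg.
rewrite /coefc mulrCA -mulrDr; congr (_ * _).
rewrite -(IntZ a If) -(IntD (IntgZ a If) Ig); congr Int.
by apply/funext => y; ring.
Qed.

Lemma coefs_lin (a : R) f g k : tame Torus f -> tame Torus g ->
  coefs (fun y => a * f y + g y) k = a * coefs f k + coefs g k.
Proof.
move=> tf tg; have If := Intg_cell_sin k tf; have Ig := Intg_cell_sin k tg.
rewrite /coefs mulrCA -mulrDr; congr (_ * _).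
rewrite -(IntZ a If) -(IntD (IntgZ a If) Ig); congr Int.
by apply/funext => y; ring.
Qed.

Lemma intvecB w w' : intvec w -> intvec w' -> intvec (w - w').
Proof.
move=> [a [b wE]] [c [d w'E]].
exists (fun i => a i + d i)%N, (fun i => b i + c i)%N => i.
by rewrite !mxE wE w'E !natrD; ring.
Qed.

Lemma intvecD w w' : intvec w -> intvec w' -> intvec (w + w').
Proof.
move=> [a [b wE]] [c [d w'E]].
exists (fun i => a i + c i)%N, (fun i => b i + d i)%N => i.
by rewrite !mxE wE w'E !natrD; ring.
Qed.

(** The product of two cosines is half a sum of two cosines, and each of these has
mean zero unless its frequency vanishes. *)
Lemma fourier_coef_cos w k : intvec w -> intvec k ->
  fourier_coef (fun y => cos (dot w y)) k =
  real_complex R (2^-1 * ((k == w)%:R + (k == - w)%:R)).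
Proof.
move=> iw ik; have [c1 c2 c3] := cell_cis (intvecB iw ik).
have [d1 d2 d3] := cell_cis (intvecD iw ik).
have isin w' : intvec w' -> Intg (fun x => cell_ind x * sin (dot w' x)).
  move=> _; apply: (Intg_mulb (C := 1) Intg_cell_ind); first exact: Meas_sin_dot.
  by move=> x; exact: norm_sin_le1.
have s1 := isin _ (intvecB iw ik); have s2 := isin _ (intvecD iw ik).
rewrite fourier_coefE.
have -> : coefc (fun y => cos (dot w y)) k = 2^-1 * ((k == w)%:R + (k == - w)%:R).
  rewrite /coefc.
  have -> : (fun y => cell_ind y * (cos (dot w y) * cos (dot k y))) =
     (fun y => 2^-1 * (cell_ind y * cos (dot (w - k) y) + cell_ind y * cos (dot (w + k) y))).
    by apply/funext => y; rewrite cosMcos dotDl dotDl dotNl; ring.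
  rewrite (IntZ _ (IntgD c1 d1)) (IntD c1 d1) c2 d2 subr_eq0 addr_eq0.
  rewrite mulrCA; congr (_ * _).
  rewrite (eq_sym w k) -(eqr_oppLR w k) (eq_sym (- w) k).
  rewrite mulrDr; congr (_ + _); case: (_ == _); by rewrite ?mulr0 ?mulVf ?pi2n_neq0.
have -> : coefs (fun y => cos (dot w y)) (- k) = 0.
  rewrite /coefs.
  have -> : (fun y => cell_ind y * (cos (dot w y) * sin (dot (- k) y))) =
     (fun y => 2^-1 * (cell_ind y * sin (dot (w - k) y) - cell_ind y * sin (dot (w + k) y))).
    by apply/funext => y; rewrite !dotDl dotNl sinB sinD sinN; field.
  by rewrite (IntZ _ (IntgB s1 s2)) (IntB s1 s2) c3 d3 subr0 !mulr0.
by [].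
Qed.

End TorusCoef.

Section BoxSum.
Context {R : realType} {n : nat}.
Implicit Types (F U H : 'rV[R]_n -> R) (k x w p : 'rV[R]_n).

Definition boxsum (N : nat) F : R :=
  \sum_(c : {ffun 'I_n -> 'I_(N.*2.+1)}) F (box_point c).

Lemma box_point_inj N : injective (@box_point R n N).
Proof.
move=> c c' /rowP h; apply/ffunP => i; apply/val_inj/eqP.
by have := h i; rewrite !mxE => /addIr/eqP; rewrite eqr_nat.
Qed.

Lemma box_point_intvec N (c : {ffun 'I_n -> 'I_(N.*2.+1)}) : intvec (@box_point R n N c).
Proof. by exists (fun i => c i : nat), (fun=> N) => i; rewrite mxE. Qed.

Lemma box_shift_lt N (i : 'I_(N.*2.+1)) : (i.+1 < N.+1.*2.+1)%N.
Proof. by rewrite doubleS !ltnS ltnW// ltnS -ltnS. Qed.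

(** The inclusion of the cube of radius N into that of radius N + 1, in terms of the
indices of [box_point]. *)
Definition box_shift N (c : {ffun 'I_n -> 'I_(N.*2.+1)}) : {ffun 'I_n -> 'I_(N.+1.*2.+1)} :=
  [ffun i => Ordinal (box_shift_lt (c i))].

Lemma box_shiftE N (c : {ffun 'I_n -> 'I_(N.*2.+1)}) :
  box_point (box_shift c) = box_point c :> 'rV[R]_n.
Proof.
apply/rowP => i; rewrite !mxE ffunE /= -[in LHS](addn1 (c i)) -[in LHS](addn1 N) !natrD.
by ring.
Qed.

Lemma boxsumS N F : boxsum N.+1 F = boxsum N F +
  \sum_(c | c \notin [set box_shift c | c : {ffun 'I_n -> 'I_(N.*2.+1)}]) F (box_point c).
Proof.
rewrite /boxsum (bigID (mem [set box_shift c | c : {ffun 'I_n -> 'I_(N.*2.+1)}]))/=.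
congr (_ + _); rewrite big_imset/=; last first.
  move=> c c' _ _ /(congr1 (@box_point R n _)); rewrite !box_shiftE.
  exact: box_point_inj.
by apply: eq_big => [c|c _]; rewrite ?inE ?box_shiftE.
Qed.

(** Normal convergence of a multiple series summed over growing cubes: the sums of H
and of U + H are nondecreasing, because their terms are nonnegative, and bounded. *)
Lemma boxsum_cvg U H (M : R) : (forall p, `|U p| <= H p) -> (forall N, boxsum N H <= M) ->
  cvgn (fun N => boxsum N U) /\ `|limn (fun N => boxsum N U)| <= M.
Proof.
move=> UH HM.
have H0 p : 0 <= H p by exact: le_trans (UH p).
have UN N : `|boxsum N U| <= M.
  by apply: le_trans (HM N); apply: (le_trans (ler_norm_sum _ _ _)); exact: ler_sum.
have ndH : nondecreasing_seq (fun N => boxsum N H).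
  apply/nondecreasing_seqP => N; rewrite boxsumS lerDl.
  by apply: sumr_ge0 => c _; exact: H0.
have ndUH : nondecreasing_seq (fun N => boxsum N U + boxsum N H).
  apply/nondecreasing_seqP => N; rewrite !boxsumS addrACA lerDl -big_split/=.
  apply: sumr_ge0 => c _; have := UH (box_point c); rewrite ler_norml => /andP[+ _].
  by rewrite lerNl -subr_ge0 opprK addrC.
have cH : cvgn (fun N => boxsum N H).
  apply: nondecreasing_is_cvgn => //; exists M => _ [N _ <-]; exact: HM.
have cUH : cvgn (fun N => boxsum N U + boxsum N H).
  apply: nondecreasing_is_cvgn => //; exists (M + M) => _ [N _ <-].
  by rewrite lerD// (le_trans (ler_norm _)).
have cU : cvgn (fun N => boxsum N U).
  have -> : (fun N => boxsum N U) = (fun N => (boxsum N U + boxsum N H) - boxsum N H).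
    by apply/funext => N; rewrite addrK.
  exact: is_cvgB.
split => //; rewrite ler_norml; apply/andP; split.
  by apply: limr_ge => //; apply: nearW => N; have := UN N; rewrite ler_norml => /andP[].
by apply: limr_le => //; apply: nearW => N; have := UN N; rewrite ler_norml => /andP[].
Qed.

Lemma geom_le (q : R) N : 0 <= q < 1 -> \sum_(i < N) q ^+ i <= (1 - q)^-1.
Proof.
move=> /andP[q0 q1]; have d : 0 < 1 - q by rewrite subr_gt0.
rewrite -[leRHS]mul1r ler_pdivlMr// mulrC.
have -> : (1 - q) * (\sum_(i < N) q ^+ i) = 1 - q ^+ N.
  elim: N => [|N IH]; first by rewrite big_ord0 mulr0 expr0 subrr.
  by rewrite big_ord_recr/= mulrDr IH exprS; ring.
by rewrite gerBl exprn_ge0.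
Qed.

Lemma gauss_sum1_bound (a : R) N : 0 < a ->
  \sum_(j < N.*2.+1) expR (- a * ((j%:R - N%:R) ^+ 2)) <= 2 * (1 - expR (- a))^-1.
Proof.
move=> a0; set q := expR (- a).
have q01 : 0 <= q < 1.
  by rewrite expR_ge0/= /q -[X in _ < X]expR0 ltr_expR oppr_lt0.
have geq (d : nat) : expR (- a * d%:R ^+ 2) <= q ^+ d.
  rewrite /q -expRM_natl ler_expR (mulrC d%:R) ler_nM2l ?oppr_lt0//.
  by rewrite -natrX ler_nat; case: d => // d; rewrite expnS expn1 leq_pmulr.
have -> : N.*2.+1 = (N + N.+1)%N by rewrite addnS addnn.
rewrite big_split_ord/= mulr_natl mulr2n lerD//.
  apply: le_trans (geom_le N.+1 q01).
  rewrite (reindex_inj rev_ord_inj)/= big_ord_recl/= -[leLHS]add0r lerD//.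
  apply: ler_sum => i _; rewrite natrB//.
  have -> : (N%:R - i.+1%:R - N%:R : R) = - (i.+1%:R) by ring.
  by rewrite sqrrN; exact: geq.
apply: le_trans (geom_le N.+1 q01); apply: ler_sum => i _.
by rewrite natrD addrAC subrr add0r; exact: geq.
Qed.

(** The sum over a cube factors into one-dimensional sums, each bounded by a
geometric series since j <= j^2. *)
Lemma gauss_boxsum (a C : R) : 0 < a -> 0 <= C -> exists M : R, forall N,
  boxsum N (fun p => C * expR (- a * dot p p)) <= M.
Proof.
move=> a0 C0; exists (C * (2 * (1 - expR (- a))^-1) ^+ n) => N.
rewrite /boxsum -mulr_sumr ler_wpM2l//.
have -> : \sum_(c : {ffun 'I_n -> 'I_(N.*2.+1)})
    expR (- a * dot (box_point c) (box_point c)) =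
  \prod_(i < n) \sum_(j < N.*2.+1) expR (- a * ((j%:R - N%:R) ^+ 2)) :> R.
  rewrite bigA_distr_bigA; apply: eq_bigr => c _.
  rewrite /dot mulr_sumr expR_sum; apply: eq_bigr => i _.
  by rewrite mxE expr2.
rewrite prodr_const card_ord lerXn2r ?nnegrE//.
- by apply: sumr_ge0 => j _; exact: expR_ge0.
- rewrite mulr_ge0// invr_ge0 subr_ge0 -[leRHS]expR0 ler_expR oppr_le0; exact: ltW.
- exact: gauss_sum1_bound.
Qed.

End BoxSum.

(** * Multipliers on the torus; Littlewood-Paley and heat symbols are admissible *)

Section TorusMultiplier.
Context {R : realType} {n : nat}.
Implicit Types (m f g phi : 'rV[R]_n -> R) (x w p : 'rV[R]_n).
Local Open Scope complex_scope.

Definition termRe m f x p : R :=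
  m p * (coefc f p * cos (dot p x) - coefs f (- p) * sin (dot p x)).
Definition termIm m f x p : R :=
  m p * (coefc f p * sin (dot p x) + coefs f (- p) * cos (dot p x)).

Lemma Re_sum (I : finType) (F : I -> R[i]) :
  @complex.Re R (\sum_i F i) = \sum_i @complex.Re R (F i).
Proof. by apply: (big_morph (@complex.Re R)) => // [[a b] [c d]]. Qed.

Lemma Im_sum (I : finType) (F : I -> R[i]) :
  @complex.Im R (\sum_i F i) = \sum_i @complex.Im R (F i).
Proof. by apply: (big_morph (@complex.Im R)) => // [[a b] [c d]]. Qed.

Lemma torus_multiplierE m f x : multiplier Torus m f x =
  limn (fun N => boxsum N (termRe m f x)) +i* limn (fun N => boxsum N (termIm m f x)).
Proof.
rewrite /multiplier /clim; congr (limn _ +i* limn _); apply/funext => N.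
  rewrite Re_sum; apply: eq_bigr => c _.
  by rewrite fourier_coefE !cReM !cImM /= /termRe; ring.
rewrite Im_sum; apply: eq_bigr => c _.
by rewrite fourier_coefE !cImM !cReM /= /termIm; ring.
Qed.

Lemma normc_le (a b : R) : Normc.normc (a +i* b) <= `|a| + `|b|.
Proof.
rewrite /Normc.normc -[leRHS]ger0_norm ?addr_ge0// -sqrtr_sqr ler_wsqrtr//.
rewrite sqrrD !real_normK ?num_real// lerD2r lerDl.
by rewrite mulrn_wge0// mulr_ge0.
Qed.

Lemma boxsum_delta N w (G : 'rV[R]_n -> R) :
  (exists c : {ffun 'I_n -> 'I_(N.*2.+1)}, box_point c = w) ->
  boxsum N (fun p => (p == w)%:R * G p) = G w.
Proof.
move=> [c cw]; rewrite /boxsum (bigD1 c)//= cw eqxx mul1r big1 ?addr0// => c' c'c.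
rewrite (_ : (_ == w) = false) ?mul0r//; apply/negbTE; apply: contra c'c.
by rewrite -cw => /eqP/box_point_inj ->.
Qed.

Lemma box_axis N (k : nat) i : (k <= N)%N ->
  exists c : {ffun 'I_n -> 'I_(N.*2.+1)}, box_point c = k%:R *: delta_mx 0 i :> 'rV[R]_n.
Proof.
move=> kN; exists [ffun j => inord (if j == i then N + k else N)%N].
apply/rowP => j; rewrite !mxE ffunE inordK; last first.
  by rewrite ltnS -addnn; case: ifP => _; rewrite ?leq_add2l ?leq_addr.
by case: eqVneq => ji; rewrite /= ?natrD; ring.
Qed.

Lemma box_axisN N (k : nat) i : (k <= N)%N ->
  exists c : {ffun 'I_n -> 'I_(N.*2.+1)}, box_point c = - (k%:R *: delta_mx 0 i) :> 'rV[R]_n.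
Proof.
move=> kN; exists [ffun j => inord (if j == i then N - k else N)%N].
apply/rowP => j; rewrite !mxE ffunE inordK; last first.
  rewrite ltnS -addnn; case: ifP => _; rewrite ?leq_addr//.
  by rewrite (leq_trans (leq_subr _ _))// leq_addr.
by case: eqVneq => ji; rewrite /= ?natrB//; ring.
Qed.

Lemma axis_dot (k : R) i (y : 'rV[R]_n) : k * y 0 i = dot (k *: delta_mx 0 i) y.
Proof.
rewrite dotZl; congr (_ * _); rewrite /dot (bigD1 i)//= big1.
  by rewrite mxE !eqxx mul1r addr0.
by move=> j ji; rewrite mxE eqxx (negbTE ji) mul0r.
Qed.

(** Fourier coefficients are bounded by the sup norm, so the series is dominated by a
Gaussian sum, whence boundedness and linearity. The only frequencies of a cosine
are w and - w, and m takes the same value at both. *)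
Lemma torus_admissible m (a C : R) : even_fun m -> 0 < a -> 0 <= C ->
  (forall p, `|m p| <= C * expR (- a * dot p p)) -> admissible Torus m.
Proof.
move=> em a0 C0 mC.
have [M HM] := @gauss_boxsum R n a C a0 C0.
have M0 : 0 <= M.
  apply: le_trans (HM 0%N); apply: sumr_ge0 => c _.
  by rewrite mulr_ge0// expR_ge0.
have tRe f x (B : R) p : tame Torus f -> (forall y, `|f y| <= B) ->
    `|termRe m f x p| <= (2 * B) * (C * expR (- a * dot p p)).
  move=> tf fB; rewrite normrM mulrC ler_pM//.
  have := coefc_bound p tf fB; have := coefs_bound (- p) tf fB => h1 h2.
  rewrite mulr_natl mulr2n; apply: le_trans (ler_normB _ _) _.
  by apply: lerD; rewrite normrM; [apply: le_trans h2|apply: le_trans h1];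
    rewrite ler_piMr// ?norm_cos_le1 ?norm_sin_le1.
have tIm f x (B : R) p : tame Torus f -> (forall y, `|f y| <= B) ->
    `|termIm m f x p| <= (2 * B) * (C * expR (- a * dot p p)).
  move=> tf fB; rewrite normrM mulrC ler_pM//.
  have := coefc_bound p tf fB; have := coefs_bound (- p) tf fB => h1 h2.
  rewrite mulr_natl mulr2n; apply: le_trans (ler_normD _ _) _.
  by apply: lerD; rewrite normrM; [apply: le_trans h2|apply: le_trans h1];
    rewrite ler_piMr// ?norm_cos_le1 ?norm_sin_le1.
have B0 f (B : R) : (forall y : 'rV[R]_n, `|f y| <= B) -> 0 <= B.
  by move=> fB; apply: le_trans (fB 0).
have HB (B : R) : 0 <= B -> forall N,
    boxsum N (fun p : 'rV[R]_n => (2 * B) * (C * expR (- a * dot p p))) <= (2 * B) * M.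
  move=> B0' N; rewrite /boxsum -mulr_sumr.
  by apply: ler_wpM2l; [rewrite mulr_ge0|exact: HM].
split.
- exists (4 * M) => [|f B x tf fB]; first by rewrite mulr_ge0.
  rewrite torus_multiplierE; apply: le_trans (normc_le _ _) _.
  have [_ h1] := boxsum_cvg (fun p => tRe f x B p tf fB) (HB _ (B0 _ _ fB)).
  have [_ h2] := boxsum_cvg (fun p => tIm f x B p tf fB) (HB _ (B0 _ _ fB)).
  by have := lerD h1 h2; move=> /le_trans; apply; rewrite le_eqVlt; apply/orP; left; apply/eqP; ring.
- move=> b f g x tf tg.
  have [_ _ [Bf fB]] := tf; have [_ _ [Bg gB]] := tg.
  have [cf1 _] := boxsum_cvg (fun p => tRe f x Bf p tf fB) (HB _ (B0 _ _ fB)).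
  have [cf2 _] := boxsum_cvg (fun p => tIm f x Bf p tf fB) (HB _ (B0 _ _ fB)).
  have [cg1 _] := boxsum_cvg (fun p => tRe g x Bg p tg gB) (HB _ (B0 _ _ gB)).
  have [cg2 _] := boxsum_cvg (fun p => tIm g x Bg p tg gB) (HB _ (B0 _ _ gB)).
  rewrite !torus_multiplierE.
  have lin (u v : nat -> R) : cvgn u -> cvgn v ->
      limn (fun N => b * u N + v N) = b * limn u + limn v.
    move=> cu cv; apply/cvg_lim => //; apply: cvgD => //.
    by apply: cvgM => //; exact: cvg_cst.
  have E1 : (fun N => boxsum N (termRe m (fun y => b * f y + g y) x)) =
      (fun N => b * boxsum N (termRe m f x) + boxsum N (termRe m g x)).
    apply/funext => N; rewrite /boxsum mulr_sumr -big_split; apply: eq_bigr => c _ /=.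
    by rewrite /termRe coefc_lin// coefs_lin//; ring.
  have E2 : (fun N => boxsum N (termIm m (fun y => b * f y + g y) x)) =
      (fun N => b * boxsum N (termIm m f x) + boxsum N (termIm m g x)).
    apply/funext => N; rewrite /boxsum mulr_sumr -big_split; apply: eq_bigr => c _ /=.
    by rewrite /termIm coefc_lin// coefs_lin//; ring.
  rewrite E1 E2 lin// lin//.
  by apply/eqP; rewrite eq_complex /=; apply/andP; split; apply/eqP; ring.
- move=> k i x; pose w : 'rV[R]_n := k%:R *: delta_mx 0 i.
  have -> : (fun y : 'rV[R]_n => cos (k%:R * y 0 i)) = (fun y => cos (dot w y)).
    by apply/funext => y; rewrite axis_dot.
  rewrite torus_multiplierE axis_dot -/w.
  have iw : intvec w.
    exists (fun j => if j == i then k else 0%N), (fun=> 0%N) => j.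
    by rewrite !mxE eqxx; case: eqVneq => _ /=; rewrite ?mulr1 ?mulr0 subr0.
  have cE N (c : {ffun 'I_n -> 'I_(N.*2.+1)}) :
      coefc (fun y => cos (dot w y)) (box_point c) =
        2^-1 * ((box_point c == w)%:R + (box_point c == - w)%:R) /\
      coefs (fun y => cos (dot w y)) (- box_point c) = 0.
    have := fourier_coef_cos iw (box_point_intvec c); rewrite fourier_coefE.
    by move=> h; split; [move/(congr1 (@complex.Re R)) : h|move/(congr1 (@complex.Im R)) : h].
  have E1 N : (k <= N)%N -> boxsum N (termRe m (fun y => cos (dot w y)) x) = m w * cos (dot w x).
    move=> kN.
    transitivity (boxsum N (fun p => (p == w)%:R * (m p * 2^-1 * cos (dot p x))) +
      boxsum N (fun p => (p == - w)%:R * (m p * 2^-1 * cos (dot p x)))).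
      rewrite /boxsum -big_split; apply: eq_bigr => c _ /=.
      by have [h1 h2] := cE N c; rewrite /termRe h1 h2; ring.
    rewrite boxsum_delta; last exact: box_axis.
    rewrite boxsum_delta; last exact: box_axisN.
    by rewrite em dotNl cosN; field.
  have E2 N : (k <= N)%N -> boxsum N (termIm m (fun y => cos (dot w y)) x) = 0.
    move=> kN.
    transitivity (boxsum N (fun p => (p == w)%:R * (m p * 2^-1 * sin (dot p x))) +
      boxsum N (fun p => (p == - w)%:R * (m p * 2^-1 * sin (dot p x)))).
      rewrite /boxsum -big_split; apply: eq_bigr => c _ /=.
      by have [h1 h2] := cE N c; rewrite /termIm h1 h2; ring.
    rewrite boxsum_delta; last exact: box_axis.
    rewrite boxsum_delta; last exact: box_axisN.
    by rewrite em dotNl sinN; ring.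
  have nk : \forall N \near \oo, (k <= N)%N by exact: nbhs_infty_ge.
  congr (_ +i* _); apply/cvg_lim => //; apply: cvg_near_cst; move: nk; apply: filterS => N kN.
    exact: E1.
  exact: E2.
Qed.

(** On the ball of radius r the Gaussian exp(r^2 - |p|^2) is at least 1. *)
Lemma symbol_dominated m (r C : R) : 0 <= r -> 0 <= C -> (forall x, `|m x| <= C) ->
  (forall x, r <= enorm x -> m x = 0) ->
  forall p, `|m p| <= C * expR (r ^+ 2) * expR (- 1 * dot p p).
Proof.
move=> r0 C0 mC mr p; have [rp|pr] := leP r (enorm p).
  by rewrite mr// normr0 !mulr_ge0// expR_ge0.
apply: (le_trans (mC p)); rewrite -mulrA ler_peMr// -expRD.
apply: le_trans (expR_ge1Dx _); rewrite lerDl mulN1r subr_ge0 -enorm_sq.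
by rewrite lerXn2r ?nnegrE ?sqrtr_ge0// ltW.
Qed.

Lemma enormZ (a : R) x : 0 <= a -> enorm (a *: x) = a * enorm x.
Proof.
move=> a0; rewrite /enorm dotZl dotZr mulrA -expr2 sqrtrM ?sqr_ge0//.
by rewrite sqrtr_sqr ger0_norm.
Qed.

Lemma lp_symbol_zero phi j (x : 'rV[R]_n) : lp_cutoff phi -> 2 * 2 ^+ j <= enorm x ->
  lp_symbol phi j x = 0.
Proof.
move=> [_ _ _ _ z2]; case: j => [|j]; first by rewrite expr0 mulr1; exact: z2.
move=> hx /=; have p0 k : 0 < (2:R) ^- k by rewrite invr_gt0 exprn_gt0.
have h k : (k <= j.+1)%N -> phi (2 ^- k *: x) = 0.
  move=> kj; apply: z2; rewrite (enormZ _ (ltW (p0 k))).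
  rewrite mulrC ler_pdivlMr ?exprn_gt0//; apply: le_trans hx.
  by rewrite ler_pM2l// ler_eXn2l// ltr1n.
by rewrite !h// subrr.
Qed.

Lemma lp_symbol_bound phi j (x : 'rV[R]_n) : lp_cutoff phi -> `|lp_symbol phi j x| <= 1.
Proof.
move=> [_ _ rg _ _]; case: j => [|j] /=.
  by have /andP[h1 h2] := rg x; rewrite ger0_norm.
have /andP[h1 h2] := rg (2 ^- j.+1 *: x); have /andP[h3 h4] := rg (2 ^- j *: x).
by rewrite ler_norml; apply/andP; split; lra.
Qed.

Lemma admissible_lp (M : flat_space) (phi : 'rV[R]_n -> R) (j : nat) : lp_cutoff phi ->
  admissible M (lp_symbol phi j).
Proof.
move=> cp; have gs := good_lp_symbol j cp.
case: M; first exact: euclid_admissible.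
have r0 : 0 <= 2 * 2 ^+ j :> R by rewrite mulr_ge0// exprn_ge0.
apply: (torus_admissible (good_even gs) ltr01 _
  (symbol_dominated r0 ler01 _ _)).
- by rewrite mul1r expR_ge0.
- by move=> x; exact: lp_symbol_bound.
- by move=> x; exact: lp_symbol_zero.
Qed.

Lemma admissible_heat (M : flat_space) (t : R) : 0 < t ->
  admissible M (fun xi : 'rV[R]_n => expR (- t * enorm xi ^+ 2)).
Proof.
move=> t0; have gs := @good_gauss R n t t0.
case: M; first exact: euclid_admissible.
apply: (torus_admissible (good_even gs) t0 ler01) => p.
by rewrite mul1r enorm_sq ger0_norm// expR_ge0.
Qed.

End TorusMultiplier.

(** * Picard iteration on lists of cosine terms *)

Section TimeIntegral.
Context {R : realType}.
Variable T : R.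
Implicit Types (f g : R -> R) (t : R).

(** Time is restricted to [0, T] throughout, since the amplitudes of the Picard
iterates are integrals from time 0 and are continuous only there. *)
Definition Tcont f := {within `[0, T], continuous f}.

Lemma Tcont_cst (c : R) : Tcont (fun=> c).
Proof. by apply: continuous_subspaceT => x; exact: cvg_cst. Qed.

Lemma TcontD f g : Tcont f -> Tcont g -> Tcont (fun s => f s + g s).
Proof. by move=> cf cg x; apply: cvgD; [exact: cf|exact: cg]. Qed.

Lemma TcontM f g : Tcont f -> Tcont g -> Tcont (fun s => f s * g s).
Proof. by move=> cf cg x; apply: cvgM; [exact: cf|exact: cg]. Qed.

Lemma Tcont_norm f : Tcont f -> Tcont (fun s => `|f s|).
Proof. by move=> cf x; apply: cvg_norm; exact: cf. Qed.

Lemma Tcont_sum (I : Type) (r : seq I) (F : I -> R -> R) :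
  (forall i, Tcont (F i)) -> Tcont (fun s => \sum_(i <- r) F i s).
Proof.
move=> cF; elim: r => [|i r IH].
  rewrite (_ : (fun s => _) = fun=> 0); first exact: Tcont_cst.
  by apply/funext => s; rewrite big_nil.
rewrite (_ : (fun s => _) = fun s => F i s + \sum_(j <- r) F j s).
  exact: TcontD.
by apply/funext => s; rewrite big_cons.
Qed.

Lemma Tcont_continuous f : continuous f -> Tcont f.
Proof. exact: continuous_subspaceT. Qed.

Definition tint t f : R := \int[leb R]_(s in `[0, t]) f s.

Lemma Tcont_integrable f t : t <= T -> Tcont f ->
  (leb R).-integrable `[0, t] (EFin \o f).
Proof.
move=> tT cf.
have h : (leb R).-integrable `[0, T] (EFin \o f).
  by apply: continuous_compact_integrable => //; exact: segment_compact.
apply: (integrableS _ _ _ h); [exact: measurable_itv|exact: measurable_itv|].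
by apply: subset_itvl; rewrite bnd_simp.
Qed.

Lemma tint_D f g t : t <= T -> Tcont f -> Tcont g ->
  tint t (fun s => f s + g s) = tint t f + tint t g.
Proof.
by move=> tT cf cg; apply: RintegralD; [exact: measurable_itv|exact: Tcont_integrable..].
Qed.

Lemma tint_Z (c : R) f t : t <= T -> Tcont f ->
  tint t (fun s => c * f s) = c * tint t f.
Proof.
by move=> tT cf; apply: RintegralZl; [exact: measurable_itv|exact: Tcont_integrable..].
Qed.

Lemma tint_sum (I : Type) (r : seq I) (F : I -> R -> R) t : t <= T ->
  (forall i, Tcont (F i)) ->
  tint t (fun s => \sum_(i <- r) F i s) = \sum_(i <- r) tint t (F i).
Proof.
move=> tT cF; elim: r => [|i r IH].
  rewrite big_nil /tint (_ : (fun s => _) = fun=> 0); last first.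
    by apply/funext => s; rewrite big_nil.
  by rewrite /Rintegral integral0.
rewrite big_cons -IH -tint_D//; last exact: Tcont_sum.
by congr tint; apply/funext => s; rewrite big_cons.
Qed.

Lemma le_tint f g t : t <= T -> Tcont f -> Tcont g ->
  (forall s, 0 <= s <= t -> f s <= g s) -> tint t f <= tint t g.
Proof.
move=> tT cf cg fg; apply: le_Rintegral; [exact: measurable_itv|exact: Tcont_integrable..|].
by move=> s /=; rewrite in_itv/=; exact: fg.
Qed.

Lemma norm_tint f t : t <= T -> Tcont f -> `|tint t f| <= tint t (fun s => `|f s|).
Proof.
by move=> tT cf; apply: le_normr_Rintegral; [exact: measurable_itv|exact: Tcont_integrable].
Qed.

Lemma tint_ge0 f t : (forall s, 0 <= s <= t -> 0 <= f s) -> 0 <= tint t f.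
Proof. by move=> f0; apply: Rintegral_ge0 => s /=; rewrite in_itv/=; exact: f0. Qed.

Lemma tint_mono f t : 0 <= t -> t <= T -> Tcont f -> (forall s, 0 <= s <= T -> 0 <= f s) ->
  tint t f <= tint T f.
Proof.
move=> t0 tT cf f0; rewrite /tint /Rintegral; apply: fine_le.
- apply: integrable_fin_num; first exact: measurable_itv.
  exact: Tcont_integrable.
- apply: integrable_fin_num; first exact: measurable_itv.
  exact: Tcont_integrable.
apply: ge0_subset_integral.
- exact: measurable_itv.
- exact: measurable_itv.
- have := Tcont_integrable (lexx T) cf; by case/integrableP.
- by move=> s /=; rewrite in_itv/= lee_fin; exact: f0.
- by apply: subset_itvl; rewrite bnd_simp.
Qed.

Lemma tint_0 f : tint 0 f = 0.
Proof. by rewrite /tint set_itv1 Rintegral_set1. Qed.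

Lemma tint_eq f g t : (forall s, 0 <= s <= t -> f s = g s) -> tint t f = tint t g.
Proof.
by move=> fg; apply: eq_Rintegral => s /set_mem /=; rewrite in_itv/=; exact: fg.
Qed.

Lemma Tcont_tint f : 0 <= T -> Tcont f -> Tcont (fun t => tint t f).
Proof.
move=> T0 cf; apply: (parameterized_integral_continuous T0).
by apply: Tcont_integrable.
Qed.

Lemma tint_cst (c : R) t : 0 <= t -> tint t (fun=> c) = c * t.
Proof.
move=> t0; rewrite /tint Rintegral_cst; last exact: measurable_itv.
rewrite /= lebesgue_measure_itv/= lte_fin; case: ltP => //= [_|tl0]; first by rewrite subr0.
by have -> : t = 0 by apply/eqP; rewrite eq_le tl0 t0.
Qed.

End TimeIntegral.

Section CosLists.
Context {R : realType}.
Variable T : R.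

(** The term a(t) cos(k th); the amplitude is bundled with its continuity so that
lists of terms can be integrated in time. *)
Record cterm := CTerm { amp :> R -> R ; amp_cont : Tcont T amp ; freq : nat }.
Implicit Types (p q : cterm) (l r a b c : seq cterm) (t th : R).

Definition csum l t th : R := \sum_(p <- l) p t * cos ((freq p)%:R * th).
(** The weight is 2^k because it is multiplicative under the addition of frequencies
and dominates k^2; no frequency is collected, so that a norm of a product is a
plain double sum. *)
Definition wnorm l t : R := \sum_(p <- l) `|p t| * 2 ^+ freq p.

Lemma tmul_cont p q : Tcont T (fun t => 2^-1 * (p t * q t)).
Proof.
apply: TcontM; first exact: Tcont_cst.
by apply: TcontM; exact: amp_cont.
Qed.

Definition tmul_add p q := CTerm (@tmul_cont p q) (freq p + freq q).
(** The frequency is |k - k'|, written as a sum of two truncated differences one of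
which is zero. *)
Definition tmul_sub p q :=
  CTerm (@tmul_cont p q) ((freq p - freq q) + (freq q - freq p)).

Definition lmul l r : seq cterm :=
  [seq tmul_add p q | p <- l, q <- r] ++ [seq tmul_sub p q | p <- l, q <- r].

Lemma sum_lmul l r (G : cterm -> R) : \sum_(x <- lmul l r) G x =
  \sum_(p <- l) \sum_(q <- r) (G (tmul_add p q) + G (tmul_sub p q)).
Proof.
rewrite big_cat/= !big_allpairs_dep -big_split/=; apply: eq_bigr => p _.
by rewrite -big_split.
Qed.

Lemma cos_distn (m n : nat) th :
  cos (((m - n) + (n - m))%N%:R * th) = cos (m%:R * th - n%:R * th).
Proof.
case: (leqP n m) => [wnorm|/ltnW mn].
  by rewrite (eqP wnorm) addn0 natrB// mulrBl.
by rewrite (eqP mn) add0n natrB// mulrBl -opprB cosN.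
Qed.

(** cos a cos b = (cos (a + b) + cos (a - b)) / 2. *)
Lemma csum_lmul l r t th : csum (lmul l r) t th = csum l t th * csum r t th.
Proof.
rewrite /csum sum_lmul mulr_suml; apply: eq_bigr => p _.
rewrite mulr_sumr; apply: eq_bigr => q _ /=.
by rewrite cos_distn natrD mulrDl cosD cosB; field.
Qed.

Lemma wnorm_ge0 l t : 0 <= wnorm l t.
Proof. by apply: sumr_ge0 => p _; rewrite mulr_ge0// exprn_ge0. Qed.

Lemma wnorm_lmul l r t : wnorm (lmul l r) t <= wnorm l t * wnorm r t.
Proof.
rewrite /wnorm sum_lmul mulr_suml; apply: ler_sum => p _.
rewrite mulr_sumr; apply: ler_sum => q _ /=.
set A := (freq p); set B := (freq q).
have h : (2 : R) ^+ ((A - B) + (B - A)) <= 2 ^+ A * 2 ^+ B.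
  rewrite -exprD ler_eXn2l ?ltr1n//; lia.
have -> : `|2^-1 * (p t * q t)| = 2^-1 * (`|p t| * `|q t|).
  by rewrite normrM normrM gtr0_norm.
rewrite exprD -mulrDr.
have : 0 <= `|p t| * `|q t| by rewrite mulr_ge0.
by move: h; set X := 2 ^+ _; set Y := 2 ^+ A; set Z := 2 ^+ B; nra.
Qed.

Lemma wnorm_cat l r t : wnorm (l ++ r) t = wnorm l t + wnorm r t.
Proof. by rewrite /wnorm big_cat. Qed.

Lemma csum_le_wnorm l t th : `|csum l t th| <= wnorm l t.
Proof.
apply: (le_trans (ler_norm_sum _ _ _)); apply: ler_sum => p _.
rewrite normrM ler_wpM2l//; apply: (le_trans (norm_cos_le1 _)).
by rewrite exprn_ege1// ler1n.
Qed.

Definition lmul3 a b c := lmul (lmul a b) c.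

(** The terms of (l + r)^3 - l^3 as three products, each with a factor r. *)
Definition lincr l r := lmul3 r (l ++ r) (l ++ r) ++ lmul3 l r (l ++ r) ++ lmul3 l l r.

(** The lists agree only up to a permutation; with sums of an arbitrary G over them
the identity serves for values at a point, zero modes and Duhamel integrals
alike. *)
Lemma sum_lincr l r (G : cterm -> R) :
  \sum_(x <- lmul3 (l ++ r) (l ++ r) (l ++ r)) G x =
  \sum_(x <- lmul3 l l l) G x + \sum_(x <- lincr l r) G x.
Proof.
pose S a b c := \sum_(x <- lmul3 a b c) G x.
have D1 a a' b c : S (a ++ a') b c = S a b c + S a' b c.
  by rewrite /S /lmul3 !sum_lmul big_cat.
have D2 a b b' c : S a (b ++ b') c = S a b c + S a b' c.
  rewrite /S /lmul3 !sum_lmul -big_split/=; apply: eq_bigr => p _.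
  by rewrite big_cat.
have D3 a b c c' : S a b (c ++ c') = S a b c + S a b c'.
  rewrite /S /lmul3 !sum_lmul -big_split/=; apply: eq_bigr => p _.
  rewrite -big_split/=; apply: eq_bigr => q _.
  rewrite !big_cat/=; ring.
transitivity (S l l l + (S r (l ++ r) (l ++ r) + (S l r (l ++ r) + S l l r))).
  rewrite -/(S _ _ _) D1 (D2 l l r (l ++ r)) (D3 l l l r); ring.
by rewrite /S /lincr -!big_cat.
Qed.

Lemma wnorm_lmul3 a b c t : wnorm (lmul3 a b c) t <= wnorm a t * wnorm b t * wnorm c t.
Proof.
apply: (le_trans (wnorm_lmul _ _ _)); rewrite ler_wpM2r ?wnorm_ge0//.
exact: wnorm_lmul.
Qed.

Lemma wnorm_lincr l r t (Y : R) : wnorm l t + wnorm r t <= Y ->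
  wnorm (lincr l r) t <= 3 * Y ^+ 2 * wnorm r t.
Proof.
move=> lY.
have -> : wnorm (lincr l r) t = wnorm (lmul3 r (l ++ r) (l ++ r)) t +
    (wnorm (lmul3 l r (l ++ r)) t + wnorm (lmul3 l l r) t).
  by rewrite /lincr (wnorm_cat (lmul3 r _ _)) (wnorm_cat (lmul3 l r _)).
have h1 := wnorm_lmul3 r (l ++ r) (l ++ r) t; have h2 := wnorm_lmul3 l r (l ++ r) t.
have h3 := wnorm_lmul3 l l r t; rewrite wnorm_cat in h1 h2.
have x0 := wnorm_ge0 l t; have y0 := wnorm_ge0 r t.
move: h1 h2 h3 lY x0 y0; set x := wnorm l t; set y := wnorm r t.
move=> h1 h2 h3 lY x0 y0.
have xY : x <= Y by apply: le_trans lY; rewrite lerDl.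
have Y0 : 0 <= Y := le_trans x0 xY.
have e1 : y * (x + y) * (x + y) <= Y ^+ 2 * y.
  by rewrite -mulrA mulrC ler_wpM2r// expr2 ler_pM// addr_ge0.
have e2 : x * y * (x + y) <= Y ^+ 2 * y.
  by rewrite mulrAC ler_wpM2r// expr2 ler_pM// addr_ge0.
have e3 : x * x * y <= Y ^+ 2 * y by rewrite ler_wpM2r// expr2 ler_pM.
move: h1 h2 h3 e1 e2 e3; lra.
Qed.

Section Duhamel.
Variable Lam : R.
Hypotheses (T0 : 0 <= T) (Lam0 : 0 <= Lam).

(** The decay rate of a term under the heat flow: th is a multiple of a coordinate
of x, and Lam is the square of the ratio. *)
Definition lam p : R := Lam * (freq p)%:R ^+ 2.

Lemma lam_ge0 p : 0 <= lam p. Proof. by rewrite mulr_ge0// sqr_ge0. Qed.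

Lemma duh_cont p : Tcont T (fun t => - (expR (- (lam p * t)) *
   tint t (fun s => expR (lam p * s) * p s))).
Proof.
have ce (c : R) : Tcont T (fun s => expR (c * s)).
  apply: Tcont_continuous; apply: (continuous_compose _ (@continuous_expR R)) => x.
  exact: mulrl_continuous.
have c1 : Tcont T (fun t => expR (- (lam p * t)) * tint t (fun s => expR (lam p * s) * p s)).
  apply: TcontM; first by have := ce (- lam p); under eq_fun do rewrite mulNr.
  by apply: Tcont_tint => //; apply: TcontM; [exact: ce|exact: amp_cont].
have := TcontM (@Tcont_cst _ T (-1)) c1.
by under eq_fun do rewrite mulN1r.
Qed.

(** Minus the Duhamel integral of one term, which keeps its frequency. The kernel
exp(- lam (t - s)) is split into a product to make the continuity in t visible. *)
Definition duh p := CTerm (@duh_cont p) (freq p).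

Lemma exp_cont (x y : R) : Tcont T (fun s => expR (- (x * (y - s)))).
Proof.
apply: Tcont_continuous; apply: (continuous_compose _ (@continuous_expR R)) => s.
apply: (@cvgN _ _ _ (nbhs s)); apply: cvgM; first exact: cvg_cst.
by apply: cvgB; [exact: cvg_cst|exact: cvg_id].
Qed.

Lemma duhE p t : t <= T ->
  duh p t = - tint t (fun s => p s * expR (- (lam p * (t - s)))).
Proof.
move=> tT; rewrite /= -(@tint_Z _ T)//; last first.
  apply: TcontM; last exact: amp_cont.
  have := @exp_cont (lam p) 0; congr Tcont; apply/funext => s.
  by congr expR; ring.
congr (- tint t _); apply/funext => s.
rewrite mulrA -expRD mulrC; congr (_ * expR _); ring.
Qed.

(** The heat factors are at most 1 for s <= t. *)
Lemma duh_le p t : 0 <= t <= T -> `|duh p t| <= tint t (fun s => `|p s|).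
Proof.
move=> /andP[t0 tT]; rewrite duhE// normrN.
have c1 : Tcont T (fun s => p s * expR (- (lam p * (t - s)))).
  by apply: TcontM; [exact: amp_cont|exact: exp_cont].
apply: (le_trans (norm_tint tT c1)).
apply: (le_tint tT); [exact: Tcont_norm|exact/Tcont_norm/amp_cont|].
move=> s /andP[s0 st]; rewrite normrM ler_piMr// ger0_norm ?expR_ge0//.
by rewrite -[leRHS]expR0 ler_expR oppr_le0 mulr_ge0 ?lam_ge0// subr_ge0.
Qed.

Lemma Tcont_wnorm l : Tcont T (wnorm l).
Proof.
apply: Tcont_sum => p; apply: TcontM; last exact: Tcont_cst.
exact/Tcont_norm/amp_cont.
Qed.

Lemma wnorm_duh l t : 0 <= t <= T -> wnorm (map duh l) t <= tint t (wnorm l).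
Proof.
move=> t0T; have /andP[t0 tT] := t0T.
have cp p : Tcont T (fun s => `|p s| * 2 ^+ freq p).
  by apply: TcontM; [exact/Tcont_norm/amp_cont|exact: Tcont_cst].
rewrite /wnorm big_map (tint_sum _ tT)//; apply: ler_sum => p _.
have -> : tint t (fun s => `|p s| * 2 ^+ freq p) = 2 ^+ freq p * tint t (fun s => `|p s|).
  rewrite -(tint_Z _ tT); last exact/Tcont_norm/amp_cont.
  by congr tint; apply/funext => s; rewrite mulrC.
by rewrite mulrC ler_wpM2l ?exprn_ge0//; exact: duh_le.
Qed.

Lemma csum_duh l t th : t <= T -> csum (map duh l) t th =
  - tint t (fun s => \sum_(p <- l) p s * expR (- (lam p * (t - s))) * cos ((freq p)%:R * th)).
Proof.
move=> tT.
have cp p : Tcont T (fun s => p s * expR (- (lam p * (t - s)))).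
  by apply: TcontM; [exact: amp_cont|exact: exp_cont].
rewrite /csum big_map (tint_sum _ tT); last first.
  by move=> p; apply: TcontM => //; exact: Tcont_cst.
rewrite -sumrN; apply: eq_bigr => p _; rewrite duhE//=.
rewrite mulNr mulrC -(tint_Z _ tT)//; congr (- tint t _); apply/funext => s.
by rewrite mulrC.
Qed.

Section Picard.
Variable w : seq cterm.

(** The iterate L_n together with the increment R_n such that L_(n+1) = L_n + R_n.
Keeping increments as lists makes their norm bound the difference of
consecutive iterates with no cancellation to be exploited. *)
Fixpoint picard n : seq cterm * seq cterm :=
  match n with
  | 0 => (w, map duh (lmul3 w w w))
  | n'.+1 => ((picard n').1 ++ (picard n').2,
              map duh (lincr (picard n').1 (picard n').2))
  end.

(** The increments telescope: L_(n+1) is w minus the Duhamel integral of L_n^3. *)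
Lemma sum_picard n (G : cterm -> R) :
  \sum_(x <- (picard n.+1).1) G x = \sum_(x <- w) G x +
  \sum_(x <- map duh (lmul3 (picard n).1 (picard n).1 (picard n).1)) G x.
Proof.
rewrite /= big_cat/=; elim: n => [//|n IH] /=.
by rewrite big_cat/= IH !big_map (sum_lincr _ _ (G \o duh)) addrA.
Qed.

Variables (W : R -> R) (B q : R).
Hypotheses (cW : Tcont T W) (wW : forall t, 0 <= t <= T -> wnorm w t <= W t)
  (WB : tint T (fun t => W t ^+ 3) <= B)
  (Wq : tint T (fun t => 3 * (W t + 2 * B) ^+ 2) <= q) (q2 : q <= 2^-1).

Lemma W_ge0 t : 0 <= t <= T -> 0 <= W t.
Proof. by move=> h; apply: le_trans (wW h); exact: wnorm_ge0. Qed.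

Lemma B_ge0 : 0 <= B.
Proof.
apply: le_trans WB; apply: tint_ge0 => s h; rewrite exprn_ge0//; exact: W_ge0.
Qed.

Lemma q_ge0 : 0 <= q.
Proof.
apply: le_trans Wq; apply: tint_ge0 => s h; by rewrite mulr_ge0// sqr_ge0.
Qed.

(** The first increment is at most the integral of W^3, and the cube of a sum
bounded by W + 2 B changes under an increment R by at most 3 (W + 2 B)^2 R.
As q <= 1/2 the increments sum up to at most 2 B, which closes the induction. *)
Lemma picard_bound n t : 0 <= t <= T ->
  wnorm (picard n).2 t <= B * q ^+ n /\
  wnorm (picard n).1 t <= W t + 2 * B * (1 - 2^-1 ^+ n).
Proof.
have B0 := B_ge0; have q0 := q_ge0.
elim: n t => [|n IH] t t0T; have /andP[t0 tT] := t0T; split.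
- rewrite expr0 mulr1 /=; apply: (le_trans (wnorm_duh _ t0T)).
  apply: le_trans WB; apply: (@le_trans _ _ (tint t (fun s => W s ^+ 3))).
    apply: (le_tint tT); first exact: Tcont_wnorm.
      by apply: TcontM; [exact: cW|apply: TcontM; exact: cW].
    move=> s /andP[s0 st]; apply: (le_trans (wnorm_lmul3 _ _ _ _)).
    have h := wW (introT andP (conj s0 (le_trans st tT))).
    have h0 := wnorm_ge0 w s; rewrite exprS expr2 mulrA.
    by apply: ler_pM => //; [exact: mulr_ge0|exact: ler_pM].
  apply: (@tint_mono _ T) => //.
    by apply: TcontM; [exact: cW|apply: TcontM; exact: cW].
  by move=> s h; rewrite exprn_ge0// W_ge0.
- by rewrite expr0 subrr mulr0 addr0 /=; exact: wW.
- rewrite /=; apply: (le_trans (wnorm_duh _ t0T)).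
  have cY : Tcont T (fun s => 3 * (W s + 2 * B) ^+ 2).
    apply: TcontM; first exact: Tcont_cst.
    by apply: TcontM; apply: TcontD => //; exact: Tcont_cst.
  apply: (@le_trans _ _ (tint t (fun s => (B * q ^+ n) * (3 * (W s + 2 * B) ^+ 2)))).
    apply: (le_tint tT); first exact: Tcont_wnorm.
      by apply: TcontM => //; exact: Tcont_cst.
    move=> s /andP[s0 st].
    have [hr hl] := IH s (introT andP (conj s0 (le_trans st tT))).
    apply: (le_trans (@wnorm_lincr _ _ s (W s + 2 * B) _)).
      apply: (le_trans (lerD hl hr)).
      have qn : q ^+ n <= 2^-1 ^+ n by rewrite lerXn2r// nnegrE.
      have := ler_wpM2l B0 qn.
      have h0 : 0 <= B * 2^-1 ^+ n by rewrite mulr_ge0// exprn_ge0.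
      by move: h0; set X := _ ^+ n; set Z := _ ^+ n; lra.
    by rewrite mulrC ler_wpM2r// mulr_ge0// sqr_ge0.
  rewrite (tint_Z _ tT)// exprSr mulrA ler_wpM2l ?mulr_ge0 ?exprn_ge0//.
  apply: le_trans Wq; apply: (@tint_mono _ T) => // s h.
  by rewrite mulr_ge0// sqr_ge0.
- rewrite /= wnorm_cat; have [hr hl] := IH t t0T.
  apply: (le_trans (lerD hl hr)).
  have qn : q ^+ n <= 2^-1 ^+ n by rewrite lerXn2r// nnegrE.
  have := ler_wpM2l B0 qn; rewrite (exprS (2^-1)).
  by set X := _ ^+ n; set Z := _ ^+ n; lra.
Qed.

Lemma picard_incr n t : 0 <= t <= T -> wnorm (picard n).2 t <= B * q ^+ n.
Proof. by move=> /(picard_bound n)[]. Qed.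

Lemma picard_wnorm n t : 0 <= t <= T -> wnorm (picard n).1 t <= W t + 2 * B.
Proof.
move=> /(picard_bound n)[_ h]; apply: (le_trans h).
rewrite lerD2l ler_piMr ?mulr_ge0 ?B_ge0// lerBlDr lerDl exprn_ge0//.
Qed.

End Picard.
End Duhamel.
End CosLists.

Section GeometricSequences.
Context {R : realType}.

(** As q <= 1/2, the distance from a n to a (n + m) is at most
2 B q^n (1 - 2^(-m)). *)
Lemma geometric_cvg (a : nat -> R) (B q : R) : 0 <= B -> 0 <= q -> q <= 2^-1 ->
  (forall n, `|a n.+1 - a n| <= B * q ^+ n) ->
  cvgn a /\ forall n, `|a n - limn a| <= 2 * B * q ^+ n.
Proof.
move=> B0 q0 q2 h.
have st n m : `|a (n + m)%N - a n| <= 2 * B * q ^+ n * (1 - 2^-1 ^+ m).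
  elim: m => [|m IH]; first by rewrite addn0 expr0 !subrr mulr0 normr0.
  rewrite addnS; have -> : a (n + m).+1 - a n = (a (n + m).+1 - a (n + m)%N) + (a (n + m)%N - a n) by ring.
  apply: (le_trans (ler_normD _ _)); apply: (le_trans (lerD (h _) IH)).
  rewrite exprD exprS.
  have qm : q ^+ m <= 2^-1 ^+ m by rewrite lerXn2r// nnegrE.
  have := ler_wpM2l (mulr_ge0 B0 (exprn_ge0 n q0)) qm.
  rewrite mulrA; set X := q ^+ n; set Y := q ^+ m; set Z := _ ^+ m; lra.
have dist n m : (n <= m)%N -> `|a m - a n| <= 2 * B * q ^+ n.
  move=> wnorm; rewrite -(subnKC wnorm); apply: (le_trans (st _ _)).
  rewrite ler_piMr ?mulr_ge0 ?exprn_ge0// lerBlDr lerDl exprn_ge0//.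
have ge0 : (fun n => 2 * B * q ^+ n) @ \oo --> (0 : R).
  rewrite -[X in _ --> X](mulr0 (2 * B)); apply: cvgMl_tmp; apply: cvg_expr.
  by rewrite ger0_norm// (le_lt_trans q2)// invf_lt1// ltr1n.
have ca : cvgn a.
  apply/cauchy_cvgP; apply: cauchy_exP => e e0.
  have /cvgrPdist_lt /(_ _ e0)[N _ hN] := ge0.
  have := hN N (leqnn N); rewrite /= sub0r normrN ger0_norm ?mulr_ge0 ?exprn_ge0// => hq.
  exists (a N); exists N => // n /= Nn; rewrite /ball/= distrC.
  exact: le_lt_trans (dist _ _ Nn) hq.
split=> // n.
have ca' : (fun m => `|a n - a m|) @ \oo --> `|a n - limn a|.
  by apply: cvg_norm; apply: cvgB; [exact: cvg_cst|exact: ca].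
rewrite -(cvg_lim (@Rhausdorff R) ca').
apply: limr_le; first by apply/cvg_ex; exists `|a n - limn a|.
by exists n => // m /= wnorm; rewrite distrC; exact: dist.
Qed.
End GeometricSequences.

(** * Sup norms, and multipliers of cosine sums and of their uniform limits *)

Section LinftyNorm.
Context {R : realType} {n : nat}.
Implicit Types (g : 'rV[R]_n -> R[i]).

Lemma cell_Torus_gt0 : (0 < lebn R n (cell Torus))%E.
Proof.
rewrite lt0e measure_ge0 andbT; apply/negP => /eqP m0.
have := @Int_cell_ind R n.
rewrite /Int (_ : Rintegral _ _ _ = 0); last first.
  transitivity (Rintegral (lebn R n) setT (\1_(@cell R n Torus))).
    by apply: eq_Rintegral => t _; rewrite cell_indE.
  rewrite /Rintegral (_ : (\int[lebn R n]_x (\1_(@cell R n Torus) x)%:E)%E = 0%E)//.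
  rewrite integral_indic ?setIT//; exact: measurable_cell.
move/eqP; apply/negP; rewrite eq_sym gt_eqF// exprn_gt0// mulr_gt0//.
exact: pi_gt0.
Qed.

Lemma cell_meas M : measurable (@cell R n M).
Proof. by case: M; [exact: measurableT|exact: measurable_cell]. Qed.

Lemma cell_gt0 M : (0 < lebn R n (cell M))%E.
Proof.
case: M; last exact: cell_Torus_gt0.
apply: (lt_le_trans cell_Torus_gt0).
by apply: le_measure => //; rewrite inE; exact: cell_meas.
Qed.

Lemma normc_ge0 (z : R[i]) : 0 <= Normc.normc z.
Proof. by case: z => a b; rewrite /Normc.normc sqrtr_ge0. Qed.

Lemma Linf_le M g (K : R) : 0 <= K ->
  (forall y, Normc.normc (g y) <= K) -> (norm_Linfty M g <= K%:E)%E.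
Proof.
move=> K0 gK; rewrite /norm_Linfty Lnorm.unlock; case: ifPn => [_|_]; last by rewrite lee_fin.
apply/ess_sup_inf.ess_supP; apply: nearW => t /=; rewrite lee_fin normrM.
rewrite indicE; case: (_ \in _) => /=; last by rewrite normr0 mul0r.
by rewrite normr1 mul1r ger0_norm ?normc_ge0.
Qed.

(** A pointwise lower bound passes to the essential supremum because the cell has
positive measure. *)
Lemma Linf_ge M g (K : R) :
  (forall y, K <= Normc.normc (g y)) -> (K%:E <= norm_Linfty M g)%E.
Proof.
move=> gK; rewrite /norm_Linfty Lnorm.unlock.
have mT : (0 < lebn R n setT)%E.
  apply: (lt_le_trans (cell_gt0 M)).
  by apply: le_measure => //; rewrite inE; [exact: cell_meas|exact: measurableT].
rewrite mT; set f := (X in ess_sup_inf.ess_sup _ X).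
have [t []] : exists t, cell M t /\ (f t <= ess_sup_inf.ess_sup (lebn R n) f)%E.
  apply: contrapT => nex.
  have /(_ f) := @ess_sup_inf.ess_sup_ge _ _ _ (lebn R n); case=> A [mA A0 hA].
  have : (lebn R n (cell M) <= lebn R n A)%E.
    apply: le_measure; rewrite ?inE; [exact: cell_meas|exact: mA|].
    by move=> t ct; apply: hA => ft; apply: nex; exists t.
  by rewrite A0 leNgt cell_gt0.
move=> ct; apply: le_trans; rewrite /f /= lee_fin normrM indicE mem_set//.
by rewrite normr1 mul1r ger0_norm ?normc_ge0.
Qed.

Lemma Linf_ge0 M g : (0 <= norm_Linfty M g)%E.
Proof. by apply: (@Linf_ge M g 0) => y; exact: normc_ge0. Qed.

End LinftyNorm.

Section MultiplierLimits.
Context {R : realType} {n : nat}.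
Implicit Types (f g : 'rV[R]_n -> R) (M : flat_space).
Local Open Scope complex_scope.

Lemma normcD (a b : R[i]) : Normc.normc (a + b) <= Normc.normc a + Normc.normc b.
Proof. exact: (@le_normcD R a b). Qed.

Lemma normc_opp (a : R[i]) : Normc.normc (- a) = Normc.normc a.
Proof. exact: (@normcN R a). Qed.

Lemma normc_real (a : R) : Normc.normc a%:C = `|a|.
Proof. by rewrite /Normc.normc /= expr0n addr0 sqrtr_sqr. Qed.

Lemma normc_sub (a b : R[i]) : Normc.normc (a - b) = Normc.normc (b - a).
Proof. by rewrite -normc_opp opprB. Qed.

Lemma tame_lincomb M (a : R) f g : tame M f -> tame M g -> tame M (fun y => a * f y + g y).
Proof.
move=> [df cf [B hB]] [dg cg [B' hB']]; split.
- by case: M df dg => // df dg i x; rewrite df dg.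
- move=> x; apply: (@cvgD _ _ _ (nbhs x)); last exact: cg.
  by apply: cvgM; [exact: cvg_cst|exact: cf].
- exists (`|a| * B + B') => x; apply: (le_trans (ler_normD _ _)).
  by rewrite lerD// normrM ler_wpM2l.
Qed.

Lemma tame0 M : tame M (fun _ : 'rV[R]_n => 0).
Proof.
split; first by case: M.
- exact: cst_continuous.
- by exists 0 => x; rewrite normr0.
Qed.

Lemma tameM M f g : tame M f -> tame M g -> tame M (fun y => f y * g y).
Proof.
move=> [df cf [B hB]] [dg cg [B' hB']]; split.
- by case: M df dg => // df dg i x; rewrite df dg.
- by move=> x; exact: (cvgM (cf x) (cg x)).
- exists (B * B') => x; rewrite normrM ler_pM//.
Qed.

Lemma cos_2pi_nat (k : nat) (a : R) : cos (a + (2 * pi) *+ k) = cos a.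
Proof.
elim: k => [|k IH]; first by rewrite addr0.
by rewrite mulrSr addrA [2 * pi]mulr_natl cosD2pi -mulr_natl IH.
Qed.

Lemma tame_cos M (k : nat) i : tame M (fun y : 'rV[R]_n => cos (k%:R * y 0 i)).
Proof.
split.
- case: M => // j x; rewrite !mxE eqxx /=; case: (i == j); last first.
    by rewrite mulr0 addr0.
  by rewrite mulr1 mulrDr [k%:R * (2 * pi)]mulr_natl cos_2pi_nat.
- apply: (continuous_compose _ (@continuous_cos R)) => x.
  exact: (cvgM (cvg_cst _) (@coord_continuous _ _ _ _ _ x)).
- by exists 1 => x; exact: norm_cos_le1.
Qed.

Section CosineSums.
Variables (I : Type) (k : I -> nat) (i0 : 'I_n).

Definition cosum (l : seq I) (a : I -> R) (y : 'rV[R]_n) : R :=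
  \sum_(p <- l) a p * cos ((k p)%:R * y 0 i0).

Lemma cosum_cons p l a : cosum (p :: l) a =
  fun y => a p * cos ((k p)%:R * y 0 i0) + cosum l a y.
Proof. by apply/funext => y; rewrite /cosum big_cons. Qed.

Lemma tame_cosum M l a : tame M (cosum l a).
Proof.
elim: l => [|p l IH].
  by rewrite (_ : cosum _ _ = fun=> 0); [exact: tame0|apply/funext => y; rewrite /cosum big_nil].
by rewrite cosum_cons; apply: tame_lincomb => //; exact: tame_cos.
Qed.

(** By linearity. The multiplier of the zero function is obtained from 0 = - 1 * 0 + 0. *)
Lemma multiplier_cosum M m l a x : admissible M m ->
  multiplier M m (cosum l a) x =
  (cosum l (fun p => a p * m ((k p)%:R *: delta_mx 0 i0)) x)%:C.
Proof.
move=> am; elim: l => [|p l IH].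
  have t0 := tame0 M.
  have := @adm_lin _ _ _ _ am (-1) _ _ x t0 t0.
  have -> : cosum [::] a = (fun=> 0) by apply/funext => y; rewrite /cosum big_nil.
  rewrite (_ : -1 * 0 + 0 = 0 :> R); last by rewrite mulr0 addr0.
  by rewrite rmorphN1 mulN1r addNr /cosum big_nil.
rewrite !cosum_cons (adm_lin am); [|exact: tame_cos|exact: tame_cosum].
by rewrite IH (adm_cos am) -rmorphM -rmorphD mulrA.
Qed.

End CosineSums.

Lemma tame_lim M (g : nat -> 'rV[R]_n -> R) f (e : nat -> R) :
  (forall k, tame M (g k)) -> e @ \oo --> 0 ->
  (forall k y, `|f y - g k y| <= e k) -> tame M f.
Proof.
move=> tg e0 fg.
have gf y : (g^~ y) @ \oo --> f y.
  apply/cvgrPdist_le => r r0; move/cvgrPdist_le: e0 => /(_ _ r0).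
  apply: filterS => k; rewrite sub0r normrN; apply: le_trans.
  by apply: (le_trans (fg k y)); exact: ler_norm.
split.
- case: M tg => // tg i x.
  have := cvg_lim (@Rhausdorff R) (gf x) => <-.
  have := cvg_lim (@Rhausdorff R) (gf (x + (2 * pi) *: delta_mx 0 i)) => <-.
  by congr (limn _); apply/funext => k; have [dg _ _] := tg k; exact: dg.
- move=> x; apply/(@cvgrPdist_lt _ _ _ (nbhs x) _ f (f x)) => r r0.
  have r3 : 0 < r / 3 by rewrite divr_gt0.
  move/cvgrPdist_lt: e0 => /(_ _ r3)[N _ /(_ N (leqnn N))] /=.
  rewrite sub0r normrN => eN.
  have eN' : e N < r / 3 := le_lt_trans (ler_norm _) eN.
  have [_ cg _] := tg N.
  move/(@cvgrPdist_lt _ _ _ (nbhs x) _ (g N) (g N x)): (cg x) => /(_ _ r3); apply: filterS => y hy.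
  have -> : f x - f y = (f x - g N x) + (g N x - g N y) + (g N y - f y) by ring.
  apply: (le_lt_trans (ler_normD _ _)).
  apply: (le_lt_trans (lerD (ler_normD _ _) (lexx _))).
  have h1 := fg N x; have h2 := fg N y; rewrite distrC in h2.
  by move: h1 h2 hy eN'; lra.
- have [_ _ [B hB]] := tg 0%N; exists (e 0%N + B) => x.
  rewrite -[f x](subrK (g 0%N x)); apply: (le_trans (ler_normD _ _)).
  by rewrite lerD.
Qed.

(** The bound of [admissible] applied to a difference. *)
Lemma multiplier_dist M m : admissible M m -> exists2 C : R, 0 <= C &
  forall f g (B : R) x, tame M f -> tame M g -> (forall y, `|f y - g y| <= B) ->
  Normc.normc (multiplier M m f x - multiplier M m g x) <= C * B.
Proof.
move=> am; have [[C C0 hC] lin _] := am; exists C => // f g B x tf tg fg.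
have := hC (fun y => -1 * g y + f y) B x (tame_lincomb _ tg tf).
rewrite lin// rmorphN1 mulN1r addrC; apply => y.
by rewrite mulN1r addrC.
Qed.

Section Limits.
Variables (M : flat_space) (m f : 'rV[R]_n -> R) (g : nat -> 'rV[R]_n -> R).
Variables (e : nat -> R).
Hypotheses (am : admissible M m) (tg : forall k, tame M (g k)) (tf : tame M f)
  (e0 : e @ \oo --> 0) (fg : forall k y, `|f y - g k y| <= e k).

Lemma multiplier_cvg x :
  Normc.normc (multiplier M m f x - multiplier M m (g k) x) @[k --> \oo] --> (0 : R).
Proof.
have [C C0 hC] := multiplier_dist am.
have Ce : (fun k => C * e k) @ \oo --> (0 : R).
  by rewrite -[X in _ --> X](mulr0 C); exact: cvgMl_tmp.
apply: (squeeze_cvgr _ _ Ce); last exact: cvg_cst.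
by apply: nearW => k; rewrite normc_ge0 /=; apply: hC.
Qed.

Lemma multiplier_lim_le x (K : R) :
  (\forall k \near \oo, Normc.normc (multiplier M m (g k) x) <= K) ->
  Normc.normc (multiplier M m f x) <= K.
Proof.
move=> gK; apply/ler_addgt0Pr => r r0.
have /cvgrPdist_lt /(_ _ r0) h := multiplier_cvg x.
have [k [h1 h2]] : exists k, Normc.normc (multiplier M m (g k) x) <= K /\
    `|0 - Normc.normc (multiplier M m f x - multiplier M m (g k) x)| < r.
  near \oo => k; exists k; split; near: k => //.
rewrite sub0r normrN ger0_norm ?normc_ge0// in h2.
rewrite -[multiplier M m f x](subrK (multiplier M m (g k) x)).
by apply: (le_trans (normcD _ _)); rewrite addrC lerD// ltW.
Unshelve. all: by end_near. Qed.

Lemma multiplier_lim_ge x (K : R) :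
  (\forall k \near \oo, K <= Normc.normc (multiplier M m (g k) x)) ->
  K <= Normc.normc (multiplier M m f x).
Proof.
move=> gK; apply/ler_addgt0Pr => r r0.
have /cvgrPdist_lt /(_ _ r0) h := multiplier_cvg x.
have [k [h1 h2]] : exists k, K <= Normc.normc (multiplier M m (g k) x) /\
    `|0 - Normc.normc (multiplier M m f x - multiplier M m (g k) x)| < r.
  near \oo => k; exists k; split; near: k => //.
rewrite sub0r normrN ger0_norm ?normc_ge0// in h2.
apply: (le_trans h1); rewrite -[multiplier M m (g k) x](subrK (multiplier M m f x)).
apply: (le_trans (normcD _ _)); rewrite addrC normc_sub lerD2l; exact: ltW h2.
Unshelve. all: by end_near. Qed.

Lemma multiplier_lim_real x (a : nat -> R) (b : R) :
  (forall k, multiplier M m (g k) x = (a k)%:C) -> a @ \oo --> b ->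
  multiplier M m f x = b%:C.
Proof.
move=> ga ab; apply/eqP; rewrite -subr_eq0; apply/eqP/Normc.eq0_normc.
have h := multiplier_cvg x.
have h2 : (fun k => Normc.normc (multiplier M m f x - multiplier M m (g k) x) +
    `|a k - b|) @ \oo --> (0 : R).
  rewrite -[X in _ --> X](addr0 0); apply: cvgD => //.
  rewrite -(@normr0 _ R) -(subrr b); apply: cvg_norm; apply: cvgB => //.
  exact: cvg_cst.
apply/eqP; rewrite eq_le normc_ge0 andbT.
rewrite -(cvg_lim (@Rhausdorff R) h2); apply: limr_ge; first by apply/cvg_ex; exists 0.
apply: nearW => k.
have -> : `|a k - b| = Normc.normc (multiplier M m (g k) x - b%:C).
  by rewrite ga -rmorphB normc_real.
have -> : multiplier M m f x - b%:C = (multiplier M m f x - multiplier M m (g k) x) +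
    (multiplier M m (g k) x - b%:C) by rewrite addrA subrK.
exact: normcD.
Qed.
End Limits.
End MultiplierLimits.

(** * The limit of the Picard iterates solves the equation *)

Section SolutionOfLists.
Context {R : realType} {d : nat}.
Variables (i0 : 'I_d) (M : flat_space) (phi : 'rV[R]_d -> R).
Hypothesis cp : lp_cutoff phi.
Local Open Scope complex_scope.

Lemma axis_enorm (k : nat) : enorm (k%:R *: delta_mx 0 i0 : 'rV[R]_d) = k%:R.
Proof.
rewrite enormZ// (_ : enorm _ = 1) ?mulr1//.
rewrite /enorm -(scale1r (delta_mx 0 i0)) -axis_dot mul1r !mxE !eqxx mulr1.
exact: sqrtr1.
Qed.

Lemma sqr_le_exp2 (k : nat) : (k ^ 2 <= 2 * 2 ^ k)%N.
Proof.
case: k => [//|[//|k]]; elim: k => [//|k IH].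
have h : (2 ^ k.+3 = 2 * 2 ^ k.+2)%N by rewrite -expnS.
have [k0|k1] := posnP k; first by rewrite k0.
by rewrite h; move: IH; nia.
Qed.

Lemma lp_symbol_low j (x : 'rV[R]_d) : enorm x <= 2 ^+ j -> lp_symbol phi j.+1 x = 0.
Proof.
move=> hx; have [_ _ _ o1 _] := cp; have p0 k : 0 <= (2:R) ^- k by rewrite invr_ge0 exprn_ge0.
rewrite /= !o1 ?subrr// enormZ//; rewrite mulrC ler_pdivrMr ?exprn_gt0// mul1r//.
by apply: (le_trans hx); rewrite ler_eXn2l ?ltr1n.
Qed.

(** The symbol vanishes unless N k > 2^(j-1), and then 4^j <= 4 N^2 k^2, while
k^2 <= 2 * 2^k. *)
Lemma lp_symbol_axis_le (N k j : nat) : (0 < N)%N ->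
  `|lp_symbol phi j ((N * k)%:R *: delta_mx 0 i0)| <=
  8 * N%:R ^+ 2 * 2 ^+ k / 4 ^+ j.
Proof.
move=> N0; have N1 : 1 <= N%:R :> R by rewrite ler1n.
have N2 : 1 <= N%:R ^+ 2 :> R by rewrite exprn_ege1.
have K1 : 1 <= 2 ^+ k :> R by rewrite exprn_ege1// ler1n.
case: j => [|j].
  apply: (le_trans (lp_symbol_bound _ _ cp)); rewrite expr0 divr1.
  by move: N2 K1; set a := _ ^+ 2; set b := 2 ^+ k; nra.
have [h|h] := leP (enorm ((N * k)%:R *: delta_mx 0 i0 : 'rV[R]_d)) (2 ^+ j).
  rewrite lp_symbol_low// normr0 divr_ge0 ?exprn_ge0//.
apply: (le_trans (lp_symbol_bound _ _ cp)).
rewrite ler_pdivlMr ?exprn_gt0// mul1r.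
rewrite axis_enorm natrM in h.
have k2 : (k%:R : R) ^+ 2 <= 2 * 2 ^+ k by rewrite -!natrX -natrM ler_nat sqr_le_exp2.
have j0 : 0 <= 2 ^+ j :> R by rewrite exprn_ge0.
have -> : 4 ^+ j.+1 = 4 * (2 ^+ j) ^+ 2 :> R.
  rewrite exprS -exprM mulnC exprM; congr (_ * _ ^+ _); by rewrite expr2; lra.
have h2 : (2 ^+ j) ^+ 2 <= (N%:R * k%:R) ^+ 2 :> R.
  by rewrite lerXn2r ?nnegrE// ?mulr_ge0// ltW.
rewrite exprMn in h2.
have : N%:R ^+ 2 * (k%:R : R) ^+ 2 <= N%:R ^+ 2 * (2 * 2 ^+ k).
  by rewrite ler_wpM2l// (le_trans ler01).
by move: h2; lra.
Qed.

(** The factor 4^j is 2^(2 j), the weight of C^2. *)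
Lemma norm_Cs_le f (K : R) : 0 <= K ->
  (forall j x, Normc.normc (lp_proj M phi j f x) <= K / 4 ^+ j) ->
  (norm_Cs M phi 2 f <= K%:E)%E.
Proof.
move=> K0 hK; apply: ge_ereal_sup => _ [j _ <-].
have -> : 2 `^ (j%:R * 2) = 4 ^+ j :> R.
  rewrite mulrC powRrM powR_mulrn ?powR_ge0// powR_mulrn//; congr (_ ^+ _); lra.
have h : (norm_Linfty M (lp_proj M phi j f) <= (K / 4 ^+ j)%:E)%E.
  by apply: Linf_le => //; rewrite divr_ge0// exprn_ge0.
apply: (@le_trans _ _ ((4 ^+ j)%:E * (K / 4 ^+ j)%:E)%E).
  by rewrite lee_wpmul2l// lee_fin exprn_ge0.
by rewrite -EFinM lee_fin mulrC divfK// gt_eqF// exprn_gt0.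
Qed.

Lemma norm_Cs_ge0 s f : (0 <= norm_Cs M phi s f)%E.
Proof.
apply: le_trans (ereal_sup_ubound _); last by exists 0%N.
by rewrite mule_ge0 ?Linf_ge0// lee_fin powR_ge0.
Qed.

Lemma ereal_cvg0 (I : Type) (F : set_system I) (FF : Filter F) (g : I -> \bar R) :
  (forall x, (0 <= g x)%E) ->
  (forall e, 0 < e -> \forall x \near F, (g x <= e%:E)%E) -> g x @[x --> F] --> 0%E.
Proof.
move=> g0 h; apply/fine_cvgP; split.
  apply: filterS (h 1 ltr01) => x gx; rewrite ge0_fin_numE//.
  exact: le_lt_trans gx (ltry _).
apply/cvgrPdist_le => e e0; apply: filterS (h e e0) => x gx /=.
rewrite sub0r normrN ger0_norm ?fine_ge0// -lee_fin fineK//.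
by rewrite ge0_fin_numE//; exact: le_lt_trans gx (ltry _).
Qed.

Section Picard.
Variables (T : R) (N : nat).
Hypotheses (T0 : 0 < T) (N0 : (0 < N)%N).
Let Lam : R := N%:R ^+ 2.
Let T0' : 0 <= T := ltW T0.
Let Lam0 : 0 <= Lam. Proof. exact: sqr_ge0. Qed.
Implicit Types (l : seq (cterm T)).

(** The lists are functions of th = N x_i0, so the frequency in x_i0 is a multiple
of N. *)
Definition nfreq (p : cterm T) : nat := (N * freq p)%N.
(** The amplitudes are a parameter: the values of the terms at a time, or their
differences between two times. *)
Definition rep l (a : cterm T -> R) : 'rV[R]_d -> R := cosum nfreq i0 l a.

Lemma repE l t y : rep l (fun p => p t) y = csum l t (N%:R * y 0 i0).
Proof. by apply: eq_bigr => p _; rewrite /nfreq natrM mulrA (mulrC (N%:R)). Qed.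

Lemma lp_rep l a j x : Normc.normc (lp_proj M phi j (rep l a) x) <=
  8 * N%:R ^+ 2 * (\sum_(p <- l) `|a p| * 2 ^+ freq p) / 4 ^+ j.
Proof.
rewrite /lp_proj /rep multiplier_cosum ?normc_real; last exact: admissible_lp.
rewrite mulrAC mulr_sumr; apply: (le_trans (ler_norm_sum _ _ _)); apply: ler_sum => p _.
rewrite normrM normrM.
apply: (@le_trans _ _ (`|a p| * (8 * N%:R ^+ 2 * 2 ^+ freq p / 4 ^+ j))).
  apply: (@le_trans _ _ (`|a p| * (8 * N%:R ^+ 2 * 2 ^+ freq p / 4 ^+ j) * 1)).
    apply: ler_pM => //.
      by rewrite ler_wpM2l//; exact: lp_symbol_axis_le.
    exact: norm_cos_le1.
  by rewrite mulr1.
by rewrite le_eqVlt; apply/orP; left; apply/eqP; ring.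
Qed.

Lemma heat_rep l s t x : 0 <= t -> heat M t (rep l (fun p => p s)) x =
  (\sum_(p <- l) p s * expR (- (lam Lam p * t)) *
     cos ((freq p)%:R * (N%:R * x 0 i0)))%:C.
Proof.
rewrite /heat le_eqVlt eq_sym => /orP[/eqP ->|t0].
  rewrite eqxx repE; congr (_%:C); apply: eq_bigr => p _.
  by rewrite mulr0 oppr0 expR0 mulr1.
rewrite gt_eqF// /rep multiplier_cosum; last exact: admissible_heat.
congr (_%:C); apply: eq_bigr => p _.
rewrite axis_enorm /nfreq natrM /lam /Lam.
congr (_ * expR _ * cos _); ring.
Qed.

Variables (w : seq (cterm T)) (W : R -> R) (B q Wm : R).
Hypotheses (cW : Tcont T W) (wW : forall t, 0 <= t <= T -> wnorm w t <= W t)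
  (WB : tint T (fun t => W t ^+ 3) <= B)
  (Wq : tint T (fun t => 3 * (W t + 2 * B) ^+ 2) <= q) (q2 : q <= 2^-1)
  (Wbound : forall t, 0 <= t <= T -> W t <= Wm).

Let L n := (picard Lam T0' w n).1.
Let Y := Wm + 2 * B.
Let B0 : 0 <= B := B_ge0 wW WB.
Let q0 : 0 <= q := q_ge0 Wq.

Lemma picard_wnorm_le n t : 0 <= t <= T -> wnorm (L n) t <= Y.
Proof.
move=> ht; apply: (le_trans (picard_wnorm T0' Lam0 cW wW WB Wq q2 n ht)).
by rewrite lerD2r; exact: Wbound.
Qed.

Let Y0 : 0 <= Y.
Proof.
have h : 0 <= (0 : R) <= T by apply/andP.
by apply: le_trans (picard_wnorm_le 0 h); exact: wnorm_ge0.
Qed.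

Let qn0 (C : R) : (fun n => C * q ^+ n) @ \oo --> (0 : R).
Proof.
rewrite -[X in _ --> X](mulr0 C); apply: cvgMl_tmp; apply: cvg_expr.
by rewrite ger0_norm// (le_lt_trans q2)// invf_lt1// ltr1n.
Qed.

Lemma picard_sum_incr n t (G : cterm T -> R) : 0 <= t <= T ->
  (forall p, `|G p| <= `|p t| * 2 ^+ freq p) ->
  `|\sum_(p <- L n.+1) G p - \sum_(p <- L n) G p| <= B * q ^+ n.
Proof.
move=> ht hG; rewrite /L /= big_cat/= addrAC subrr add0r.
apply: le_trans (picard_incr T0' Lam0 cW wW WB Wq q2 n ht).
by apply: (le_trans (ler_norm_sum _ _ _)); apply: ler_sum.
Qed.

Definition psol t y : R := limn (fun n => rep (L n) (fun p => p t) y).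

Lemma term_le (p : cterm T) t th : `|p t * cos ((freq p)%:R * th)| <= `|p t| * 2 ^+ freq p.
Proof.
rewrite normrM ler_wpM2l//; apply: (le_trans (norm_cos_le1 _)).
by rewrite exprn_ege1// ler1n.
Qed.

Lemma psol_cvg t y : 0 <= t <= T ->
  cvgn (fun n => rep (L n) (fun p => p t) y) /\
  forall n, `|psol t y - rep (L n) (fun p => p t) y| <= 2 * B * q ^+ n.
Proof.
move=> ht; have [|c h] := geometric_cvg (a := fun n => rep (L n) (fun p => p t) y) B0 q0 q2.
  move=> n; rewrite !repE; apply: (picard_sum_incr _ ht) => p; exact: term_le.
by split => // n; rewrite distrC.
Qed.

Lemma psol_dist t y n : 0 <= t <= T ->
  `|psol t y - rep (L n) (fun p => p t) y| <= 2 * B * q ^+ n.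
Proof. by move=> ht; have [_] := psol_cvg y ht. Qed.

Lemma tame_rep l a : tame M (rep l a).
Proof. exact: tame_cosum. Qed.

Lemma tame_psol t : 0 <= t <= T -> tame M (psol t).
Proof.
move=> ht; apply: (tame_lim (fun n => tame_rep (L n) (fun p => p t)) (qn0 (2 * B))).
by move=> n y; exact: psol_dist.
Qed.

Lemma psol_in_Cs t : 0 <= t <= T -> in_Cs M phi 2 (psol t).
Proof.
move=> ht; have [h1 h2 h3] := tame_psol ht; split=> //.
apply: (@le_lt_trans _ _ (8 * N%:R ^+ 2 * Y)%:E); last exact: ltry.
apply: norm_Cs_le => [|j x].
  by rewrite mulr_ge0// mulr_ge0// exprn_ge0.
apply: (multiplier_lim_le (admissible_lp M j cp)
  (fun n => tame_rep (L n) (fun p => p t)) (tame_psol ht) (qn0 (2 * B))).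
  by move=> n y; exact: psol_dist.
apply: nearW => n; apply: (le_trans (lp_rep _ _ _ _)).
rewrite ler_wpM2r ?invr_ge0 ?exprn_ge0// ler_wpM2l ?mulr_ge0 ?exprn_ge0//.
exact: picard_wnorm_le.
Qed.

Let dn n t t' := \sum_(p <- L n) `|p t' - p t| * 2 ^+ freq p.

(** The increments after the n-th one contribute at most twice their norm. *)
Lemma dn_le n m t t' : 0 <= t <= T -> 0 <= t' <= T ->
  dn (n + m) t t' <= dn n t t' + 4 * B * q ^+ n * (1 - 2^-1 ^+ m).
Proof.
move=> ht ht'; elim: m => [|m IH]; first by rewrite addn0 expr0 subrr mulr0 addr0.
rewrite addnS /dn /L /= big_cat/= -/(L _).
have h : \sum_(p <- (picard Lam T0' w (n + m)).2) `|p t' - p t| * 2 ^+ freq p <=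
    2 * B * q ^+ n * 2^-1 ^+ m.
  apply: (@le_trans _ _ (wnorm (picard Lam T0' w (n + m)).2 t' + wnorm (picard Lam T0' w (n + m)).2 t)).
    rewrite /wnorm -big_split/=; apply: ler_sum => p _.
    by rewrite -mulrDl ler_wpM2r ?exprn_ge0// ler_normB.
  have i1 := picard_incr T0' Lam0 cW wW WB Wq q2 (n + m) ht.
  have i2 := picard_incr T0' Lam0 cW wW WB Wq q2 (n + m) ht'.
  apply: (le_trans (lerD i2 i1)); rewrite exprD.
  have qm : q ^+ m <= 2^-1 ^+ m by rewrite lerXn2r// nnegrE.
  have := ler_wpM2l (mulr_ge0 B0 (exprn_ge0 n q0)) qm.
  by move: (q ^+ n) (q ^+ m) (2^-1 ^+ m) => a b c; lra.
apply: (le_trans (lerD IH h)); rewrite (exprS (2^-1)) /dn.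
by move: (\sum_(p <- L n) _) (q ^+ n) (2^-1 ^+ m) => a b c; lra.
Qed.

(** The norm of C^2 is controlled uniformly in j by the distance [dn] between the
amplitudes at the two times. That distance is small for a fixed iterate because
the amplitudes are continuous, and the tail is uniformly small. *)
Lemma psol_continuous t : 0 <= t <= T ->
  norm_Cs M phi 2 (psol t' \- psol t) @[t' --> within `[0, T] (nbhs t)] --> 0%E.
Proof.
move=> ht; apply: ereal_cvg0 => [t'|e e0]; first exact: norm_Cs_ge0.
pose D : R := 8 * N%:R ^+ 2.
have D0 : 0 < D by rewrite mulr_gt0// exprn_gt0// ltr0n.
have e2 : 0 < e / D / 2 by rewrite !divr_gt0.
have /cvgrPdist_lt /(_ _ e2)[m _ /(_ m (leqnn m))] := qn0 (4 * B).
rewrite /= sub0r normrN ger0_norm ?mulr_ge0 ?exprn_ge0// => qm.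
have cdn : dn m t t' @[t' --> within `[0, T] (nbhs t)] --> (0 : R).
  have E : \sum_(p <- L m) `|p t - p t| * 2 ^+ freq p = 0.
    by rewrite big1// => p _; rewrite subrr normr0 mul0r.
  rewrite -[X in _ --> X]E.
  apply: cvg_rsum => p; apply: cvgMr_tmp; apply: cvg_norm.
  apply: cvgB; last exact: cvg_cst.
  have /subspace_continuousP := @amp_cont _ _ p; apply.
  by rewrite /= in_itv.
have /cvgrPdist_lt /(_ _ e2) near1 := cdn.
have near2 : \forall t' \near within `[0, T] (nbhs t), 0 <= t' <= T.
  by apply: filterS (withinT _ _) => t' /=; rewrite in_itv.
apply: filterS2 near1 near2 => t' h1 ht'.
rewrite sub0r normrN in h1; have h1' := le_lt_trans (ler_norm _) h1.
apply: norm_Cs_le => [|j x]; first exact: ltW.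
have tg n : tame M (rep (L n) (fun p => p t' - p t)) by exact: tame_rep.
have tf : tame M (psol t' \- psol t).
  have := tame_lincomb (-1) (tame_psol ht) (tame_psol ht'); congr tame.
  by apply/funext => y /=; rewrite mulN1r addrC.
have fg n y : `|(psol t' \- psol t) y - rep (L n) (fun p => p t' - p t) y| <=
    4 * B * q ^+ n.
  have d1 := psol_dist y n ht; have d2 := psol_dist y n ht'.
  have -> : rep (L n) (fun p => p t' - p t) y =
     rep (L n) (fun p => p t') y - rep (L n) (fun p => p t) y.
    by rewrite /rep /cosum -sumrB; apply: eq_bigr => p _; rewrite mulrBl.
  rewrite /=; set a := psol t' y; set b := psol t y.
  set a' := rep _ _ _; set b' := rep _ _ _.
  have -> : a - b - (a' - b') = (a - a') - (b - b') by ring.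
  apply: (le_trans (ler_normB _ _)); apply: (le_trans (lerD d2 d1)); lra.
apply: (multiplier_lim_le (admissible_lp M j cp) tg tf (qn0 (4 * B)) fg).
exists m => // n /= mn; apply: (le_trans (lp_rep _ _ _ _)).
rewrite ler_wpM2r ?invr_ge0 ?exprn_ge0//.
have := dn_le m (n - m) ht ht'; rewrite subnKC// => hdn.
have : dn n t t' <= e / D.
  apply: (le_trans hdn).
  have h3 : 4 * B * q ^+ m * (1 - 2^-1 ^+ (n - m)) <= 4 * B * q ^+ m.
    by rewrite ler_piMr ?mulr_ge0 ?exprn_ge0// lerBlDr lerDl exprn_ge0.
  by move: h3 h1' qm; lra.
by rewrite -/D -/(dn n t t') -ler_pdivlMl// mulrC.
Qed.

Hypothesis wheat : forall t th, 0 <= t <= T -> csum w t th =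
  \sum_(p <- w) p 0 * expR (- (lam Lam p * t)) * cos ((freq p)%:R * th).

(** At time 0 all Duhamel integrals are empty. *)
Lemma psol0 y : psol 0 y = rep w (fun p => p 0) y.
Proof.
rewrite /psol (_ : (fun n => _) = fun=> rep w (fun p => p 0) y); first exact: lim_cst.
apply/funext => -[//|n]; rewrite !repE /csum /L sum_picard -/(csum _ _ _) -/(csum _ _ _).
by rewrite csum_duh// tint_0 oppr0 addr0.
Qed.

Section Duhamel.
Variables (t : R) (x : 'rV[R]_d).
Hypothesis ht : 0 <= t <= T.
Let tT : t <= T. Proof. by case/andP: ht. Qed.
Let th := N%:R * x 0 i0.

Let inT s : 0 <= s <= t -> 0 <= s <= T.
Proof. by move=> /andP[-> st]; exact: le_trans tT. Qed.

Let Qn n s := \sum_(p <- lmul3 (L n) (L n) (L n))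
  p s * expR (- (lam Lam p * (t - s))) * cos ((freq p)%:R * th).
Let Qlim s := limn (Qn^~ s).
Let C3 := 3 * Y ^+ 2 * B.

Lemma picard_duhamel n :
  rep (L n.+1) (fun p => p t) x = csum w t th - tint t (Qn n).
Proof. by rewrite repE /csum /L sum_picard -/(csum _ _ _) -/(csum _ _ _) csum_duh. Qed.

(** Only times s <= t occur, for which the heat factors are at most 1. *)
Lemma nonlin_cvg s : 0 <= s <= t ->
  cvgn (Qn^~ s) /\ forall n, `|Qn n s - Qlim s| <= 2 * C3 * q ^+ n.
Proof.
move=> hs; apply: geometric_cvg => //.
  by rewrite /C3 mulr_ge0// mulr_ge0// sqr_ge0.
move=> n; rewrite /Qn {1 2 3}/L /= sum_lincr -/(L n) addrAC subrr add0r.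
apply: (le_trans (ler_norm_sum _ _ _)).
have hN := wnorm_lincr (l := L n) (r := (picard Lam T0' w n).2) (t := s) (Y := Y).
have hY : wnorm (L n) s + wnorm (picard Lam T0' w n).2 s <= Y.
  by have := picard_wnorm_le n.+1 (inT hs); rewrite /L /= wnorm_cat.
have hR := picard_incr T0' Lam0 cW wW WB Wq q2 n (inT hs).
apply: (@le_trans _ _ (wnorm (lincr (L n) (picard Lam T0' w n).2) s)); last first.
  apply: (le_trans (hN hY)); rewrite /C3 -[leRHS]mulrA ler_wpM2l//.
  by rewrite mulr_ge0// sqr_ge0.
apply: ler_sum => p _; rewrite mulrAC normrM.
apply: (@le_trans _ _ (`|p s| * 2 ^+ freq p * 1)); last by rewrite mulr1.
apply: ler_pM => //; first exact: term_le.
rewrite ger0_norm ?expR_ge0// -[leRHS]expR0 ler_expR oppr_le0.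
by rewrite mulr_ge0 ?lam_ge0// subr_ge0; case/andP: hs.
Qed.

Lemma Tcont_lim (g : nat -> R -> R) f (e : nat -> R) :
  (forall n, Tcont t (g n)) -> e @ \oo --> 0 ->
  (forall n s, 0 <= s <= t -> `|f s - g n s| <= e n) -> Tcont t f.
Proof.
move=> cg e0 fg; apply/subspace_continuousP => s; rewrite /= in_itv/= => hs.
apply/cvgrPdist_lt => r r0; have r3 : 0 < r / 3 by rewrite divr_gt0.
move/cvgrPdist_lt: e0 => /(_ _ r3)[n _ /(_ n (leqnn n))] /=.
rewrite sub0r normrN => en; have en' : e n < r / 3 := le_lt_trans (ler_norm _) en.
have /subspace_continuousP/(_ s) := cg n; rewrite /= in_itv/= => /(_ hs).
move/cvgrPdist_lt => /(_ _ r3) near1.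
have near2 : \forall s' \near within `[0, t] (nbhs s), 0 <= s' <= t.
  by apply: filterS (withinT _ _) => s' /=; rewrite in_itv.
apply: filterS2 near1 near2 => s' hy hs'.
have -> : f s - f s' = (f s - g n s) + (g n s - g n s') + (g n s' - f s') by ring.
apply: (le_lt_trans (ler_normD _ _)).
apply: (le_lt_trans (lerD (ler_normD _ _) (lexx _))).
have h1 := fg n s hs; have h2 := fg n s' hs'; rewrite distrC in h2.
by move: h1 h2 hy en'; lra.
Qed.

Let Tcont_Qn n : Tcont t (Qn n).
Proof.
apply: Tcont_sum => p; apply: TcontM; last exact: Tcont_cst.
apply: TcontM; last exact: exp_cont.
apply: continuous_subspaceW (@amp_cont _ _ p).
by apply: subset_itvl; rewrite bnd_simp.
Qed.

Let Tcont_Qlim : Tcont t Qlim.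
Proof.
apply: (Tcont_lim Tcont_Qn (qn0 (2 * C3))) => n s hs.
by rewrite distrC; have [_] := nonlin_cvg hs.
Qed.

(** The limit of the Duhamel formula of the iterates, in which the integrands
converge uniformly on [0, t]. *)
Lemma psol_duhamel_real : psol t x = csum w t th - tint t Qlim.
Proof.
have [ca _] := psol_cvg x ht.
have h1 : (fun n => rep (L n.+1) (fun p => p t) x) @ \oo --> psol t x.
  rewrite (cvg_shiftS (fun n => rep (L n) (fun p => p t) x)); exact: ca.
apply: (cvg_unique (@Rhausdorff R) h1).
rewrite (_ : (fun n => _) = fun n => csum w t th - tint t (Qn n)); last first.
  by apply/funext => n; exact: picard_duhamel.
apply: cvgB; first exact: cvg_cst.
have t0 : 0 <= t by case/andP: ht.
have e0 : (fun n => 2 * C3 * t * q ^+ n) @ \oo --> (0 : R) by exact: qn0.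
apply/cvgrPdist_le => e ep; move/cvgrPdist_le: e0 => /(_ _ ep).
apply: filterS => n; rewrite sub0r normrN => hn.
apply: le_trans (le_trans (ler_norm _) hn).
have cD : Tcont t (fun s => Qlim s + -1 * Qn n s).
  by apply: TcontD => //; apply: TcontM => //; exact: Tcont_cst.
have -> : tint t Qlim - tint t (Qn n) = tint t (fun s => Qlim s + -1 * Qn n s).
  rewrite (tint_D (lexx t))//; last by apply: TcontM => //; exact: Tcont_cst.
  by rewrite (tint_Z _ (lexx t))// mulN1r.
apply: (le_trans (norm_tint (lexx t) cD)).
rewrite mulrAC -(tint_cst _ t0).
apply: (le_tint (lexx t)); [exact: Tcont_norm|exact: Tcont_cst|move=> s hs].
by rewrite mulN1r distrC; have [_] := nonlin_cvg hs.
Qed.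

Lemma psol_le s y : 0 <= s <= T -> `|psol s y| <= Y + 2 * B.
Proof.
move=> hs; rewrite -[psol s y](subrK (rep (L 0) (fun p => p s) y)) addrC.
apply: (le_trans (ler_normD _ _)); apply: lerD.
  by rewrite repE; apply: (le_trans (csum_le_wnorm _ _ _)); exact: picard_wnorm_le.
by have := psol_dist y 0 hs; rewrite expr0 mulr1.
Qed.

Lemma cube_dist (a b K : R) : `|a| <= K -> `|b| <= K ->
  `|a ^+ 3 - b ^+ 3| <= 3 * K ^+ 2 * `|a - b|.
Proof.
move=> aK bK; have -> : a ^+ 3 - b ^+ 3 = (a * a + a * b + b * b) * (a - b) by ring.
rewrite normrM ler_wpM2r//; apply: (le_trans (ler_normD _ _)).
apply: (le_trans (lerD (ler_normD _ _) (lexx _))); rewrite !normrM.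
have h1 : `|a| * `|a| <= K ^+ 2 by rewrite expr2 ler_pM.
have h2 : `|a| * `|b| <= K ^+ 2 by rewrite expr2 ler_pM.
have h3 : `|b| * `|b| <= K ^+ 2 by rewrite expr2 ler_pM.
lra.
Qed.

Lemma rep_cube l s y : rep (lmul3 l l l) (fun p => p s) y = rep l (fun p => p s) y ^+ 3.
Proof. by rewrite !repE /lmul3 !csum_lmul !exprS expr0 mulr1 mulrA. Qed.

(** The bound of an admissible multiplier is not uniform in t - s, so it only serves
to identify the limit for fixed s; the rate of convergence needed to integrate
in s comes from [nonlin_cvg]. *)
Lemma heat_cube s : 0 <= s <= t ->
  heat M (t - s) (fun y => psol s y ^+ 3) x = (Qlim s)%:C.
Proof.
move=> hs; have hsT := inT hs; have [cQ _] := nonlin_cvg hs.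
have ts0 : 0 <= t - s by rewrite subr_ge0; case/andP: hs.
have rE n : heat M (t - s) (rep (lmul3 (L n) (L n) (L n)) (fun p => p s)) x = (Qn n s)%:C.
  by rewrite heat_rep.
have tf : tame M (fun y => psol s y ^+ 3).
  have h := tame_psol hsT; have := tameM (tameM h h) h; congr tame.
  by apply/funext => y; rewrite !exprS expr0 mulr1 mulrA.
have fg n y : `|psol s y ^+ 3 - rep (lmul3 (L n) (L n) (L n)) (fun p => p s) y| <=
    3 * (Y + 2 * B) ^+ 2 * (2 * B) * q ^+ n.
  rewrite rep_cube; apply: (le_trans (cube_dist (psol_le y hsT) _)).
    rewrite repE; apply: (le_trans (csum_le_wnorm _ _ _)).
    by apply: (le_trans (picard_wnorm_le n hsT)); rewrite lerDl mulr_ge0.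
  rewrite -[leRHS]mulrA; apply: ler_wpM2l; last exact: psol_dist.
  by rewrite mulr_ge0// sqr_ge0.
have [ts|ts] := eqVneq (t - s) 0.
  rewrite /heat ts eqxx; congr (_%:C); apply/esym/(cvg_lim (@Rhausdorff R)).
  have := qn0 (3 * (Y + 2 * B) ^+ 2 * (2 * B)) => e0.
  apply/cvgrPdist_le => e ep; move/cvgrPdist_le: e0 => /(_ _ ep).
  apply: filterS => n; rewrite sub0r normrN => hn.
  apply: le_trans (le_trans (ler_norm _) hn); apply: le_trans (fg n x).
  have := rE n; rewrite /heat ts eqxx => -[] ->.
  exact: lexx.
have tpos : 0 < t - s by rewrite lt_neqAle eq_sym ts.
rewrite /heat (negbTE ts).
apply: (multiplier_lim_real (admissible_heat M tpos)
  (fun n => tame_rep (lmul3 (L n) (L n) (L n)) (fun p => p s)) tf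
  (qn0 (3 * (Y + 2 * B) ^+ 2 * (2 * B))) fg (a := Qn^~ s)); last exact: cQ.
by move=> n; have := rE n; rewrite /heat (negbTE ts).
Qed.

Lemma psol_duhamel : (psol t x)%:C = heat M t (psol 0) x -
  cintegral (leb R) `[0, t] (fun s => heat M (t - s) (fun y => psol s y ^+ 3) x).
Proof.
have t0 : 0 <= t by case/andP: ht.
rewrite (_ : psol 0 = rep w (fun p => p 0)); last by apply/funext => y; exact: psol0.
rewrite heat_rep// -(wheat _ ht) psol_duhamel_real rmorphB; congr (_ - _).
rewrite /cintegral; apply/esym; congr (_ +i* _).
  apply: eq_Rintegral => s /set_mem /=; rewrite in_itv/= => hs.
  by rewrite heat_cube.
transitivity (Rintegral (leb R) `[0, t] (fun=> 0)).
  apply: eq_Rintegral => s /set_mem /=; rewrite in_itv/= => hs.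
  by rewrite heat_cube.
by rewrite /Rintegral integral0.
Qed.
End Duhamel.

Lemma psol_solution : solution M phi T 2 psol.
Proof.
split => // [t ht|t ht|t x ht]; first exact: psol_in_Cs.
  exact: psol_continuous.
exact: psol_duhamel.
Qed.

End Picard.
End SolutionOfLists.

(** * The initial data and their resonance *)

Section ExponentialIntegral.
Context {R : realType}.

Lemma tint_exp (a T : R) : 0 < a -> 0 < T ->
  tint T (fun s => expR (- (a * s))) = (1 - expR (- (a * T))) / a.
Proof.
move=> a0 T0; pose G (s : R) := - a^-1 * expR (- a * s).
have dG (s : R) : is_derive s 1 G (expR (- (a * s))).
  have := is_deriveZ (- a^-1) (is_derive1_comp (is_derive_expR _) (is_derive_mulr (- a) s)).
  move=> h; apply: (is_derive_ext h) => //=; rewrite /GRing.scale/= [- a * s]mulNr.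
  by field; rewrite gt_eqF.
have cG (s : R) : {for s, continuous G}.
  by apply: differentiable_continuous; apply/derivable1_diffP; exact: ex_derive.
rewrite /tint /Rintegral (@continuous_FTC2 _ _ G)//=.
- by rewrite /G mulr0 expR0 ![- a * _]mulNr; field; rewrite gt_eqF.
- apply: continuous_subspaceT; apply: (continuous_compose _ (@continuous_expR R)) => s.
  by apply: cvgN; apply: cvgM; [exact: cvg_cst|exact: cvg_id].
- split.
  + by move=> x _; exact: ex_derive.
  + by apply: cvg_at_right_filter; exact: cG.
  + by apply: cvg_at_left_filter; exact: cG.
- by move=> x _; rewrite derive1E; exact: derive_val.
Qed.

Lemma tint_exp_le (a T : R) : 0 < a -> 0 < T -> tint T (fun s => expR (- (a * s))) <= a^-1.
Proof.
by move=> a0 T0; rewrite tint_exp// ler_pdivrMr// mulVf ?gt_eqF// gerBl//.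
Qed.

Lemma tint_exp_ge (a T : R) : 0 < a -> 0 < T -> 1 <= a * T ->
  2^-1 / a <= tint T (fun s => expR (- (a * s))).
Proof.
move=> a0 T0 aT; rewrite tint_exp// ler_wpM2r ?invr_ge0 ?(ltW a0)//.
have h : expR (- (a * T)) <= 2^-1.
  rewrite expRN lef_pV2 ?posrE ?expR_gt0//.
  by apply: le_trans (expR_ge1Dx _); lra.
lra.
Qed.

Lemma Tcont_exp (T a : R) : Tcont T (fun s => expR (- (a * s))).
Proof.
apply: Tcont_continuous; apply: (continuous_compose _ (@continuous_expR R)) => s.
by apply: cvgN; apply: cvgM; [exact: cvg_cst|exact: cvg_id].
Qed.
End ExponentialIntegral.

Lemma seq_sum_ge (R : realType) (r : seq nat) j (F : nat -> R) :
  j \in r -> (forall i, 0 <= F i) -> F j <= \sum_(i <- r) F i.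
Proof. by move=> jr F0; rewrite (big_rem j)//= lerDl sumr_ge0. Qed.

Lemma sum_iota_const (R : realType) n (c : R) : \sum_(k <- iota 0 n) c = n%:R * c.
Proof. by rewrite big_const_seq count_predT size_iota iter_addr_0 mulr_natl. Qed.

Section InitialData.
Context {R : realType}.
Variables (T r delta : R) (m K : nat).
Hypotheses (T0 : 0 < T) (r1 : 1 <= r) (r3 : r ^+ 3 = 4) (delta0 : 0 < delta).
Let T0' : 0 <= T := ltW T0.
Let Lam : R := (2 ^ m)%:R ^+ 2.
Let r0 : 0 < r := lt_le_trans ltr01 r1.

Let LamE : Lam = 4 ^+ m.
Proof. by rewrite /Lam natrX -exprM mulnC exprM; congr (_ ^+ _); rewrite expr2; lra. Qed.

Lemma wave_cont k : Tcont T (fun t => delta * r ^+ (m + k) * expR (- (4 ^+ (m + k) * t))).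
Proof. by apply: TcontM; [exact: Tcont_cst|exact: Tcont_exp]. Qed.

(** The frequency 2^k is relative to th = 2^m x_i0, so that the wave is
delta r^j cos(2^j x_i0) with j = m + k, evolved by the heat flow. *)
Definition wave k : cterm T := CTerm (@wave_cont k) (2 ^ k).
Definition data : seq (cterm T) := [seq wave k | k <- iota 0 K.+1].
Definition data_size : R := delta * K.+1%:R * r ^+ K * 2 ^+ (2 ^ K).

Lemma wave_ge0 k t : 0 <= wave k t.
Proof. by rewrite /= !mulr_ge0 ?expR_ge0 ?exprn_ge0 ?(ltW delta0) ?(ltW r0). Qed.

Lemma data_size_ge0 : 0 <= data_size.
Proof. by rewrite /data_size !mulr_ge0 ?exprn_ge0 ?(ltW delta0) ?(ltW r0). Qed.

(** All waves are bounded by the largest amplitude, the slowest decay and the largest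
weight; the dependence on m is only in r^m and in the decay. *)
Lemma wnorm_data t : 0 <= t -> wnorm data t <= data_size * r ^+ m * expR (- (4 ^+ m * t)).
Proof.
move=> t0; rewrite /wnorm big_map.
apply: (@le_trans _ _ (\sum_(k <- iota 0 K.+1) (delta * r ^+ K * 2 ^+ (2 ^ K)) *
    (r ^+ m * expR (- (4 ^+ m * t))))); last first.
  rewrite sum_iota_const /data_size le_eqVlt; apply/orP; left; apply/eqP; ring.
rewrite big_seq_cond [leRHS]big_seq_cond; apply: ler_sum => k.
rewrite mem_iota /= add0n ltnS andbT => kK.
rewrite ger0_norm; last exact: wave_ge0.
rewrite /= exprD.
have e1 : expR (- (4 ^+ (m + k) * t)) <= expR (- (4 ^+ m * t)).
  rewrite ler_expR lerN2 ler_wpM2r// exprD ler_peMr ?exprn_ge0//.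
  by rewrite exprn_ege1//; lra.
have e2 : r ^+ k <= r ^+ K by rewrite ler_weXn2l.
have e3 : 2 ^+ (2 ^ k) <= 2 ^+ (2 ^ K) :> R.
  by rewrite ler_weXn2l ?leq_pexp2l//; lra.
have -> : delta * (r ^+ m * r ^+ k) * expR (- (4 ^+ (m + k) * t)) * 2 ^+ (2 ^ k) =
  delta * r ^+ m * ((r ^+ k * 2 ^+ (2 ^ k)) * expR (- (4 ^+ (m + k) * t))) by ring.
have -> : delta * r ^+ K * 2 ^+ (2 ^ K) * (r ^+ m * expR (- (4 ^+ m * t))) =
  delta * r ^+ m * ((r ^+ K * 2 ^+ (2 ^ K)) * expR (- (4 ^+ m * t))) by ring.
have x0 k' : 0 <= r ^+ k' by rewrite exprn_ge0// ltW.
rewrite ler_wpM2l ?mulr_ge0 ?(ltW delta0)//.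
by apply: ler_pM; rewrite ?mulr_ge0 ?exprn_ge0 ?expR_ge0 ?(ltW r0)//; apply: ler_pM; rewrite ?exprn_ge0 ?(ltW r0).
Qed.

Definition data_bound t : R := data_size * r ^+ m * expR (- (4 ^+ m * t)).

Lemma Tcont_W : Tcont T data_bound.
Proof. by apply: TcontM; [exact: Tcont_cst|exact: Tcont_exp]. Qed.

Lemma data_bound_le t : 0 <= t -> data_bound t <= data_size * r ^+ m.
Proof.
move=> t0; rewrite /data_bound ler_piMr//.
  by apply: mulr_ge0; [exact: data_size_ge0|rewrite exprn_ge0// ltW].
by rewrite -[leRHS]expR0 ler_expR oppr_le0 mulr_ge0 ?exprn_ge0.
Qed.

Let p4 k : 0 < 4 ^+ k :> R. Proof. by rewrite exprn_gt0. Qed.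

Let r3m k : (r ^+ k) ^+ 3 = 4 ^+ k.
Proof. by rewrite -exprM mulnC exprM r3. Qed.

(** Since (r^m)^3 = 4^m, the growth of the amplitude is exactly compensated by the
time scale 4^(-m). *)
Lemma tint_W3 : tint T (fun t => data_bound t ^+ 3) <= data_size ^+ 3.
Proof.
have -> : tint T (fun t => data_bound t ^+ 3) =
    data_size ^+ 3 * 4 ^+ m * tint T (fun t => expR (- (3 * 4 ^+ m * t))).
  rewrite -(tint_Z _ (lexx T)); last exact: Tcont_exp.
  congr tint; apply/funext => t; rewrite /data_bound exprMn [(data_size * _) ^+ 3]exprMn r3m -expRM_natl.
  by congr (_ * expR _); ring.
have a0 : 0 < 3 * 4 ^+ m :> R by rewrite mulr_gt0.
apply: (@le_trans _ _ (data_size ^+ 3 * 4 ^+ m * (3 * 4 ^+ m)^-1)).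
  apply: ler_wpM2l; last exact: tint_exp_le.
  by apply: mulr_ge0; [exact/exprn_ge0/data_size_ge0|exact: ltW].
have -> : data_size ^+ 3 * 4 ^+ m * (3 * 4 ^+ m)^-1 = data_size ^+ 3 * 3^-1 by field; rewrite gt_eqF.
by rewrite ler_piMr//; [exact/exprn_ge0/data_size_ge0|lra].
Qed.

(** Here (r^m)^2 / 4^m = r^(-m), which is where large m helps. *)
Lemma tint_W2 (B : R) : tint T (fun t => 3 * (data_bound t + 2 * B) ^+ 2) <=
  3 * data_size ^+ 2 / r ^+ m + 24 * B ^+ 2 * T.
Proof.
have cW := Tcont_W; have cc (c : R) : Tcont T (fun=> c) by exact: Tcont_cst.
have c1 : Tcont T (fun t => 6 * (data_size ^+ 2 * (r ^+ m) ^+ 2) * expR (- (2 * 4 ^+ m * t))).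
  by apply: TcontM => //; exact: Tcont_exp.
apply: (@le_trans _ _ (tint T (fun t => 6 * (data_size ^+ 2 * (r ^+ m) ^+ 2) *
   expR (- (2 * 4 ^+ m * t)) + 24 * B ^+ 2))).
  apply: (le_tint (lexx T)).
  - by apply: TcontM => //; apply: TcontM; apply: TcontD.
  - exact: TcontD.
  move=> t _; have -> : 6 * (data_size ^+ 2 * (r ^+ m) ^+ 2) * expR (- (2 * 4 ^+ m * t)) =
      6 * data_bound t ^+ 2.
    have gen (a b c : R) : (a * b * c) ^+ 2 = a ^+ 2 * b ^+ 2 * c ^+ 2 by ring.
    by rewrite /data_bound gen -expRM_natl [RHS]mulrA; congr (_ * expR _); ring.
  have := sqr_ge0 (data_bound t - 2 * B); lra.
rewrite (tint_D (lexx T))// (tint_Z _ (lexx T)); last exact: Tcont_exp.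
rewrite (tint_cst _ T0') lerD2r.
have a0 : 0 < 2 * 4 ^+ m :> R by rewrite mulr_gt0.
apply: (@le_trans _ _ (6 * (data_size ^+ 2 * (r ^+ m) ^+ 2) * (2 * 4 ^+ m)^-1)).
  apply: ler_wpM2l; last exact: tint_exp_le.
  by rewrite mulr_ge0// mulr_ge0// sqr_ge0.
rewrite -r3m; have rm : 0 < r ^+ m by rewrite exprn_gt0.
by rewrite le_eqVlt; apply/orP; left; apply/eqP; field; rewrite gt_eqF.
Qed.

Lemma data_heat t th : 0 <= t <= T -> csum data t th =
  \sum_(p <- data) p 0 * expR (- (lam Lam p * t)) * cos ((freq p)%:R * th).
Proof.
have E k : lam Lam (wave k) = 4 ^+ (m + k).
  rewrite /lam LamE exprD; congr (_ * _); rewrite -[freq _]/(2 ^ k)%N natrX.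
  rewrite -exprM mulnC exprM; congr (_ ^+ _); rewrite expr2; lra.
move=> _; rewrite /csum !big_map; apply: eq_bigr => k _; rewrite E; congr (_ * _).
by rewrite -[amp _ t]/(delta * _ * _) -[amp _ 0]/(delta * _ * _) mulr0 oppr0 expR0 mulr1.
Qed.

(** The mean over th of the function represented by a list. *)
Definition zmode (l : seq (cterm T)) t : R := \sum_(p <- l) (freq p == 0%N)%:R * p t.

Lemma zmode_data t : zmode data t = 0.
Proof.
rewrite /zmode big_map big1// => k _ /=.
by rewrite expn_eq0 /= mul0r.
Qed.

(** Among the products of three waves, those of the waves k, k and k + 1 contain a
term of frequency 2^k + 2^k - 2^(k+1) = 0. Since r^3 = 4 its time integral is
independent of k and m once 4^m T >= 1, and every other term of frequency 0 has
a nonnegative amplitude. *)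
Lemma zmode_resonance : 1 <= 4 ^+ m * T ->
  zmode (map (duh Lam T0') (lmul3 data data data)) T <= - (K%:R * (delta ^+ 3 / 48)).
Proof.
move=> mT; rewrite /zmode big_map.
pose G (p : cterm T) : R := (freq p == 0%N)%:R * tint T p.
have -> : \sum_(p <- lmul3 data data data) (freq (duh Lam T0' p) == 0%N)%:R * duh Lam T0' p T
    = - \sum_(p <- lmul3 data data data) G p.
  rewrite -sumrN; apply: eq_bigr => p _; rewrite duhE// /G /= mulrN; congr (- _).
  case: eqP => [p0|_]; last by rewrite !mul0r.
  congr (_ * _); apply: tint_eq => s _.
  by rewrite /lam p0 expr0n /= mulr0 mul0r oppr0 expR0 mulr1.
rewrite lerN2 /lmul3 sum_lmul.
pose H x := \sum_(q <- data) (G (tmul_add x q) + G (tmul_sub x q)).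
rewrite -/(\sum_(x <- lmul data data) H x) (sum_lmul _ _ H).
have pos2 a b : forall s, 0 <= 2^-1 * (wave a s * wave b s).
  by move=> s; apply: mulr_ge0 => //; apply: mulr_ge0; exact: wave_ge0.
have G0 (p q : cterm T) : (forall s, 0 <= p s) -> (forall s, 0 <= q s) ->
    0 <= G (tmul_add p q) /\ 0 <= G (tmul_sub p q).
  by move=> hp hq; split; apply: mulr_ge0 => //; apply: tint_ge0 => s _ /=; apply: mulr_ge0 => //; exact: mulr_ge0.
have H0 (x : cterm T) : (forall s, 0 <= x s) -> 0 <= H x.
  move=> hx; rewrite /H big_map sumr_ge0// => k _.
  have [h1 h2] := G0 x (wave k) hx (wave_ge0 k).
  exact: addr_ge0.
rewrite big_map.
have low k : (k < K)%N -> delta ^+ 3 / 48 <=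
    \sum_(q <- data) (H (tmul_add (wave k) q) + H (tmul_sub (wave k) q)).
  move=> kK; rewrite big_map.
  have ha i : 0 <= H (tmul_add (wave k) (wave i)) by apply: H0; exact: pos2.
  have hs i : 0 <= H (tmul_sub (wave k) (wave i)) by apply: H0; exact: pos2.
  apply: le_trans (seq_sum_ge (j := k) _ _); last 2 first.
  - by rewrite mem_iota /= add0n ltnS ltnW.
  - by move=> i; exact: addr_ge0.
  apply: (@le_trans _ _ (H (tmul_add (wave k) (wave k)))); last by rewrite lerDl.
  rewrite /H big_map.
  have gg i := G0 (tmul_add (wave k) (wave k)) (wave i) (pos2 k k) (wave_ge0 i).
  apply: le_trans (seq_sum_ge (j := k.+1) _ _); last 2 first.
  - by rewrite mem_iota /= add0n ltnS.
  - by move=> i; have [h1 h2] := gg i; exact: addr_ge0.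
  apply: (@le_trans _ _ (G (tmul_sub (tmul_add (wave k) (wave k)) (wave k.+1)))); last first.
    by rewrite lerDr; have [] := gg k.+1.
  rewrite /G /=.
  rewrite (_ : _ == _ = true) ?mul1r; last first.
    by rewrite expnS mul2n addnn subnn.
  have -> : tint T (fun t => 2^-1 * (2^-1 *
      (delta * r ^+ (m + k) * expR (- (4 ^+ (m + k) * t)) *
       (delta * r ^+ (m + k) * expR (- (4 ^+ (m + k) * t)))) *
     (delta * r ^+ (m + k.+1) * expR (- (4 ^+ (m + k.+1) * t))))) =
     (4^-1 * delta ^+ 3 * r * 4 ^+ (m + k)) *
      tint T (fun t => expR (- (6 * 4 ^+ (m + k) * t))).
    rewrite -(tint_Z _ (lexx T)); last exact: Tcont_exp.
    congr tint; apply/funext => t.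
    have E6 : expR (- (6 * 4 ^+ (m + k) * t)) = expR (- (4 ^+ (m + k) * t)) *
       expR (- (4 ^+ (m + k) * t)) * expR (- (4 * 4 ^+ (m + k) * t)).
      by rewrite -!expRD; congr expR; ring.
    rewrite E6 addnS [r ^+ _.+1]exprS [4 ^+ _.+1]exprS.
    set e1 := expR (- (4 ^+ (m + k) * t)); set e2 := expR _; rewrite -(r3m (m + k)).
    by field.
  have a0 : 0 < 6 * 4 ^+ (m + k) :> R by rewrite mulr_gt0.
  have aT : 1 <= 6 * 4 ^+ (m + k) * T.
    apply: (le_trans mT); rewrite ler_wpM2r// exprD mulrCA ler_peMr ?exprn_ge0//.
    have : 1 <= 4 ^+ k :> R by rewrite exprn_ege1//; lra.
    lra.
  have := tint_exp_ge a0 T0 aT => hJ.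
  apply: (@le_trans _ _ ((4^-1 * delta ^+ 3 * r * 4 ^+ (m + k)) * (2^-1 / (6 * 4 ^+ (m + k))))); last first.
    by rewrite ler_wpM2l// !mulr_ge0 ?exprn_ge0 ?(ltW delta0) ?(ltW r0).
  have -> : (4^-1 * delta ^+ 3 * r * 4 ^+ (m + k)) * (2^-1 / (6 * 4 ^+ (m + k))) =
     delta ^+ 3 / 48 * r by field; rewrite gt_eqF.
  by rewrite ler_peMr// divr_ge0// exprn_ge0// ltW.
have -> : K%:R * (delta ^+ 3 / 48) = \sum_(k <- iota 0 K) (delta ^+ 3 / 48).
  by rewrite sum_iota_const.
have -> : iota 0 K.+1 = iota 0 K ++ [:: K] by rewrite -{1}addn1 iotaD.
rewrite big_cat/= -[leLHS]addr0; apply: lerD.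
  rewrite big_seq_cond [leRHS]big_seq_cond; apply: ler_sum => k.
  by rewrite mem_iota add0n andbT /=; exact: low.
rewrite big_seq1 big_map sumr_ge0// => i _.
by rewrite addr_ge0//; apply: H0; exact: pos2.
Qed.

End InitialData.

(** * The zero mode, the initial norm and the theorem *)

Section ZeroMode.
Context {R : realType} {d : nat}.
Variables (i0 : 'I_d) (M : flat_space) (phi : 'rV[R]_d -> R).
Hypothesis cp : lp_cutoff phi.
Local Open Scope complex_scope.
Variables (T : R) (N : nat).
Hypotheses (T0 : 0 < T) (N2 : (2 <= N)%N).
Let Lam : R := N%:R ^+ 2.
Let T0' : 0 <= T := ltW T0.
Let N0 : (0 < N)%N := ltnW N2.
Let Lam0 : 0 <= Lam. Proof. exact: sqr_ge0. Qed.

(** The cutoff is 1 at frequency 0 and vanishes at all other frequencies, which are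
at least N >= 2. *)
Lemma lp0_rep (l : seq (cterm T)) t x :
  lp_proj M phi 0 (rep i0 N l (fun p => p t)) x = (zmode l t)%:C.
Proof.
rewrite /lp_proj /rep multiplier_cosum; last exact: admissible_lp.
congr (_%:C); apply: eq_bigr => p _ /=; have [_ _ _ o1 z2] := cp.
rewrite /nfreq mulrAC mulrC; case: eqP => [->|/eqP p0].
  by rewrite muln0 mul0r cos0 scale0r o1 ?mulr1 ?mul1r// /enorm dot0l sqrtr0.
rewrite z2 ?mul0r// axis_enorm ler_nat (leq_trans N2)// leq_pmulr// lt0n.
exact: p0.
Qed.

Variables (w : seq (cterm T)) (W : R -> R) (B q : R).
Hypotheses (cW : Tcont T W) (wW : forall t, 0 <= t <= T -> wnorm w t <= W t)
  (WB : tint T (fun t => W t ^+ 3) <= B)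
  (Wq : tint T (fun t => 3 * (W t + 2 * B) ^+ 2) <= q) (q2 : q <= 2^-1).

Lemma zmode_le (l : seq (cterm T)) t : `|zmode l t| <= wnorm l t.
Proof.
apply: (le_trans (ler_norm_sum _ _ _)); apply: ler_sum => p _.
rewrite normrM mulrC ler_wpM2l//; apply: (@le_trans _ _ 1).
  by case: (_ == _); rewrite ?normr1 ?normr0.
by rewrite exprn_ege1// ler1n.
Qed.

Lemma zmode_cat (l l' : seq (cterm T)) t : zmode (l ++ l') t = zmode l t + zmode l' t.
Proof. by rewrite /zmode big_cat. Qed.

(** The zero modes of the increments R_i with i >= 1 are at most B q^i. *)
Lemma zmode_picard n : zmode (picard Lam T0' w n.+1).1 T <=
  zmode w T + zmode (map (duh Lam T0') (lmul3 w w w)) T + 2 * B * q * (1 - 2^-1 ^+ n).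
Proof.
have B0 := B_ge0 wW WB; have q0 := q_ge0 Wq.
have hT : 0 <= T <= T by rewrite T0' lexx.
elim: n => [|n IH]; first by rewrite expr0 subrr mulr0 addr0 -zmode_cat.
rewrite -[picard _ _ _ n.+2]/(_, _) zmode_cat.
have h := picard_incr T0' Lam0 cW wW WB Wq q2 n.+1 hT.
have h2 := le_trans (ler_norm _) (le_trans (zmode_le _ _) h).
apply: (le_trans (lerD IH h2)).
have qn : q ^+ n <= 2^-1 ^+ n by rewrite lerXn2r// nnegrE.
have := ler_wpM2l (mulr_ge0 B0 q0) qn.
rewrite !exprS; set X := q ^+ n; set Z := 2^-1 ^+ n; lra.
Qed.

Lemma Linf_psol (K : R) :
  zmode w T + zmode (map (duh Lam T0') (lmul3 w w w)) T + 2 * B * q <= - K ->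
  (K%:E <= norm_Linfty M (lp_proj M phi 0 (psol i0 N T0 w T)))%E.
Proof.
move=> hK; apply: Linf_ge => x.
have B0 := B_ge0 wW WB; have q0 := q_ge0 Wq.
have hT : 0 <= T <= T by rewrite T0' lexx.
have e0 : (fun n => 2 * B * q ^+ n) @ \oo --> (0 : R).
  rewrite -[X in _ --> X](mulr0 (2 * B)); apply: cvgMl_tmp; apply: cvg_expr.
  by rewrite ger0_norm// (le_lt_trans q2)// invf_lt1// ltr1n.
apply: (multiplier_lim_ge (admissible_lp M 0 cp)
  (fun n => tame_rep i0 M N (picard Lam T0' w n).1 (fun p => p T))
  (tame_psol i0 M N T0 cW wW WB Wq q2 hT) e0).
  by move=> n y; exact: (psol_dist i0 N T0 cW wW WB Wq q2).
exists 1%N => // -[//|n] _ /=.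
rewrite -/(lp_proj M phi 0 _) lp0_rep normc_real.
rewrite -normrN; apply: le_trans (ler_norm _); rewrite lerNr.
apply: (le_trans (zmode_picard n)); apply: le_trans hK.
rewrite lerD2l ler_piMr ?mulr_ge0// lerBlDr lerDl exprn_ge0//.
Qed.

End ZeroMode.

Section InitialNorm.
Context {R : realType} {d : nat}.
Variables (i0 : 'I_d) (M : flat_space) (phi : 'rV[R]_d -> R).
Hypothesis cp : lp_cutoff phi.
Local Open Scope complex_scope.

(** At dyadic frequencies the blocks do not overlap: a cutoff is 1 up to |xi| = 1 and
0 from |xi| = 2 on, so its values at dyadic points are 0 and 1. *)
Lemma lp_symbol_dyadic (i j : nat) : (0 < i)%N ->
  `|lp_symbol phi j ((2 ^ i)%:R *: delta_mx 0 i0)| <= (i == j)%:R.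
Proof.
move=> i_gt0; have [->|ij] := eqVneq i j; first exact: lp_symbol_bound.
have eE : enorm ((2 ^ i)%:R *: delta_mx 0 i0 : 'rV[R]_d) = 2 ^+ i.
  by rewrite axis_enorm natrX.
have [lt_ji|le_ij] := ltnP j i.
  by rewrite lp_symbol_zero ?normr0// eE -exprS ler_weXn2l// ler1n.
case: j => [|j] in ij le_ij *; first by rewrite leqn0 in le_ij; rewrite (eqP le_ij) in i_gt0.
rewrite lp_symbol_low ?normr0// eE ler_weXn2l ?ler1n//.
by rewrite -ltnS ltn_neqAle ij.
Qed.

Lemma sum_iota_delta n a (c : R) : 0 <= c ->
  \sum_(k <- iota 0 n) (k == a)%:R * c <= c.
Proof.
move=> c0; have : \sum_(k <- iota 0 n) (k == a)%:R * c = (a < n)%:R * c.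
  elim: n => [|n IH]; first by rewrite big_nil mul0r.
  have -> : iota 0 n.+1 = iota 0 n ++ [:: n] by rewrite -{1}addn1 iotaD.
  rewrite big_cat big_seq1 IH /= -mulrDl ltnS; congr (_ * _).
  by case: (ltngtP a n); rewrite ?addr0 ?add0r.
by move=> ->; case: (a < n)%N; rewrite ?mul1r ?mul0r.
Qed.

Variables (T r delta : R) (m K : nat).
Hypotheses (r1 : 1 <= r) (delta0 : 0 < delta) (m0 : (0 < m)%N).
Let r0 : 0 < r := lt_le_trans ltr01 r1.

Lemma lp_data j x :
  Normc.normc (lp_proj M phi j (rep i0 (2 ^ m) (data T r delta m K) (fun p => p 0)) x) <=
  delta * r ^+ j.
Proof.
have c0 : 0 <= delta * r ^+ j by rewrite mulr_ge0 ?exprn_ge0// ltW.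
rewrite /lp_proj /rep multiplier_cosum ?normc_real; last exact: admissible_lp.
rewrite /cosum big_map; apply: (le_trans (ler_norm_sum _ _ _)).
apply: le_trans (@sum_iota_delta K.+1 (j - m)%N _ c0); apply: ler_sum => k _.
rewrite normrM -[leRHS]mulr1; apply: ler_pM => //; last exact: norm_cos_le1.
rewrite normrM ger0_norm; last exact: wave_ge0.
rewrite -[amp _ 0]/(delta * _ * _) mulr0 oppr0 expR0 mulr1.
rewrite -[nfreq _ _]/(2 ^ m * 2 ^ k)%N -expnD.
have mk : (0 < m + k)%N by rewrite addn_gt0 m0.
apply: (@le_trans _ _ (delta * r ^+ (m + k) * (m + k == j)%:R)).
  by rewrite ler_wpM2l ?lp_symbol_dyadic// mulr_ge0 ?exprn_ge0// ltW.
case: eqP => [<-|_]; last by rewrite mulr0 mulr_ge0.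
by rewrite mulr1 addKn eqxx mul1r.
Qed.

(** The exponent 2/3 of r is compensated by 2^(j s) because s <= -2/3. *)
Lemma norm_Cs_data (s : R) : r = 2 `^ (2 / 3) -> s <= - (2 / 3) ->
  (norm_Cs M phi s (rep i0 (2 ^ m) (data T r delta m K) (fun p => p 0%R)) <= delta%:E)%E.
Proof.
move=> rE hs; apply: ge_ereal_sup => _ [j _ <-].
have h : (norm_Linfty M (lp_proj M phi j
    (rep i0 (2 ^ m) (data T r delta m K) (fun p => p 0%R))) <= (delta * r ^+ j)%:E)%E.
  apply: Linf_le => [|x]; last exact: lp_data.
  by rewrite mulr_ge0 ?exprn_ge0// ltW.
apply: (@le_trans _ _ ((2 `^ (j%:R * s))%:E * (delta * r ^+ j)%:E)%E).
  by rewrite lee_wpmul2l// lee_fin powR_ge0.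
rewrite -EFinM lee_fin mulrCA ler_piMr ?(ltW delta0)//.
have -> : r ^+ j = 2 `^ (j%:R * (2 / 3)).
  by rewrite rE -powR_mulrn ?powR_ge0// -powRrM [_ * j%:R]mulrC.
rewrite -powRD; last by apply/implyP => _; rewrite pnatr_eq0.
rewrite -mulrDr -[leRHS](@powRr0 _ 2); apply: ler_powR; first by rewrite ler1n.
by rewrite mulr_ge0_le0//; lra.
Qed.
End InitialNorm.

Theorem theorem1p1 (R : realType) (d : nat) (d_gt0 : (0 < d)%N) (M : flat_space)
    (phi : 'rV[R]_d -> R) (phi_cutoff : lp_cutoff phi)
    (s : R) (s_le : s <= - (2 / 3)) (eps : R) (eps_gt0 : 0 < eps) :
  exists (T s0 : R) (u : R -> 'rV[R]_d -> R) (t : R),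
    [/\ solution M phi T s0 u,
        0 < t < eps,
        t <= T,
        (norm_Cs M phi s (u 0%R) < eps%:E)%E &
        ((eps^-1)%R%:E < norm_Linfty M (lp_proj M phi 0 (u t)))%E].
Proof.
pose i0 : 'I_d := Ordinal d_gt0.
pose r : R := 2 `^ (2 / 3).
have r3 : r ^+ 3 = 4.
  rewrite -powR_mulrn ?powR_ge0// -powRrM (_ : 2 / 3 * 3 = 2%:R :> R); last by field.
  by rewrite powR_mulrn// expr2; lra.
have r_gt1 : 1 < r.
  rewrite ltNge; apply/negP => r1.
  have : r ^+ 3 <= 1 by rewrite exprn_ile1 ?powR_ge0.
  by rewrite r3; lra.
have r1 := ltW r_gt1; have r0 : 0 < r := lt_trans ltr01 r_gt1.
(* order of choices: delta, the number K of waves, the bound B and the ratio q,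
   the time T, and last the base frequency 2^m *)
pose delta := eps / 2.
have delta0 : 0 < delta by rewrite divr_gt0.
have d3 : 0 < delta ^+ 3 / 48 by rewrite divr_gt0// exprn_gt0.
pose K := Num.bound ((eps^-1 + 2) / (delta ^+ 3 / 48)).
have hK : eps^-1 + 2 <= K%:R * (delta ^+ 3 / 48).
  rewrite -ler_pdivrMr//; apply/ltW/archi_boundP.
  by rewrite divr_ge0 ?(ltW d3)// addr_ge0// invr_ge0 ltW.
have CK0 : 0 <= data_size r delta K by exact: data_size_ge0.
pose B := data_size r delta K ^+ 3; have B0 : 0 <= B by rewrite exprn_ge0.
pose q := (2 + 2 * B)^-1.
have q0 : 0 < q by rewrite invr_gt0; lra.
have q2 : q <= 2^-1 by rewrite lef_pV2 ?posrE; lra.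
have Bq : 2 * B * q <= 1 by rewrite /q ler_pdivrMr; lra.
(* on [0, T] the constant 2 B contributes at most q / 2 to the ratio *)
pose T := Num.min (eps / 2) (q / (48 * B ^+ 2 + 1)).
have B2 : 0 <= B ^+ 2 by rewrite sqr_ge0.
have T0 : 0 < T by rewrite lt_min !divr_gt0//; lra.
have Te : T < eps by rewrite gt_min; apply/orP; left; lra.
have TB : 24 * B ^+ 2 * T <= q / 2.
  have : T <= q / (48 * B ^+ 2 + 1) by rewrite ge_min lexx orbT.
  rewrite ler_pdivlMr; last lra.
  by move: (B ^+ 2) T0 B2 => b T0 b0; lra.
(* r^m >= A ensures 4^m T >= 1, m > 0, and that the integral of W^2
   contributes at most q / 2 *)
pose A := T^-1 + 6 * data_size r delta K ^+ 2 / q + 2.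
have Ti : 0 < T^-1 by rewrite invr_gt0.
have C2 : 0 <= 6 * data_size r delta K ^+ 2 / q by rewrite divr_ge0 ?(ltW q0)// mulr_ge0// sqr_ge0.
have A0 : 0 < A by rewrite /A; lra.
have [m hm] : exists m, A < r ^+ m.
  have cr : (fun n => r^-1 ^+ n) @ \oo --> (0 : R).
    by apply: cvg_expr; rewrite ger0_norm ?invf_lt1// invr_ge0 ltW.
  have Ai : 0 < A^-1 by rewrite invr_gt0.
  move/cvgrPdist_lt: cr => /(_ _ Ai)[n _ /(_ n (leqnn n))] /=.
  rewrite sub0r normrN exprVn gtr0_norm ?invr_gt0 ?exprn_gt0// => h; exists n.
  by rewrite -ltf_pV2 ?posrE ?exprn_gt0.
have rm0 : 0 < r ^+ m by rewrite exprn_gt0.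
have m0 : (0 < m)%N.
  by rewrite lt0n; apply/negP => /eqP E; move: hm; rewrite E expr0 /A; lra.
have mT : 1 <= 4 ^+ m * T.
  rewrite -ler_pdivrMr// mul1r.
  have : r ^+ m <= 4 ^+ m.
    rewrite lerXn2r ?nnegrE ?(ltW r0)// -r3 -[leLHS]expr1.
    by apply: ler_weXn2l.
  by move: hm; rewrite /A; lra.
pose w := data T r delta m K.
pose W := data_bound r delta m K.
have cW : Tcont T W by exact: Tcont_W.
have wW t : 0 <= t <= T -> wnorm w t <= W t.
  by case/andP => t0 _; apply: wnorm_data.
have WB : tint T (fun t => W t ^+ 3) <= B by exact: tint_W3.
have Wq : tint T (fun t => 3 * (W t + 2 * B) ^+ 2) <= q.
  apply: (le_trans (tint_W2 delta m K T0 r1 r3 B)).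
  have : 3 * data_size r delta K ^+ 2 / r ^+ m <= q / 2.
    rewrite ler_pdivrMr//.
    have : 6 * data_size r delta K ^+ 2 / q <= r ^+ m by move: hm; rewrite /A; lra.
    by rewrite ler_pdivrMr//; lra.
  by move: TB; lra.
have Wb t : 0 <= t <= T -> W t <= data_size r delta K * r ^+ m.
  by case/andP => t0 _; apply: data_bound_le.
have N0 : (0 < 2 ^ m)%N by rewrite expn_gt0.
have N2 : (2 <= 2 ^ m)%N by rewrite -[X in (X <= _)%N](expn1 2) leq_exp2l.
have wh t th : 0 <= t <= T -> csum w t th =
    \sum_(p <- w) p 0 * expR (- (lam ((2 ^ m)%:R ^+ 2) p * t)) * cos ((freq p)%:R * th).
  exact: data_heat.
exists T, 2, (psol i0 (2 ^ m) T0 w), T; split.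
- exact: (psol_solution i0 M phi_cutoff T0 N0 cW wW WB Wq q2 Wb wh).
- by rewrite T0.
- exact: lexx.
- apply: (@le_lt_trans _ _ delta%:E); last by rewrite lte_fin /delta; lra.
  rewrite (_ : psol _ _ _ _ 0 = rep i0 (2 ^ m) w (fun p => p 0)).
    exact: norm_Cs_data.
  by apply/funext => y; exact: psol0.
- apply: (@lt_le_trans _ _ (eps^-1 + 1)%:E); first by rewrite lte_fin ltrDl.
  apply: (Linf_psol i0 M phi_cutoff N2 cW wW WB Wq q2).
  rewrite zmode_data add0r.
  have := @zmode_resonance R T r delta m K T0 r1 r3 delta0 mT.
  by move: hK Bq; lra.
Qed.
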